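(* Let $K$ be a field, $f:\mathbb Z_{\ge0}\to\mathbb R_{\ge0}$ with $\lim_{n\to\infty}f(n)/n=0$, and $B=\bigoplus_{n\ge0}B_n$ an integral graded $K$-algebra of finite type over $K$, generated as $K$-algebra by $B_1$. Suppose: (i) the Krull dimension $\dim B$ is $>0$; (ii) for every $n\ge1$, $B_n$ carries a separated, exhaustive and left continuous $\mathbb R$-filtration making $B$ an $f$-quasi-filtered graded $K$-algebra; (iii) $\limsup_{n\to\infty}\sup_{0\ne a\in B_n}\lambda(a)/n<+\infty$. For $n\ge1$ let $\nu_n=T_{1/n}\nu_{B_n}$. Then (1) $\lim_{n\to\infty}\frac1n\min_{0\ne a\in B_n}\lambda(a)$ exists in $\mathbb R$; (2) the supports of the $\nu_n$ ($n\ge1$) are contained in a common bounded interval and $(\nu_n)_{n\ge1}$ converges vaguely to a Borel probability measure on $\mathbb R$.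
   Context: Filtrations: a decreasing family $(\mathcal F_rW)_{r\in\mathbb R}$ of subspaces; separated: $\bigcap_r\mathcal F_rW=0$; exhaustive: $\bigcup_r\mathcal F_rW=W$; left continuous: $\mathcal F_rW=\bigcap_{s<r}\mathcal F_sW$. Index: $\lambda(x)=\sup\{r:x\in\mathcal F_rW\}$. For nonzero finite-dimensional $W$, $\nu_W$ is the Borel probability measure with $\nu_W([r,+\infty[)=\dim\mathcal F_rW/\dim W$. $T_\varepsilon\nu$ is the image of $\nu$ under $x\mapsto\varepsilon x$. Vague convergence: convergence of integrals of all continuous compactly supported functions. $B$ (with filtrations $(B_{n,s})_s$) is $f$-quasi-filtered if there is $n_0\ge0$ such that for all $r>0$, $(n_i)\in\mathbb Z_{\ge n_0}^r$, $(s_i)\in\mathbb R^r$: $B_{n_1,s_1}\cdots B_{n_r,s_r}\subseteq B_{N,S}$, $N=\sum n_i$, $S=\sum(s_i-f(n_i))$. *)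

(* Defs.v *)
From Stdlib Require Import Reals ClassicalDescription.
From HB Require Import structures.
From mathcomp Require Import all_boot all_order all_algebra.

Set Implicit Arguments.
Unset Strict Implicit.
Unset Printing Implicit Defensive.

Section Alg.
Local Open Scope ring_scope.
Variable K : fieldType.

Definition is_subspace (V : lmodType K) (S : V -> Prop) : Prop :=
  S 0 /\ (forall x y, S x -> S y -> S (x + y)) /\ (forall (k : K) x, S x -> S (k *: x)).

Definition in_span (V : lmodType K) (S : V -> Prop) (x : V) : Prop :=
  exists (vs : seq V) (ks : seq K),
    (forall i, (i < size vs)%N -> S vs`_i) /\ x = \sum_(i < size vs) ks`_i *: vs`_i.

Definition lin_indep (V : lmodType K) (vs : seq V) : Prop :=
  forall ks : seq K, size ks = size vs ->
    \sum_(i < size vs) ks`_i *: vs`_i = 0 -> forall i, (i < size vs)%N -> ks`_i = 0.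

Definition has_dim (V : lmodType K) (S : V -> Prop) (d : nat) : Prop :=
  is_subspace S /\
  exists vs : seq V, size vs = d /\ (forall i, (i < size vs)%N -> S vs`_i) /\
    lin_indep vs /\
    (forall x, S x -> exists ks : seq K, x = \sum_(i < size vs) ks`_i *: vs`_i).

Definition integral_domain (B : comAlgType K) : Prop :=
  (1 : B) <> 0 /\ forall a b : B, a * b = 0 -> a = 0 \/ b = 0.

Definition graded (B : comAlgType K) (Bn : nat -> B -> Prop) : Prop :=
  (forall n, is_subspace (Bn n)) /\
  (forall m n a b, Bn m a -> Bn n b -> Bn (m + n)%N (a * b)) /\
  Bn 0%N 1 /\
  (forall x : B, exists (N : nat) (c : nat -> B),
      (forall i, Bn i (c i)) /\ x = \sum_(i < N) c i) /\
  (forall (N : nat) (c : nat -> B), (forall i, Bn i (c i)) ->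
      \sum_(i < N) c i = 0 -> forall i, (i < N)%N -> c i = 0).

Inductive in_subalg (B : comAlgType K) (S : B -> Prop) : B -> Prop :=
| sa_gen x : S x -> in_subalg S x
| sa_one : in_subalg S 1
| sa_add x y : in_subalg S x -> in_subalg S y -> in_subalg S (x + y)
| sa_mul x y : in_subalg S x -> in_subalg S y -> in_subalg S (x * y)
| sa_scale (k : K) x : in_subalg S x -> in_subalg S (k *: x).

Definition finite_type (B : comAlgType K) : Prop :=
  exists s : seq B, forall x, in_subalg (fun y => y \in s) x.

Definition generated_by (B : comAlgType K) (S : B -> Prop) : Prop :=
  forall x, in_subalg S x.

Definition is_ideal (B : comAlgType K) (I : B -> Prop) : Prop :=
  I 0 /\ (forall x y, I x -> I y -> I (x + y)) /\ (forall a x, I x -> I (a * x)).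

Definition is_prime_ideal (B : comAlgType K) (I : B -> Prop) : Prop :=
  is_ideal I /\ ~ I 1 /\ (forall a b, I (a * b) -> I a \/ I b).

Definition krull_dim_pos (B : comAlgType K) : Prop :=
  exists p q : B -> Prop, is_prime_ideal p /\ is_prime_ideal q /\
    (forall x, p x -> q x) /\ (exists x, q x /\ ~ p x).

Definition filtration_on (B : comAlgType K) (W : B -> Prop) (Fr : R -> B -> Prop) : Prop :=
  (forall r, is_subspace (Fr r) /\ (forall x, Fr r x -> W x)) /\
  (forall r s, Rle r s -> forall x, Fr s x -> Fr r x) /\
  (forall x, (forall r, Fr r x) -> x = 0) /\
  (forall x, W x -> exists r, Fr r x) /\
  (forall r x, Fr r x <-> (forall s, Rlt s r -> Fr s x)).

Definition prod_set (B : comAlgType K) (F : nat -> R -> B -> Prop)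
    (l : seq (nat * R)) (y : B) : Prop :=
  exists xs : seq B, size xs = size l /\
    (forall i, (i < size l)%N -> F (nth (0%N, R0) l i).1 (nth (0%N, R0) l i).2 xs`_i) /\
    y = \prod_(i < size l) xs`_i.

Definition quasi_filtered (B : comAlgType K) (f : nat -> R)
    (F : nat -> R -> B -> Prop) : Prop :=
  exists n0 : nat, forall l : seq (nat * R), (0 < size l)%N ->
    (forall i, (i < size l)%N -> (n0 <= (nth (0%N, R0) l i).1)%N) ->
    forall x, in_span (prod_set F l) x ->
      F (sumn (map fst l))
        (foldr (fun p acc => Rplus (Rminus p.2 (f p.1)) acc) R0 l) x.

Definition lambda_is (B : comAlgType K) (Fr : R -> B -> Prop) (a : B) (l : R) : Prop :=
  is_lub (fun r => Fr r a) l.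

Definition is_min_lambda (B : comAlgType K) (Bn : nat -> B -> Prop)
    (F : nat -> R -> B -> Prop) (n : nat) (m : R) : Prop :=
  (exists a, Bn n a /\ a <> 0 /\ lambda_is (F n) a m) /\
  (forall a l, Bn n a -> a <> 0 -> lambda_is (F n) a l -> Rle m l).

Definition limsup_lambda_finite (B : comAlgType K) (Bn : nat -> B -> Prop)
    (F : nat -> R -> B -> Prop) : Prop :=
  exists (C : R) (N : nat), forall n, (N <= n)%N -> (1 <= n)%N ->
    forall a l, Bn n a -> a <> 0 -> lambda_is (F n) a l -> Rle (Rdiv l (INR n)) C.

End Alg.

Local Open Scope R_scope.

Inductive borel : (R -> Prop) -> Prop :=
| borel_open (a b : R) : borel (fun x => a < x < b)
| borel_compl (A : R -> Prop) : borel A -> borel (fun x => ~ A x)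
| borel_cunion (A : nat -> R -> Prop) : (forall k, borel (A k)) -> borel (fun x => exists k, A k x)
| borel_ext (A A' : R -> Prop) : (forall x, A x <-> A' x) -> borel A -> borel A'.

Definition prob_measure (mu : (R -> Prop) -> R) : Prop :=
  (forall A, borel A -> 0 <= mu A) /\
  mu (fun _ => True) = 1 /\
  (forall A : nat -> R -> Prop, (forall k, borel (A k)) ->
     (forall i j x, i <> j -> A i x -> A j x -> False) ->
     infinite_sum (fun k => mu (A k)) (mu (fun x => exists k, A k x))).

Definition indic (A : R -> Prop) (x : R) : R :=
  if excluded_middle_informative (A x) then 1 else 0.

Definition simple_below (mu : (R -> Prop) -> R) (h : R -> R) (v : R) : Prop :=
  exists l : seq (R * (R -> Prop)),
    (forall i, (i < size l)%nat -> 0 <= (nth (0, fun _ => False) l i).1 /\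
                                  borel (nth (0, fun _ => False) l i).2) /\
    (forall i j x, (i < j)%nat -> (j < size l)%nat ->
        (nth (0, fun _ => False) l i).2 x -> (nth (0, fun _ => False) l j).2 x -> False) /\
    (forall x, foldr (fun p acc => p.1 * indic p.2 x + acc) 0 l <= h x) /\
    v = foldr (fun p acc => p.1 * mu p.2 + acc) 0 l.

Definition integral_nonneg (mu : (R -> Prop) -> R) (h : R -> R) (I : R) : Prop :=
  is_lub (simple_below mu h) I.

Definition integral (mu : (R -> Prop) -> R) (g : R -> R) (I : R) : Prop :=
  exists I1 I2, integral_nonneg mu (fun x => Rmax (g x) 0) I1 /\
                integral_nonneg mu (fun x => Rmax (- g x) 0) I2 /\ I = I1 - I2.

Definition compact_support (g : R -> R) : Prop :=
  exists M, forall x, M < Rabs x -> g x = 0.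

Definition vague_cv (nu : nat -> (R -> Prop) -> R) (mu : (R -> Prop) -> R) : Prop :=
  forall g, continuity g -> compact_support g ->
    exists (In : nat -> R) (I : R),
      (forall n, (1 <= n)%nat -> integral (nu n) g (In n)) /\
      integral mu g I /\ Un_cv In I.

Definition in_support (mu : (R -> Prop) -> R) (x : R) : Prop :=
  forall eps, 0 < eps -> 0 < mu (fun y => x - eps < y < x + eps).

Definition pushT (eps : R) (nu : (R -> Prop) -> R) : (R -> Prop) -> R :=
  fun A => nu (fun y => A (eps * y)).

(* nu = nu_W for the filtration (F_r) of the nonzero finite-dim space W *)
Definition is_nu_W (K : fieldType) (B : comAlgType K) (W : B -> Prop)
    (Fr : R -> B -> Prop) (nu : (R -> Prop) -> R) : Prop :=
  prob_measure nu /\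
  forall r d d', has_dim (Fr r) d -> has_dim W d' ->
    nu (fun x => r <= x) = INR d / INR d'.

(* Main.v *)
Require Import Defs.
From Stdlib Require Import Reals Classical ClassicalDescription Lra Lia.
From HB Require Import structures.
From mathcomp Require Import all_boot all_order all_algebra zify.
From mathcomp Require ring boolp all_classical all_reals all_analysis Rstruct Rstruct_topology.

(* The tail function of [nu_n] at [t] is the dimension of [F_(nt) B_n] divided by that of [B_n], so
   everything rests on comparing these dimensions for different [n].

   Dividing by powers of some [z0] in [B_1] embeds the graded pieces in a field [E]. Choose among the
   quotients [z / z0], [z] in [B_1], a transcendence basis [Y_1, .., Y_e]; then [dim B_n = O(n ^ e)].
   A valuation ring of [E] for which the monomials in the [Y_i] are ordered lexicographically gives
   every nonzero element of [B_n] a value in [(1/q) Z^e], with one [q] for all [n].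

   Let [V] in [B_m] have dimension [D]. Cut [Z^e] into cells of side [a q] and classes modulo [q]. If
   [k = 1] modulo [q], a vector [x] of [V] whose value lies in a given cell and class, raised to the
   power [k] and multiplied by monomials in the [Y_i], realises every point of that class in the
   [k]-dilated cell. Hence the products of [k] elements of [V] with elements of [B_g], [g >= 2 e k a],
   span at least [k ^ e D] dimensions. As the filtration is bounded below on [B_g] by a multiple of
   [g], taking [a / m] small yields [dim F_(n(t - eps)) B_n / n ^ e >= dim F_(mt) B_m / m ^ e - eta]
   for [m] large and [n] large compared with [m]. Therefore the tails converge wherever their limit
   inferior is continuous, and the limit measure is the image of Lebesgue measure on [0, 1] under
   the corresponding quantile function.

   The minima of [lambda] are almost superadditive, since [B_N] is spanned by products of elements
   of the [B_(n_i)]; their convergence is Fekete's lemma. *)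

Set Implicit Arguments.
Unset Strict Implicit.
Unset Printing Implicit Defensive.

(** * Linear algebra *)

Section LinearAlgebra.
Import GRing.Theory.
Local Open Scope ring_scope.
Variables (K : fieldType) (V : lmodType K).

(** The field $K$ is arbitrary, so the residue field of the valuation may be larger than $K$ and
    independent elements may share a value: counting values does not count dimensions. This shapes
    two choices. A basis of $V$ is made orthogonal for the valuation ([adapted]), so that elements
    of equal value do not cancel. And the products are not powers $x^k$ but $x^{k-1}x'$, where $x$
    is fixed for each cell and class while $x'$ runs through all basis elements of the same value;
    the multiplicity of that value is thus carried to every point realised. If $x$ has the most
    frequent value among the $(a+1)^e$ points of its class in its cell, then $D$ is at most
    $(a+1)^e$ times the number of basis elements retained, whereas each of these is paired with
    $(k(a+1))^e$ points of the dilated cell; the quotient is the factor $k^e$. Only $k+1$ filtered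
    factors occur, so the loss of level is $kf(m)+f(g)$, small against $n=km+g$ because $f(m)/m$ and
    $g/n$ are small. *)

Definition findep (I : finType) (b : I -> V) : Prop :=
  forall c : I -> K, \sum_i c i *: b i = 0 -> forall i, c i = 0.

Definition fspan (I : finType) (b : I -> V) (x : V) : Prop :=
  exists c : I -> K, x = \sum_i c i *: b i.

Lemma subspace_sum (S : V -> Prop) (I : finType) (c : I -> K) (b : I -> V) :
  is_subspace S -> (forall i, S (b i)) -> S (\sum_i c i *: b i).
Proof.
move=> [S0 [SD SZ]] Sb; apply: (big_ind S) => // i _; exact: SZ.
Qed.

Lemma fspan_subspace (I : finType) (b : I -> V) : is_subspace (fspan b).
Proof.
split; [|split].
- by exists (fun=> 0); rewrite big1 // => i _; rewrite scale0r.
- move=> _ _ [c ->] [d ->]; exists (fun i => c i + d i).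
  by rewrite -big_split; apply: eq_bigr => i _; rewrite scalerDl.
- move=> k _ [c ->]; exists (fun i => k * c i).
  by rewrite scaler_sumr; apply: eq_bigr => i _; rewrite scalerA.
Qed.

Lemma fspan_mem (I : finType) (b : I -> V) i : fspan b (b i).
Proof.
exists (fun j => (j == i)%:R); rewrite (bigD1 i) //= eqxx scale1r big1 ?addr0 //.
by move=> j /negPf ->; rewrite scale0r.
Qed.

Lemma fspan_trans (I J : finType) (b : I -> V) (w : J -> V) x :
  (forall i, fspan w (b i)) -> fspan b x -> fspan w x.
Proof. by move=> bw [c ->]; apply: subspace_sum => //; exact: fspan_subspace. Qed.

Lemma findep_neq0 (I : finType) (b : I -> V) i : findep b -> b i <> 0.
Proof.
move=> fb bi0; have := fb (fun j => (j == i)%:R).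
rewrite (bigD1 i) //= eqxx bi0 scaler0 add0r big1 => [/(_ erefl i)|j /negPf ->].
  by rewrite eqxx => /eqP; rewrite oner_eq0.
by rewrite scale0r.
Qed.

Lemma findep_reindex (I J : finType) (b : I -> V) (h : J -> I) :
  injective h -> findep b -> findep (b \o h).
Proof.
move=> hI fb c cb0 j.
pose c' i := \sum_(k | h k == i) c k.
have c'h k : c' (h k) = c k.
  by rewrite /c' (big_pred1 k) // => l; rewrite /= (inj_eq hI).
rewrite -c'h; apply: fb; rewrite -[RHS]cb0.
rewrite (partition_big h predT) //=; apply: eq_bigr => i _.
by rewrite /c' scaler_suml; apply: eq_bigr => k /eqP <-.
Qed.

(** Otherwise the matrix expressing [b] in [w] has more rows than columns, and a nonzero vector of
    its left kernel is a relation among the [b i]. *)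
Lemma steinitz (I J : finType) (b : I -> V) (w : J -> V) :
  findep b -> (forall i, fspan w (b i)) -> (#|I| <= #|J|)%N.
Proof.
move=> fb /fin_all_exists [M bM]; rewrite leqNgt; apply/negP => ltJI.
pose A : 'M[K]_(#|I|, #|J|) := \matrix_(i, j) M (enum_val i) (enum_val j).
have : kermx A != 0.
  rewrite kermx_eq0 /row_free; apply/negP => /eqP rA.
  by have := rank_leq_col A; rewrite rA leqNgt ltJI.
case/rowV0Pn => u /sub_kermxP uA /negP []; apply/eqP.
apply/rowP => i; rewrite mxE.
rewrite -(enum_valK i); apply: (fb (fun i => u 0 (enum_rank i))).
under eq_bigr do rewrite bM scaler_sumr.
rewrite exchange_big /= big1 // => j _.
under eq_bigr do rewrite scalerA.
rewrite -scaler_suml.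
have -> : \sum_i u 0 (enum_rank i) * M i j = (u *m A) 0 (enum_rank j).
  rewrite mxE (reindex_omap enum_rank (fun i => Some (enum_val i))) /=.
    apply: eq_big => [k|k _]; first by rewrite enum_rankK eqxx.
    by rewrite mxE !enum_rankK.
  by move=> k _; rewrite enum_valK.
by rewrite uA mxE scale0r.
Qed.

Lemma lin_indepE (vs : seq V) :
  lin_indep vs <-> findep (fun i : 'I_(size vs) => vs`_i).
Proof.
split.
- move=> h c cv0 i.
  have := h (mkseq (fun j => if insub j is Some j then c j else 0) (size vs)).
  rewrite size_mkseq => /(_ erefl).
  have E (j : 'I_(size vs)) :
     (mkseq (fun j => if insub j is Some j then c j else 0) (size vs))`_j = c j.
    by rewrite nth_mkseq // valK.
  under eq_bigr do rewrite E.
  by move=> /(_ cv0 i (ltn_ord i)); rewrite E.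
- move=> h ks sk e0 i lti; exact: (h (fun i : 'I__ => ks`_i) e0 (Ordinal lti)).
Qed.

Lemma findep_extend n (b : 'I_n -> V) x :
  findep b -> ~ fspan b x ->
  findep (fun i : 'I_n.+1 => if unlift ord_max i is Some j then b j else x).
Proof.
move=> fb nx c; rewrite big_ord_recr /= unlift_none.
under eq_bigr => i _.
  have -> : widen_ord (leqnSn n) i = lift ord_max i.
    by apply: val_inj; rewrite /= /bump leqNgt ltn_ord.
  rewrite liftK; over.
move=> e0.
have c0 : c ord_max = 0.
  apply: NNPP => /eqP cn0; apply: nx.
  exists (fun i => - (c ord_max)^-1 * c (lift ord_max i)).
  under eq_bigr do rewrite -scalerA.
  rewrite -scaler_sumr scaleNr -scalerN.
  by move/eqP: e0; rewrite addrC addr_eq0 => /eqP <-; rewrite scalerA mulVf // scale1r.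
move=> i; case: (unliftP ord_max i) => [j ->|-> //].
by apply: (fb (fun j => c (lift ord_max j))); move: e0; rewrite c0 scale0r addr0.
Qed.

(** Without a basis inside [S], independent families in [S] could be extended indefinitely, against
    the bound [#|J|]. *)
Lemma subspace_basis (S : V -> Prop) (J : finType) (w : J -> V) :
  is_subspace S -> (forall x, S x -> fspan w x) ->
  exists d (b : 'I_d -> V), [/\ findep b, (forall i, S (b i)) & (forall x, S x -> fspan b x)].
Proof.
move=> sS Sw; apply: NNPP => nb.
have ext n : exists b : 'I_n -> V, findep b /\ (forall i, S (b i)).
  elim: n => [|n [b [fb Sb]]].
    by exists (fun=> 0); split=> [c _ []|[]].
  have [x [Sx nx]] : exists x, S x /\ ~ fspan b x.
    apply: NNPP => h; apply: nb; exists n, b; split=> // x Sx.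
    by apply: NNPP => nx; apply: h; exists x.
  eexists; split; first exact: (findep_extend fb nx).
  by move=> i /=; case: (unlift ord_max i) => [j|] /=; [apply: Sb|].
have [b [fb Sb]] := ext #|J|.+1.
have := steinitz fb (fun i => Sw _ (Sb i)).
by rewrite card_ord ltnn.
Qed.

Lemma has_dimE (S : V -> Prop) d :
  has_dim S d <-> is_subspace S /\ exists b : 'I_d -> V,
    [/\ findep b, (forall i, S (b i)) & (forall x, S x -> fspan b x)].
Proof.
split=> [[sS [vs [<- [Svs [/lin_indepE li sp]]]]]|[sS [b [fb Sb sp]]]].
  split=> //; exists (fun i => vs`_i); split=> //= [i|x /sp [ks ->]].
    exact: Svs.
  by exists (fun i : 'I__ => ks`_i).
split=> //; exists (mkseq (fun j => if insub j is Some j then b j else 0) d).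
have E (j : 'I_d) :
     (mkseq (fun j => if insub j is Some j then b j else 0) d)`_j = b j.
    by rewrite nth_mkseq // valK.
rewrite size_mkseq; split=> //; split; last split.
- by move=> i lti; rewrite -[i]/(nat_of_ord (Ordinal lti)) E.
- move=> ks; rewrite size_mkseq => _.
  under eq_bigr do rewrite E.
  by move=> e0 i lti; apply: (fb (fun i : 'I__ => ks`_i) e0 (Ordinal lti)).
- move=> x /sp [c ->]; exists (mkseq (fun j => if insub j is Some j then c j else 0) d).
  by apply: eq_bigr => i _; rewrite E nth_mkseq // valK.
Qed.

Lemma has_dim_exists (S : V -> Prop) (J : finType) (w : J -> V) :
  is_subspace S -> (forall x, S x -> fspan w x) -> exists d, has_dim S d.
Proof.
move=> sS Sw; have [d [b [fb Sb sp]]] := subspace_basis sS Sw.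
by exists d; apply/has_dimE; split=> //; exists b.
Qed.

Lemma has_dim_ge (S : V -> Prop) d (I : finType) (b : I -> V) :
  has_dim S d -> findep b -> (forall i, S (b i)) -> (#|I| <= d)%N.
Proof.
move=> /has_dimE [_ [w [_ _ sp]]] fb Sb; rewrite -[d]card_ord.
by apply: (steinitz fb) => i; exact/sp.
Qed.

End LinearAlgebra.

(** * Graded algebras generated in degree one *)

Section GradedAlgebra.
Import GRing.Theory.
Local Open Scope ring_scope.
Variables (K : fieldType) (B : comAlgType K) (Bn : nat -> B -> Prop).
Hypothesis grB : graded Bn.

Let BnS n : is_subspace (Bn n). Proof. by case: grB. Qed.
Let Bn0 n : Bn n 0. Proof. by case: (BnS n). Qed.
Let BnD n x y : Bn n x -> Bn n y -> Bn n (x + y). Proof. case: (BnS n) => _ [h _]; exact: h. Qed.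
Let BnZ n k x : Bn n x -> Bn n (k *: x). Proof. case: (BnS n) => _ [_ h]; exact: h. Qed.
Let BnN n x : Bn n x -> Bn n (- x). Proof. by rewrite -scaleN1r; exact: BnZ. Qed.

Lemma graded_mul m n a b : Bn m a -> Bn n b -> Bn (m + n)%N (a * b).
Proof. by case: grB => _ [h _]; exact: h. Qed.

Lemma graded_one : Bn 0%N 1. Proof. by case: grB => _ [_ [h _]]. Qed.

Lemma graded_exp n k a : Bn n a -> Bn (k * n)%N (a ^+ k).
Proof.
move=> ha; elim: k => [|k IH]; first by rewrite expr0; exact: graded_one.
by rewrite exprS mulSn; exact: graded_mul.
Qed.

(** The ideal $\bigoplus_{i\ge a}B_i$. Degrees may repeat in the list, so that sums are
    concatenations and products need no regrouping. *)
Definition hsum (a : nat) (x : B) : Prop :=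
  exists s : seq (nat * B), (forall p, p \in s -> (a <= p.1)%N /\ Bn p.1 p.2) /\
    x = \sum_(p <- s) p.2.

Lemma hsum0 a : hsum a 0.
Proof. by exists [::]; rewrite big_nil. Qed.

Lemma hsum_hom a n x : (a <= n)%N -> Bn n x -> hsum a x.
Proof.
move=> an Bx; exists [:: (n, x)]; rewrite big_seq1; split=> // p.
by rewrite inE => /eqP ->.
Qed.

Lemma hsumD a x y : hsum a x -> hsum a y -> hsum a (x + y).
Proof.
move=> [s [hs ->]] [t [ht ->]]; exists (s ++ t); rewrite big_cat; split=> // p.
by rewrite mem_cat => /orP[/hs|/ht].
Qed.

Lemma hsum_sum a (T : eqType) (s : seq T) (G : T -> B) :
  (forall i, i \in s -> hsum a (G i)) -> hsum a (\sum_(i <- s) G i).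
Proof.
move=> h; rewrite big_seq; apply: (big_ind (hsum a)) => //; [exact: hsum0|exact: hsumD].
Qed.

Lemma hsum_mul a b x y : hsum a x -> hsum b y -> hsum (a + b) (x * y).
Proof.
move=> [s [hs ->]] [t [ht ->]]; rewrite mulr_suml.
apply: hsum_sum => p /hs[ap Bp]; rewrite mulr_sumr.
apply: hsum_sum => q /ht[bq Bq].
by apply: (@hsum_hom _ (p.1 + q.1)%N); [exact: leq_add|exact: graded_mul].
Qed.

Lemma hsumZ a k x : hsum a x -> hsum a (k *: x).
Proof.
move=> [s [hs ->]]; rewrite scaler_sumr; apply: hsum_sum => p /hs[ap Bp].
by apply: (@hsum_hom _ p.1) => //; exact: BnZ.
Qed.

Lemma hsum_weak a b x : (a <= b)%N -> hsum b x -> hsum a x.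
Proof.
move=> ab [s [hs ->]]; exists s; split=> // p /hs[bp Bp]; split=> //.
exact: leq_trans bp.
Qed.

Lemma hsum_all x : hsum 0 x.
Proof.
case: grB => _ [_ [_ [h _]]]; have [N [c [Bc ->]]] := h x.
by apply: hsum_sum => i _; exact: (@hsum_hom _ i).
Qed.

Lemma grade_uniq (s : seq (nat * B)) :
  (forall p, p \in s -> Bn p.1 p.2) -> \sum_(p <- s) p.2 = 0 ->
  forall n, \sum_(p <- s | p.1 == n) p.2 = 0.
Proof.
move=> hs s0 n; case: grB => _ [_ [_ [_ h]]].
pose c i := \sum_(p <- s | p.1 == i) p.2.
(* [N] exceeds [n] and every degree in the list, so no term is lost when the sum is regrouped by
   degree. *)
pose N := (n + \max_(p <- s) p.1.+1).+1.
apply: (h N c) => //; last by rewrite /N; lia.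
  move=> i; rewrite /c big_seq_cond; apply: (big_ind (Bn i)) => //; first exact: BnD.
  by move=> p /andP[/hs Bp /eqP <-].
rewrite -[RHS]s0 /c (exchange_big_dep xpredT) //= big_seq [RHS]big_seq.
apply: eq_bigr => p ps.
have pN : (p.1 < N)%N.
  by rewrite /N ltnS; apply/ltnW/(leq_trans _ (leq_addl _ _)); exact: leq_bigmax_seq.
by rewrite (big_pred1 (Ordinal pN)) // => i; rewrite /= -val_eqE eq_sym.
Qed.

Lemma grade_comp n x h : Bn n x -> hsum n.+1 h -> x + h = 0 -> x = 0.
Proof.
move=> Bx [s [hs ->]] e0.
have := @grade_uniq ((n, x) :: s); rewrite big_cons; move/(_ _ e0 n).
rewrite big_cons eqxx big_seq_cond big_pred0 ?addr0; first apply.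
  by move=> p; rewrite inE => /orP[/eqP -> //|/hs[]].
move=> p /=; apply/negP => /andP[/hs[lt _] /eqP e]; by rewrite e ltnn in lt.
Qed.

Lemma in_subalg_ind_ring (S : B -> Prop) (P : B -> Prop) :
  (forall x, S x -> P x) -> P 1 -> (forall x y, P x -> P y -> P (x + y)) ->
  (forall x y, P x -> P y -> P (x * y)) -> (forall k x, P x -> P (k *: x)) ->
  forall x, in_subalg S x -> P x.
Proof. by move=> h1 h2 h3 h4 h5 x; elim=> *; auto. Qed.

Hypothesis genB : generated_by (Bn 1%N).

(** Modulo $\bigoplus_{i\ge1}B_i$, every polynomial in elements of $B_1$ is a scalar; the
    degree-zero components are then compared. *)
Lemma degree0_scalar x : Bn 0%N x -> exists k : K, x = k%:A.
Proof.
move=> Bx.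
have [k [h [hh e]]] : exists k h, hsum 1 h /\ x = k%:A + h.
  move: {Bx} x (genB x); apply: in_subalg_ind_ring.
  - by move=> y By; exists 0, y; rewrite scale0r add0r; split=> //; exact: (@hsum_hom _ 1).
  - by exists 1, 0; rewrite scale1r addr0; split=> //; exact: hsum0.
  - move=> _ _ [k [h [hh ->]]] [k' [h' [hh' ->]]]; exists (k + k'), (h + h').
    by split; [exact: hsumD|rewrite scalerDl addrACA].
  - move=> _ _ [k [h [hh ->]]] [k' [h' [hh' ->]]].
    exists (k * k'), (k *: h' + k' *: h + h * h'); split.
      apply: hsumD; last by apply: (@hsum_weak _ 2) => //; exact: (@hsum_mul 1 1).
      by apply: hsumD; exact: hsumZ.
    rewrite mulrDl !mulrDr -!scalerAl -!scalerAr !mul1r mulr1 scalerA.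
    by rewrite !addrA.
  - move=> c _ [k [h [hh ->]]]; exists (c * k), (c *: h); split; first exact: hsumZ.
    by rewrite scalerDr scalerA.
exists k; apply/eqP; rewrite -subr_eq0; apply/eqP.
apply: (@grade_comp 0 _ (- h)).
- by apply: BnD => //; apply: BnN; apply: BnZ; exact: graded_one.
- by rewrite -scaleN1r; exact: hsumZ.
- by rewrite e -addrA -opprD subrr.
Qed.

Hypothesis ftB : finite_type B.

(** The degree-one components of the algebra generators span $B_1$: modulo $\bigoplus_{i\ge2}B_i$, a
    polynomial in the generators is a scalar plus a linear combination of these components. *)
Lemma degree1_finite : exists n (z : 'I_n -> B),
  (forall i, Bn 1%N (z i)) /\ forall x, Bn 1%N x -> fspan z x.
Proof.
have dec x : exists k l h, [/\ Bn 1%N l, hsum 2 h & x = k%:A + l + h].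
  have [s [hs ->]] := hsum_all x.
  elim: s hs => [|[i y] s IH] hs.
    by exists 0, 0, 0; rewrite big_nil scale0r !addr0; split=> //; exact: hsum0.
  rewrite big_cons.
  have [|k [l [h [Bl hh ->]]]] := IH.
    by move=> p ps; apply: hs; rewrite inE ps orbT.
  have /= [_ By] := hs (i, y) (mem_head _ _).
  case: i By {hs} => [|[|i]] By.
  - have [k' ->] := degree0_scalar By.
    by exists (k' + k), l, h; rewrite scalerDl /= !addrA.
  - exists k, (y + l), h; split=> //; first exact: BnD.
    by rewrite /= !addrA [y + _]addrC.
  - exists k, l, (h + y); split=> //; last by rewrite /= addrC !addrA.
    by apply: hsumD => //; exact: (@hsum_hom _ i.+2).
have [s hs] := ftB.
have /fin_all_exists [k /fin_all_exists [z /fin_all_exists [h hz]]] :=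
  (fun i : 'I_(size s) => dec s`_i).
exists (size s), z; split=> [i|x Bx]; first by have [] := hz i.
have spZ : is_subspace (fspan z) by exact: fspan_subspace.
have [sp0 [spD spS]] := spZ.
have sp1 y : fspan z y -> Bn 1%N y.
  by move=> [c ->]; apply: subspace_sum => // i; have [] := hz i.
have [k' [l [h' [Bl hh e]]]] : exists k l h, [/\ fspan z l, hsum 2 h & x = k%:A + l + h].
  move: {Bx} x (hs x); apply: in_subalg_ind_ring.
  - move=> y ys.
    have lt : (index y s < size s)%N by rewrite index_mem.
    have [_ h2 e] := hz (Ordinal lt).
    exists (k (Ordinal lt)), (z (Ordinal lt)), (h (Ordinal lt)); split=> //.
      exact: fspan_mem.
    by rewrite -e /= nth_index.
  - exists 1, 0, 0; split=> //; first exact: hsum0.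
    by rewrite scale1r !addr0.
  - move=> _ _ [k1 [l1 [h1 [sl1 hh1 ->]]]] [k2 [l2 [h2 [sl2 hh2 ->]]]].
    exists (k1 + k2), (l1 + l2), (h1 + h2); split; [exact: spD|exact: hsumD|].
    by rewrite scalerDl; rewrite addrACA; congr (_ + _); rewrite addrACA.
  - move=> _ _ [k1 [l1 [h1 [sl1 hh1 ->]]]] [k2 [l2 [h2 [sl2 hh2 ->]]]].
    exists (k1 * k2), (k1 *: l2 + k2 *: l1),
      (l1 * l2 + (k1%:A + l1) * h2 + h1 * (k2%:A + l2 + h2)); split.
    + by apply: spD; exact: spS.
    + apply: hsumD; last by apply: (@hsum_weak _ (2 + 0)) => //; apply: hsum_mul => //; exact: hsum_all.
      apply: hsumD; last by apply: (@hsum_weak _ (0 + 2)) => //; apply: hsum_mul => //; exact: hsum_all.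
      by apply: (@hsum_hom _ 2) => //; apply: (@graded_mul 1 1); exact: sp1.
    + rewrite mulrDl [_ * (_ + h2)]mulrDr 2!addrA; congr (_ + _ + _).
      rewrite mulrDl !mulrDr -!scalerAl -!scalerAr !mul1r mulr1 scalerA.
      by rewrite !addrA.
  - move=> c _ [k1 [l1 [h1 [sl1 hh1 ->]]]].
    exists (c * k1), (c *: l1), (c *: h1); split; [exact: spS|exact: hsumZ|].
    by rewrite !scalerDr scalerA.
suff -> : x = l by [].
have k0 : k'%:A = 0 :> B.
  apply: (@grade_comp 0 _ (l - x + h')).
  - by apply: BnZ; exact: graded_one.
  - apply: hsumD; last exact: (@hsum_weak _ 2).
    by apply: (@hsum_hom _ 1) => //; apply: BnD; [exact: sp1|exact: BnN].
  - by rewrite addrAC !addrA -e subrr.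
apply/esym/eqP; rewrite -subr_eq0; apply/eqP.
apply: (@grade_comp 1 _ h') => //; first by apply: BnD; [exact: sp1|exact: BnN].
by rewrite [X in _ - X]e k0 add0r opprD addrA subrr add0r addNr.
Qed.

(** * Monomials in degree-one generators *)

Section Monomials.
Variables (J : finType) (z : J -> B).
Hypotheses (Bz : forall j, Bn 1%N (z j)) (spz : forall x, Bn 1%N x -> fspan z x).

Definition monom n (t : n.-tuple J) : B := \prod_(j <- t) z j.

Lemma monom_hom n (t : n.-tuple J) : Bn n (monom t).
Proof.
rewrite /monom; case: t => t /= /eqP <-.
elim: t => [|j t IH]; first by rewrite big_nil; exact: graded_one.
by rewrite big_cons /= -add1n; exact: graded_mul.
Qed.

Lemma monom_mul m n x y :
  fspan (@monom m) x -> fspan (@monom n) y -> fspan (@monom (m + n)) (x * y).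
Proof.
move=> [c ->] [d ->]; rewrite mulr_suml.
have [sp0 [spD spS]] := fspan_subspace (@monom (m + n)).
apply: (big_ind (fspan _)) => // t _; rewrite mulr_sumr.
apply: (big_ind (fspan _)) => // u _.
rewrite -scalerAl -scalerAr; apply: (spS _ _ (spS _ _ _)).
have -> : monom t * monom u = monom [tuple of t ++ u] by rewrite /monom big_cat.
exact: fspan_mem.
Qed.

Lemma homogeneous_monom n x : Bn n x -> fspan (@monom n) x.
Proof.
move=> Bx.
have [s [hs e]] : exists s : seq (nat * B),
    (forall p, p \in s -> fspan (@monom p.1) p.2) /\ x = \sum_(p <- s) p.2.
  move: {Bx} x (genB x); apply: in_subalg_ind_ring.
  - move=> y /spz [c e]; exists [:: (1%N, y)]; rewrite big_seq1; split=> // p.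
    rewrite inE => /eqP -> /=; rewrite e.
    apply: subspace_sum; first exact: fspan_subspace.
    move=> j; have -> : z j = monom [tuple j] by rewrite /monom big_seq1.
    exact: fspan_mem.
  - exists [:: (0%N, 1)]; rewrite big_seq1; split=> // p.
    rewrite inE => /eqP -> /=.
    have -> : 1 = monom [tuple] by rewrite /monom big_nil.
    exact: fspan_mem.
  - move=> _ _ [s [hs ->]] [t [ht ->]]; exists (s ++ t); rewrite big_cat; split=> // p.
    by rewrite mem_cat => /orP[/hs|/ht].
  - move=> _ _ [s [hs ->]] [t [ht ->]].
    exists [seq ((p.1 + q.1)%N, p.2 * q.2) | p <- s, q <- t]; split.
      by move=> _ /allpairsP[[p q] /= [/hs hp /ht hq ->]] /=; exact: monom_mul.
    rewrite big_allpairs_dep mulr_suml; apply: eq_bigr => p _.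
    by rewrite mulr_sumr.
  - move=> k _ [s [hs ->]]; exists [seq (p.1, k *: p.2) | p <- s]; split.
      move=> _ /mapP[p /hs hp ->] /=.
      by have [_ [_ h]] := fspan_subspace (@monom p.1); exact: h.
    by rewrite big_map scaler_sumr.
(* With $-x$ adjoined in degree $n$ the list sums to zero, so its terms of degree $n$ already add up
   to $x$. *)
have := @grade_uniq ((n, - x) :: s).
rewrite big_cons -e addNr => /(_ _ erefl n); rewrite big_cons eqxx => h.
have {h} /eqP : - x + \sum_(p <- s | p.1 == n) p.2 = 0.
  apply: h => p; rewrite inE => /orP[/eqP -> /=|/hs [c ->]]; first exact: BnN.
  by apply: subspace_sum => // t; exact: monom_hom.
rewrite addrC subr_eq0 => /eqP <-.
have [sp0 [spD spS]] := fspan_subspace (@monom n).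
by rewrite big_seq_cond; apply: (big_ind (fspan _)) => // p /andP[/hs hp /eqP <-].
Qed.

End Monomials.

Lemma homogeneous_dim n : exists d, has_dim (Bn n) d.
Proof.
have [p [z [Bz spz]]] := degree1_finite.
exact: has_dim_exists (BnS n) (homogeneous_monom Bz spz (n := n)).
Qed.

Lemma in_span_subspace (V : lmodType K) (S : V -> Prop) : is_subspace (in_span S).
Proof.
split; first by exists [::], [::]; split=> //; rewrite big_ord0.
split.
- move=> _ _ [vs [ks [h ->]]] [vs' [ks' [h' ->]]].
  (* [in_span] does not fix the length of the coefficient list; [mkseq] pads or truncates it to that
     of [vs] before the concatenation. *)
  exists (vs ++ vs'), (mkseq (nth 0 ks) (size vs) ++ ks'); split.
    move=> i; rewrite size_cat nth_cat => lti; case: ltnP => [|le]; first exact: h.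
    by apply: h'; rewrite ltn_subLR.
  rewrite size_cat big_split_ord /=; congr (_ + _); apply: eq_bigr => i _.
    by rewrite !nth_cat size_mkseq ltn_ord nth_mkseq.
  by rewrite !nth_cat size_mkseq ltnNge leq_addr /= addKn.
- move=> k _ [vs [ks [h ->]]]; exists vs, (map ( *%R k) ks); split=> //.
  rewrite scaler_sumr; apply: eq_bigr => i _; rewrite scalerA; congr (_ *: _).
  case: (ltnP i (size ks)) => lti; first by rewrite (nth_map 0).
  by rewrite !nth_default ?size_map // mulr0.
Qed.

Lemma in_span_mem (V : lmodType K) (S : V -> Prop) x : S x -> in_span S x.
Proof.
move=> Sx; exists [:: x], [:: 1]; split; first by case.
by rewrite big_ord1 /= scale1r.
Qed.

Lemma in_span_min (V : lmodType K) (S T : V -> Prop) :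
  is_subspace T -> (forall x, S x -> T x) -> forall x, in_span S x -> T x.
Proof.
move=> sT ST x [vs [ks [h ->]]].
apply: (@subspace_sum _ _ _ _ (fun i : 'I__ => ks`_i) (fun i : 'I__ => vs`_i)) => // i.
exact/ST/h.
Qed.

Lemma prod_set_cons (F : nat -> R -> B -> Prop) p l y w :
  F p.1 p.2 y -> prod_set F l w -> prod_set F (p :: l) (y * w).
Proof.
move=> Fy [xs [sz [h ->]]]; exists (y :: xs); split; first by rewrite /= sz.
split=> [[|i] //= lti|]; first exact: h.
by rewrite /= big_ord_recl.
Qed.

(** Every monomial of the total degree is cut into consecutive blocks whose degrees are those
    prescribed by [l]; generation in degree one makes any such cut possible. *)
Lemma homogeneous_prod_span (F : nat -> R -> B -> Prop) (l : seq (nat * R)) :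
  (forall i, (i < size l)%N -> forall x, let p := nth (0%N, R0) l i in
     Bn p.1 x -> F p.1 p.2 x) ->
  forall x, Bn (sumn (map fst l)) x -> in_span (prod_set F l) x.
Proof.
have [p [z [Bz spz]]] := degree1_finite.
elim: l => [|[m s] l IH] hl x Bx.
  have [k ->] := degree0_scalar Bx.
  have [_ [_ h]] := in_span_subspace (prod_set F [::]); apply: h.
  by apply: in_span_mem; exists [::]; split=> //; split=> //; rewrite big_ord0.
have := homogeneous_monom Bz spz Bx.
have sp := in_span_subspace (prod_set F ((m, s) :: l)).
move=> [c ->]; apply: subspace_sum => // t.
rewrite /monom -(cat_take_drop m t) big_cat /=.
have st := size_tuple t.
have Bh (u : seq 'I_p) n : size u = n -> Bn n (\prod_(j <- u) z j).
  by move=> /eqP su; exact: (monom_hom Bz (Tuple su)).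
have By : Bn m (\prod_(j <- take m t) z j).
  apply: Bh; rewrite size_take st /=; case: ltnP => //; lia.
have Bw : Bn (sumn (map fst l)) (\prod_(j <- drop m t) z j).
  by apply: Bh; rewrite size_drop st /= addKn.
have := IH (fun i => hl i.+1) _ Bw.
move: (\prod_(j <- drop m t) z j) => w.
move: (\prod_(j <- take m t) z j) By => y By.
apply: (@in_span_min _ _ (fun w => in_span (prod_set F ((m, s) :: l)) (y * w))).
  have [sp0 [spD spS]] := sp; split; first by rewrite mulr0.
  split=> [u v hu hv|k u hu]; first by rewrite mulrDr; exact: spD.
  by rewrite -scalerAr; exact: spS.
move=> u hu; apply: in_span_mem; apply: prod_set_cons => //=.
exact: (hl 0%N).
Qed.

End GradedAlgebra.

(** * Growth of finitely generated algebras *)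

(** An alias of [L] that carries the $K$-algebra structure induced by [iota]. *)
Definition Kfield (K L : fieldType) (iota : {rmorphism K -> L}) : Type := L.

Section KfieldStructure.
Import GRing.Theory.
Import mathcomp.algebra_tactics.ring.
Local Open Scope ring_scope.
Variables (K L : fieldType) (iota : {rmorphism K -> L}).
HB.instance Definition _ := GRing.Field.on (Kfield iota).

Definition kscale (k : K) (x : Kfield iota) : Kfield iota := (iota k : Kfield iota) * x.

Fact kscaleA a b v : kscale a (kscale b v) = kscale (a * b) v.
Proof. by rewrite /kscale mulrA rmorphM. Qed.
Fact kscale1 : left_id 1 kscale.
Proof. by move=> x; rewrite /kscale rmorph1 mul1r. Qed.
Fact kscaleDr : right_distributive kscale +%R.
Proof. by move=> a x y; rewrite /kscale mulrDr. Qed.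
Fact kscaleDl v : {morph kscale^~ v : a b / a + b}.
Proof. by move=> a b; rewrite /kscale rmorphD mulrDl. Qed.
HB.instance Definition _ :=
  GRing.Zmodule_isLmodule.Build K (Kfield iota) kscaleA kscale1 kscaleDr kscaleDl.

Fact kscaleAl (k : K) (x y : Kfield iota) : k *: (x * y) = (k *: x) * y.
Proof. by rewrite /GRing.scale /= /kscale mulrA. Qed.
HB.instance Definition _ := GRing.Lmodule_isLalgebra.Build K (Kfield iota) kscaleAl.

Fact kscaleAr (k : K) (x y : Kfield iota) : k *: (x * y) = x * (k *: y).
Proof. by rewrite /GRing.scale /= /kscale mulrCA. Qed.
HB.instance Definition _ := GRing.Lalgebra_isAlgebra.Build K (Kfield iota) kscaleAr.

Lemma kscaleE (k : K) (x : Kfield iota) : k *: x = (iota k : Kfield iota) * x.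
Proof. by []. Qed.

End KfieldStructure.

Lemma expn_mono e m n : m <= n -> m ^ e <= n ^ e.
Proof. by case: e => // e mn; rewrite leq_exp2r. Qed.

Section Growth.
Import GRing.Theory.
Import mathcomp.algebra_tactics.ring.
Local Open Scope ring_scope.
Variables (K L : fieldType) (iota : {rmorphism K -> L}).
Notation E := (Kfield iota).

(* The degree bound is on each variable separately. *)
Fixpoint Pdeg (ys : seq E) (n : nat) (x : E) : Prop :=
  if ys is y :: ys' then
    exists p : {poly E}, [/\ (size p <= n.+1)%N, (forall i, Pdeg ys' n p`_i) & x = p.[y]]
  else exists k : K, x = k%:A.

Lemma Pdeg_mono ys n m x : (n <= m)%N -> Pdeg ys n x -> Pdeg ys m x.
Proof.
elim: ys x => [|y ys IH] x nm //= [p [sp cp ->]]; exists p; split=> //.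
  exact: leq_trans sp _.
by move=> i; exact: IH.
Qed.

Lemma Pdeg_subspace ys n : is_subspace (Pdeg ys n).
Proof.
elim: ys => [|y ys [IH0 [IHD IHZ]]] /=.
  split; first by exists 0; rewrite scale0r.
  split=> [_ _ [k ->] [l ->]|k _ [l ->]]; first by exists (k + l); rewrite scalerDl.
  by exists (k * l); rewrite scalerA.
split; first by exists 0; split=> //; rewrite ?size_poly0 ?horner0 // => i; rewrite coef0.
split=> [_ _ [p [sp cp ->]] [q [sq cq ->]]|k _ [p [sp cp ->]]].
  exists (p + q); split; rewrite ?hornerD //.
    by apply: (leq_trans (size_polyD _ _)); rewrite geq_max sp sq.
  by move=> i; rewrite coefD; exact: IHD.
exists ((k%:A : E) *: p); split.
- exact: leq_trans (size_scale_leq _ _) sp.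
- by move=> i; rewrite coefZ mulr_algl; exact: IHZ.
- by rewrite hornerZ mulr_algl.
Qed.

Lemma Pdeg0 ys n : Pdeg ys n 0. Proof. by case: (Pdeg_subspace ys n). Qed.
Lemma PdegD ys n x y : Pdeg ys n x -> Pdeg ys n y -> Pdeg ys n (x + y).
Proof. case: (Pdeg_subspace ys n) => _ [h _]; exact: h. Qed.
Lemma PdegZ ys n k x : Pdeg ys n x -> Pdeg ys n (k *: x).
Proof. case: (Pdeg_subspace ys n) => _ [_ h]; exact: h. Qed.
Lemma PdegN ys n x : Pdeg ys n x -> Pdeg ys n (- x).
Proof. by rewrite -scaleN1r; exact: PdegZ. Qed.

Lemma Pdeg_sum ys n (I : Type) (r : seq I) (P : pred I) (G : I -> E) :
  (forall i, P i -> Pdeg ys n (G i)) -> Pdeg ys n (\sum_(i <- r | P i) G i).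
Proof. by move=> h; apply: (big_ind (Pdeg ys n)) => //; [exact: Pdeg0|exact: PdegD]. Qed.

Lemma PdegM ys n m x y : Pdeg ys n x -> Pdeg ys m y -> Pdeg ys (n + m) (x * y).
Proof.
elim: ys n m x y => [|y0 ys IH] n m x y /=.
  by move=> [k ->] [l ->]; exists (k * l); rewrite -scalerAl mul1r scalerA.
move=> [p [sp cp ->]] [q [sq cq ->]]; exists (p * q); split; rewrite ?hornerM //.
  by apply: (leq_trans (size_polyMleq _ _)); move: (size p) (size q) sp sq => a b; lia.
by move=> i; rewrite coefM; apply: Pdeg_sum => j _; exact: IH.
Qed.

Lemma Pdeg_cons y ys n x : Pdeg ys n x -> Pdeg (y :: ys) n x.
Proof.
move=> px; exists x%:P; split; rewrite ?hornerC //.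
  by rewrite size_polyC; case: eqP.
by move=> i; rewrite coefC; case: eqP => // _; exact: Pdeg0.
Qed.

Lemma Pdeg1 ys : Pdeg ys 0 1.
Proof. by elim: ys => [|y ys]; [exists 1; rewrite scale1r|exact: Pdeg_cons]. Qed.

Lemma Pdeg_var ys y : y \in ys -> Pdeg ys 1 y.
Proof.
elim: ys => // y0 ys IH; rewrite inE => /orP[/eqP ->|/IH /Pdeg_cons //].
exists 'X; split; rewrite ?size_polyX ?hornerX // => i.
rewrite coefX; case: eqP => _; last exact: Pdeg0.
exact: Pdeg_mono (Pdeg1 _).
Qed.

Lemma Pdeg_exp ys n k x : Pdeg ys n x -> Pdeg ys (k * n) (x ^+ k).
Proof.
move=> px; elim: k => [|k IH]; first by rewrite expr0; exact: Pdeg1.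
by rewrite exprS mulSn; exact: PdegM.
Qed.

Definition Kalg (ys : seq E) (x : E) : Prop := exists n, Pdeg ys n x.

Lemma Kalg_bound ys (p : {poly E}) : (forall i, Kalg ys p`_i) ->
  exists g, forall i, Pdeg ys g p`_i.
Proof.
move=> h; have /fin_all_exists [g hg] := (fun i : 'I_(size p) => h i).
exists (\max_i g i) => i; case: (ltnP i (size p)) => lti; last by rewrite nth_default //; exact: Pdeg0.
by apply: Pdeg_mono (hg (Ordinal lti)); exact: leq_bigmax.
Qed.

Definition transcendental (S : E -> Prop) (T : E) : Prop :=
  forall p : {poly E}, (forall i, S p`_i) -> p.[T] = 0 -> p = 0.

(** Each entry is transcendental over the algebra of the entries after it; this order of elimination
    is the one that matches the lexicographic order of exponents. *)
Fixpoint algind (Ys : seq E) : Prop :=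
  if Ys is T :: Ys' then algind Ys' /\ transcendental (Kalg Ys') T else True.

(* The common denominator [eta] absorbs the leading coefficients of the algebraic equations that
   eliminate high powers of a generator. *)
Definition growth (ys : seq E) (e : nat) : Prop :=
  exists c : nat, forall n, exists N (w : 'I_N -> E) (eta : E),
    [/\ (N <= c * n.+1 ^ e)%N, eta != 0 & forall x, Pdeg ys n x -> fspan w (eta * x)].

Lemma fspan_horner N s (w : 'I_N -> E) (eta y : E) (p : {poly E}) :
  (size p <= s)%N -> (forall i, fspan w (eta * p`_i)) ->
  fspan (fun ij : 'I_N * 'I_s => w ij.1 * y ^+ ij.2) (eta * p.[y]).
Proof.
move=> sp cp; rewrite (horner_coef_wide _ sp) mulr_sumr.
have [sp0 [spD spS]] := fspan_subspace (fun ij : 'I_N * 'I_s => w ij.1 * y ^+ ij.2).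
apply: (big_ind (fspan _)) => // i _; rewrite mulrA.
have [c ->] := cp i; rewrite mulr_suml.
apply: (big_ind (fspan _)) => // j _; rewrite -scalerAl; apply: spS.
exact: (@fspan_mem _ _ _ (fun ij : 'I_N * 'I_s => w ij.1 * y ^+ ij.2) (j, i)).
Qed.

Lemma fspan_enum (I : finType) (w : I -> E) :
  exists w' : 'I_#|I| -> E, forall x, fspan w x -> fspan w' x.
Proof.
exists (fun i => w (enum_val i)) => x; apply: fspan_trans => i.
by rewrite -[i]enum_rankK; exact: (fspan_mem (fun i => w (enum_val i))).
Qed.

Lemma growth_nil : growth [::] 0.
Proof.
exists 1%N => n; exists 1%N, (fun=> 1), 1; split; rewrite ?oner_neq0 //.
by move=> x [k ->]; exists (fun=> k); rewrite big_ord1 mul1r.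
Qed.

Lemma growth_transcendental y ys e : growth ys e -> growth (y :: ys) e.+1.
Proof.
move=> [c hc]; exists c => n; have [N [w [eta [leN eta0 hw]]]] := hc n.
have [w' hw'] := fspan_enum (fun ij : 'I_N * 'I_n.+1 => w ij.1 * y ^+ ij.2).
exists #|{: 'I_N * 'I_n.+1}|, w', eta; split=> //.
  by rewrite card_prod !card_ord expnSr mulnA leq_mul2r leN orbT.
move=> x [p [sp cp ->]]; apply: hw'; apply: fspan_horner => // i; exact: hw _ (cp i).
Qed.

(** Pseudo-division by the equation [p] of [y]: each further power of [y] costs one factor of the
    leading coefficient and raises the degree of the coefficients by at most [g]. *)
Lemma algebraic_reduce y ys g (p : {poly E}) :
  (forall i, Pdeg ys g p`_i) -> p != 0 -> p.[y] = 0 ->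
  forall b, exists r : {poly E}, [/\ (size r < size p)%N,
    (forall i, Pdeg ys (g * b) r`_i) & lead_coef p ^+ b * y ^+ b = r.[y]].
Proof.
move=> cp p0 py; set h := lead_coef p.
have sp1 : (1 < size p)%N.
  rewrite ltnNge; apply/negP => /size1_polyC pC.
  by move: py p0; rewrite pC hornerC => ->; rewrite eqxx.
set s := (size p).-1.
have sE : size p = s.+1 by rewrite /s prednK // ltnW.
elim=> [|b [r [sr cr e]]].
  exists 1; split; rewrite ?size_poly1 ?hornerC //; last by rewrite !expr0 mulr1.
  move=> i; rewrite muln0 coefC; case: eqP => _; [exact: Pdeg1|exact: Pdeg0].
(* Multiplication by ['X] may bring the degree up to that of [p]; subtracting this multiple of [p]
   cancels the top coefficient and does not change the value at [y]. *)
exists (h *: ('X * r) - r`_s.-1 *: p); split.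
- have s0 : (0 < s)%N by lia.
  rewrite sE ltnS; apply/leq_sizeP => j sj; rewrite coefB !coefZ coefXM.
  case: ltngtP sj => // [lt|<-] _.
    rewrite [p`_j]nth_default ?sE // [r`_j.-1]nth_default; first by rewrite if_same !mulr0 subr0.
    by apply: (@leq_trans s); [rewrite -ltnS -sE|lia].
  rewrite eqn0Ngt s0 /= /h lead_coefE -/s; ring.
- move=> i; rewrite coefB !coefZ mulnSr addnC; apply: PdegD; last apply: PdegN.
    apply: PdegM; first by rewrite /h lead_coefE.
    rewrite coefXM; case: eqP => _; [exact: Pdeg0|exact: cr].
  by rewrite addnC; exact: PdegM.
- rewrite hornerD hornerN !hornerZ py mulr0 subr0 hornerM hornerX -e !exprS; ring.
Qed.

Lemma growth_algebraic y ys e :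
  growth ys e -> ~ transcendental (Kalg ys) y -> growth (y :: ys) e.
Proof.
move=> [c hc] nt.
have [p [cp [py p0]]] : exists p : {poly E},
    (forall i, Kalg ys p`_i) /\ p.[y] = 0 /\ p != 0.
  apply: NNPP => h; apply: nt => p cp py; apply: NNPP => /eqP p0; apply: h.
  by exists p.
have [g {}cp] := Kalg_bound cp.
have /(_ _) hr := algebraic_reduce cp p0 py.
set h := lead_coef p in hr; have h0 : h != 0 by rewrite lead_coef_eq0.
(* The coefficients reach degree $n+gn<(g+1)(n+1)$, whence the factor $(g+1)^e$; [size p] bounds the
   number of powers of [y] that remain. *)
exists (c * g.+1 ^ e * size p)%N => n.
have [N [w [eta [leN eta0 hw]]]] := hc (n + g * n)%N.
have [w' hw'] := fspan_enum (fun ij : 'I_N * 'I_(size p) => w ij.1 * y ^+ ij.2).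
(* The single factor $h^n$ clears the denominators of all powers $y^b$ with $b\le n$ at once. *)
exists #|{: 'I_N * 'I_(size p)}|, w', (eta * h ^+ n); split.
- rewrite card_prod !card_ord -!mulnA [(size p * _)%N]mulnC !mulnA leq_mul2r.
  apply/orP; right; apply: (leq_trans leN); rewrite -mulnA -expnMn leq_mul2l.
  by apply/orP; right; apply: expn_mono; nia.
- by rewrite mulf_neq0 // expf_neq0.
move=> x [q [sq cq ->]]; apply: hw'.
have [r [sr cr e']] : exists r : {poly E}, [/\ (size r <= size p)%N,
    (forall i, Pdeg ys (n + g * n) r`_i) & h ^+ n * q.[y] = r.[y]].
  rewrite (horner_coef_wide _ sq) mulr_sumr.
  have step (b : 'I_n.+1) : exists r : {poly E}, [/\ (size r <= size p)%N,
      (forall i, Pdeg ys (n + g * n) r`_i) & h ^+ n * (q`_b * y ^+ b) = r.[y]].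
    have [r [sr cr e']] := hr b.
    exists ((q`_b * h ^+ (n - b)) *: r); split.
    + exact: leq_trans (size_scale_leq _ _) (ltnW sr).
    + move=> i; rewrite coefZ.
      have -> : (n + g * n = (n + (n - b) * g) + g * b)%N.
        by have := ltn_ord b; nia.
      apply: PdegM (cr i); apply: (PdegM (cq _)); apply: Pdeg_exp.
      by rewrite /h lead_coefE.
    + rewrite hornerZ -e'.
      have -> : h ^+ n = h ^+ (n - b) * h ^+ b by rewrite -exprD subnK // -ltnS.
      ring.
  have /fin_all_exists [r hr'] := step.
  exists (\sum_b r b); split.
  + by apply: (leq_trans (size_sum _ _ _)); apply/bigmax_leqP => b _; case: (hr' b).
  + by move=> i; rewrite coef_sum; apply: Pdeg_sum => b _; case: (hr' b).
  + by rewrite horner_sum; apply: eq_bigr => b _; case: (hr' b).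
rewrite -mulrA e'; apply: fspan_horner => // i; exact: hw _ (cr i).
Qed.

Lemma transcendence_basis (ys : seq E) : exists Ys : seq E,
  [/\ {subset Ys <= ys}, (forall n x, Pdeg Ys n x -> Pdeg ys n x), algind Ys & growth ys (size Ys)].
Proof.
elim: ys => [|y ys [Ys [sub subP ai gr]]].
  by exists [::]; split=> //; exact: growth_nil.
(* The dichotomy is taken over all generators met so far: algebraicity then feeds
   [growth_algebraic], and transcendence passes down to the smaller algebra of [Ys]. *)
have [tr|nt] := classic (transcendental (Kalg ys) y).
  exists (y :: Ys); split=> /=.
  - move=> x; rewrite !inE => /orP[-> //|/sub ->]; exact: orbT.
  - by move=> n x [p [sp cp ->]]; exists p; split=> // i; exact: subP.
  - split=> // p cp; apply: tr => i; have [n h] := cp i; exists n; exact: subP.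
  - exact: growth_transcendental.
exists Ys; split=> //.
- by move=> x /sub; rewrite inE => ->; rewrite orbT.
- by move=> n x /subP; exact: Pdeg_cons.
- exact: growth_algebraic.
Qed.

(** Multiplication by $\eta\ne0$ is injective, so the common denominator does not affect the number
    of independent elements. *)
Lemma growth_bound ys e : growth ys e -> exists c : nat, forall n (I : finType) (b : I -> E),
  findep b -> (forall i, Pdeg ys n (b i)) -> (#|I| <= c * n.+1 ^ e)%N.
Proof.
move=> [c hc]; exists c => n I b fb pb.
have [N [w [eta [leN eta0 hw]]]] := hc n.
apply: leq_trans leN; rewrite -[N]card_ord.
apply: (@steinitz _ _ _ _ (fun i => eta * b i) w) => [d d0|i]; last exact/hw/pb.
apply: fb; apply/eqP; rewrite -(mulrI_eq0 _ (mulfI eta0)) mulr_sumr -[X in _ == X]d0.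
by apply/eqP/eq_bigr => i _; rewrite scalerAr.
Qed.

End Growth.

(** * Valuation rings *)

Section ValuationRing.
Import GRing.Theory.
Import mathcomp.algebra_tactics.ring.
Local Open Scope ring_scope.
Variable E : fieldType.

Definition is_subring (R : E -> Prop) : Prop :=
  [/\ R 1, forall x y, R x -> R y -> R (x - y) & forall x y, R x -> R y -> R (x * y)].

Definition is_valring (R : E -> Prop) : Prop :=
  is_subring R /\ forall x, R x \/ R x^-1.

Section SubringTheory.
Variable R : E -> Prop.
Hypothesis Rr : is_subring R.

Lemma subring1 : R 1. Proof. by case: Rr. Qed.
Lemma subringB x y : R x -> R y -> R (x - y). Proof. by case: Rr => _ h _; exact: h. Qed.
Lemma subringM x y : R x -> R y -> R (x * y). Proof. by case: Rr => _ _ h; exact: h. Qed.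
Lemma subring0 : R 0. Proof. by rewrite -(subrr 1); apply: subringB; exact: subring1. Qed.
Lemma subringN x : R x -> R (- x).
Proof. by rewrite -sub0r => h; apply: subringB => //; exact: subring0. Qed.
Lemma subringD x y : R x -> R y -> R (x + y).
Proof. by move=> hx hy; rewrite -[y]opprK; apply: subringB => //; exact: subringN. Qed.
Lemma subring_sum (I : Type) (r : seq I) (P : pred I) (G : I -> E) :
  (forall i, P i -> R (G i)) -> R (\sum_(i <- r | P i) G i).
Proof. by move=> h; apply: (big_ind R) => //; [exact: subring0|exact: subringD]. Qed.
Lemma subringX x n : R x -> R (x ^+ n).
Proof. by move=> h; elim: n => [|n IH]; [exact: subring1|rewrite exprS; exact: subringM]. Qed.

Definition adjoin (x y : E) : Prop := exists p : {poly E}, (forall i, R p`_i) /\ y = p.[x].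

Lemma adjoin_subring x : is_subring (adjoin x).
Proof.
split.
- exists 1; rewrite hornerC; split=> // i; rewrite coefC; case: eqP => _; [exact: subring1|exact: subring0].
- move=> _ _ [p [cp ->]] [q [cq ->]]; exists (p - q); rewrite hornerD hornerN; split=> // i.
  by rewrite coefB; exact: subringB.
- move=> _ _ [p [cp ->]] [q [cq ->]]; exists (p * q); rewrite hornerM; split=> // i.
  by rewrite coefM; apply: subring_sum => j _; exact: subringM.
Qed.

Lemma adjoin_incl x y : R y -> adjoin x y.
Proof.
move=> Ry; exists y%:P; rewrite hornerC; split=> // i; rewrite coefC.
by case: eqP => _ //; exact: subring0.
Qed.

Lemma adjoin_mem x : adjoin x x.
Proof.
exists 'X; rewrite hornerX; split=> // i; rewrite coefX.
by case: eqP => _; [exact: subring1|exact: subring0].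
Qed.

End SubringTheory.

Section Chevalley.
Variables (R0 : E -> Prop) (pi : E).
Hypotheses (R0r : is_subring R0) (R0pi : R0 pi) (pi0 : pi != 0) (R0V : ~ R0 pi^-1).

Let good (R : E -> Prop) := [/\ is_subring R, (forall x, R0 x -> R x) & ~ R pi^-1].

Lemma maximal_good : exists R, good R /\
  forall R', good R' -> (forall x, R x -> R' x) -> forall x, R' x -> R x.
Proof.
pose P : classical_sets.set (classical_sets.set E) := fun A => (forall x, ~ A x) \/ good A.
have [|A [PA Amax]] := @classical_sets.Zorn_bigcup E P.
  move=> F FP Ftot.
  have [[A [FA [x Ax]]]|nF] := classic (exists A, F A /\ exists x, A x); last first.
    by left=> x [A FA Ax]; apply: nF; exists A; split=> //; exists x.
  have gd C y : F C -> C y -> good C.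
    by move=> FC Cy; have [/(_ y)|] := FP _ FC.
  have dir C D y z : F C -> C y -> F D -> D z -> exists2 G, F G & G y /\ G z.
    move=> FC Cy FD Dz; have [CD|DC] := Ftot _ _ FC FD.
      by exists D => //; split=> //; exact: CD.
    by exists C => //; split=> //; exact: DC.
  have gA := gd _ _ FA Ax; right; split.
  - split.
    + by exists A => //; case: gA => /subring1.
    + move=> y z [C FC Cy] [D FD Dz]; have [G FG [Gy Gz]] := dir _ _ _ _ FC Cy FD Dz.
      by exists G => //; case: (gd _ _ FG Gy) => Gr _ _; exact: subringB.
    + move=> y z [C FC Cy] [D FD Dz]; have [G FG [Gy Gz]] := dir _ _ _ _ FC Cy FD Dz.
      by exists G => //; case: (gd _ _ FG Gy) => Gr _ _; exact: subringM.
  - by move=> y R0y; exists A => //; case: gA => _ h _; exact: h.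
  - by move=> [C FC Cpi]; case: (gd _ _ FC Cpi).
have mx R' : good R' -> (forall x, A x -> R' x) -> forall x, R' x -> A x.
  move=> gR sub x R'x; apply: NNPP => nAx; apply: (Amax R'); last by right.
  by split=> // h; apply: nAx; exact: h.
case: PA => [A0|gA]; last by exists A.
have g0 : good R0 by split.
by case: (A0 1); apply: (mx R0) => // [x /A0 //|]; exact: subring1.
Qed.

(** Chevalley's extension theorem. Let $R$ be maximal among the subrings that contain [R0] but not
    $\pi^{-1}$. If neither $x$ nor $x^{-1}$ lay in $R$, then $\pi^{-1}$ would lie in $R[x]$ and in
    $R[x^{-1}]$, and the two polynomial expressions could be used to shorten each other. *)
Lemma chevalley : exists R, [/\ is_valring R, (forall x, R0 x -> R x) & ~ R pi^-1].
Proof.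
have [R [[Rr R0R RV] Rmax]] := maximal_good.
exists R; split=> //; split=> // x.
have Rpi : R pi by exact: R0R.
have adj y : ~ R y -> adjoin R y pi^-1.
  move=> nRy; apply: NNPP => nadj; apply: nRy; apply: (Rmax (adjoin R y)).
  - split=> // [|z R0z]; first exact: adjoin_subring.
    by apply: adjoin_incl => //; exact: R0R.
  - by move=> z; exact: adjoin_incl.
  - exact: adjoin_mem.
(* $\pi$ lies in the Jacobson radical of $R$: if $u=1-\pi r$ were not invertible in $R$, then
   $\pi^{-1}\in R[u^{-1}]$, so $u^n\pi^{-1}\in R$ for some $n$; as $u^n\in1-\pi R$, this puts
   $\pi^{-1}$ in $R$. *)
have unit1 r : R r -> R (1 - pi * r)^-1.
  move=> Rr'; set u := 1 - pi * r.
  have [u0|u0] := eqVneq u 0; first by rewrite u0 invr0; exact: subring0.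
  apply: NNPP => /adj [p [cp e]].
  have Ru : R u by apply: subringB => //; [exact: subring1|exact: subringM].
  have [c [Rc ec]] : exists c, R c /\ u ^+ size p * pi^-1 = c.
    eexists; split; last by [].
    rewrite e horner_coef mulr_sumr; apply: subring_sum => // i _.
    have -> : u ^+ size p = u ^+ (size p - i) * u ^+ i.
      by rewrite -exprD subnK // ltnW.
    rewrite mulrCA -mulrA exprVn mulfV ?expf_neq0 // mulr1.
    by apply: subringM => //; exact: subringX.
  have [r' [Rr'' er]] : exists r', R r' /\ u ^+ size p = 1 - pi * r'.
    elim: (size p) => [|n [r' [h e']]].
      by exists 0; split; [exact: subring0|rewrite mulr0 subr0].
    exists (r + r' - pi * r * r'); split; last by rewrite exprS e' /u; ring.
    by apply: subringB => //; [exact: subringD|do 2 apply: subringM => //].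
  apply: RV; rewrite er in ec.
  have -> : pi^-1 = c + r' by rewrite -ec; field.
  exact: subringD.
pose rel n y := exists a : nat -> E, (forall i, R (a i)) /\ \sum_(i < n.+1) a i * y ^+ i = pi^-1.
have relP y : ~ R y -> exists n, rel n y.
  move=> /adj [p [cp e]]; exists (size p), (fun i => p`_i); split=> //.
  by rewrite -(horner_coef_wide y (leqnSn _)).
have rel0 y : ~ rel 0%N y.
  by move=> [a [Ra]]; rewrite big_ord1 expr0 mulr1 => e; apply: RV; rewrite -e.
have relW n m y : (n <= m)%N -> rel n y -> rel m y.
  move=> nm [a [Ra e]]; exists (fun i => if (i <= n)%N then a i else 0); split.
    by move=> i; case: ifP => // _; exact: subring0.
  rewrite -e (big_ord_widen m.+1 (fun i => a i * y ^+ i)) // [RHS]big_mkcond /=.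
  by apply: eq_bigr => i _; rewrite ltnS; case: ifP => //; rewrite mul0r.
(* The relation in $y^{-1}$, multiplied by $\pi y^{n+1}$, reads $(1-\pi
   b_0)y^{n+1}=\pi\sum_{i\ge1}b_iy^{n+1-i}$. Its left coefficient is a unit, so the top power of [y]
   can be eliminated from the other relation. *)
have red n m y : y != 0 -> (m <= n.+1)%N -> rel n.+1 y -> rel m y^-1 -> rel n y.
  move=> y0 mn [a [Ra ea]] /(relW _ _ _ mn) [b [Rb eb]].
  set v := (1 - pi * b 0%N)^-1.
  have Rv : R v by exact: unit1.
  have v0 : 1 - pi * b 0%N != 0.
    apply/eqP => h; apply: RV; have -> : pi^-1 = b 0%N; last by [].
    by apply: (mulfI pi0); rewrite mulfV //; apply/eqP; rewrite -subr_eq0 h.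
  exists (fun i => a i + pi * a n.+1 * v * b (n.+1 - i)%N); split.
    by move=> i; apply: subringD => //; do 3 apply: subringM => //.
  under eq_bigr do rewrite mulrDl.
  rewrite big_split /=.
  have -> : \sum_(i < n.+1) a i * y ^+ i = pi^-1 - a n.+1 * y ^+ n.+1.
    by rewrite -ea [in RHS]big_ord_recr /= addrK.
  have -> : \sum_(i < n.+1) pi * a n.+1 * v * b (n.+1 - i)%N * y ^+ i
      = pi * a n.+1 * v * (y ^+ n.+1 * (pi^-1 - b 0%N)).
    rewrite -eb [in RHS]big_ord_recl /= expr0 mulr1 [b 0%N + _]addrC addrK.
    rewrite !mulr_sumr (reindex_inj rev_ord_inj) /=; apply: eq_bigr => i _.
    rewrite -mulrA; congr (_ * _).
    have -> : (n.+1 - (n.+1 - i.+1) = i.+1)%N by have := ltn_ord i; lia.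
    rewrite mulrCA; congr (_ * _).
    have -> : bump 0 i = i.+1 by [].
    have -> : y ^+ n.+1 = y ^+ (n.+1 - i.+1) * y ^+ i.+1.
      by rewrite -exprD subnK.
    by rewrite -mulrA exprVn mulfV ?expf_neq0 // mulr1.
  by rewrite /v; field; rewrite pi0 v0.
apply: NNPP => /not_or_and [nx nxV].
have x0 : x != 0 by apply/eqP => e; apply: nx; rewrite e; exact: subring0.
have [n rn] := relP _ nx; have [m rm] := relP _ nxV.
(* Descent on $n+m$, shortening the longer relation, with the roles of $x$ and $x^{-1}$ exchanged
   when needed, until a relation of degree $0$ would put $\pi^{-1}$ in $R$. *)
have : (n + m <= n + m)%N by [].
move: {2}(n + m)%N => s; move: x x0 n m rn rm {nx nxV}.
elim: s => [|s IH] x x0 n m rn rm le.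
  have n0 : n = 0%N by lia.
  by apply: (rel0 x); rewrite -n0.
case: (leqP m n) => mn.
  case: n rn mn le => [/rel0 //|n] rn mn le.
  by apply: (IH x x0 n m) => //; exact: (red n m).
case: m rm mn le => [/rel0 //|m] rm mn le.
apply: (IH x x0 n m) => //; last by lia.
by apply: (red m n); rewrite ?invr_eq0 ?invrK // ltnW.
Qed.

End Chevalley.
End ValuationRing.

(** * Laurent monomials and the lexicographic valuation ring *)

Section LaurentMonomials.
Import GRing.Theory.
Import mathcomp.algebra_tactics.ring.
Local Open Scope ring_scope.
Variables (K L : fieldType) (iota : {rmorphism K -> L}).
Notation E := (Kfield iota).

Definition lexpos e (g : 'I_e -> int) : Prop :=
  exists i, (0 < g i)%R /\ forall j : 'I_e, (j < i)%N -> g j = 0.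

Definition lexnn e (g : 'I_e -> int) : Prop := lexpos g \/ forall i, g i = 0.

Lemma lexposD e (g h : 'I_e -> int) : lexpos g -> lexnn h -> lexpos (fun i => g i + h i).
Proof.
move=> [i [gi gj]] [[k [hk hj]]|h0]; last first.
  by exists i; rewrite h0 addr0; split=> // j ji; rewrite h0 addr0 gj.
case: (ltngtP i k) => [ik|ki|/val_inj eik].
- exists i; rewrite hj // addr0; split=> // j ji; rewrite gj // hj //; exact: ltn_trans ik.
- exists k; rewrite gj // add0r; split=> // j ji; rewrite gj ?hj //; exact: ltn_trans ki.
- subst k; exists i; split; first by lia.
  by move=> j ji; rewrite gj // hj.
Qed.

Lemma lexnnD e (g h : 'I_e -> int) : lexnn g -> lexnn h -> lexnn (fun i => g i + h i).
Proof.
move=> [gp|g0] hn; first by left; exact: lexposD.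
case: hn => [[i [hi hj]]|h0]; last by right=> i; rewrite g0 h0.
by left; exists i; rewrite g0 add0r; split=> // j ji; rewrite g0 hj.
Qed.

Lemma lex_total e (g : 'I_e -> int) :
  lexpos g \/ lexpos (fun i => - g i) \/ forall i, g i = 0.
Proof.
have [/existsP [i0 gi0]|nex] := boolP [exists i, g i != 0]; last first.
  right; right=> i; apply/eqP/negPn/negP => gi; case/negP: nex; apply/existsP; by exists i.
have [i gi imin] := @arg_minnP _ i0 (fun i => g i != 0) (fun i : 'I_e => i : nat) gi0.
have gj (j : 'I_e) : (j < i)%N -> g j = 0.
  by move=> ji; apply/eqP/negPn/negP => /imin; rewrite leqNgt ji.
case: (Order.TotalTheory.ltgtP (g i) 0) gi => // gi _.
- by right; left; exists i; split=> [|j /gj ->]; [lia|rewrite oppr0].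
- by left; exists i.
Qed.

Definition mon (Ys : seq E) (g : 'I_(size Ys) -> int) : E := \prod_(i < size Ys) Ys`_i ^ g i.

Lemma Kalg_subring (Ys : seq E) : is_subring (Kalg Ys).
Proof.
split.
- by exists 0%N; exact: Pdeg1.
- move=> x y [n hx] [m hy]; exists (n + m)%N.
  apply: PdegD; first by apply: Pdeg_mono hx; exact: leq_addr.
  by apply: PdegN; apply: Pdeg_mono hy; exact: leq_addl.
- by move=> x y [n hx] [m hy]; exists (n + m)%N; exact: PdegM.
Qed.

Lemma KalgZ (Ys : seq E) k x : Kalg Ys x -> Kalg Ys (k *: x).
Proof. by move=> [n h]; exists n; exact: PdegZ. Qed.

Definition fracs (S : E -> Prop) (x : E) : Prop := exists b, [/\ S b, b != 0 & S (b * x)].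

Lemma fracs_subring S : is_subring S -> is_subring (fracs S).
Proof.
move=> Sr; split.
- by exists 1; rewrite mulr1 oner_neq0; split=> //; exact: subring1.
- move=> x y [b [Sb b0 Sx]] [c [Sc c0 Sy]]; exists (b * c); rewrite mulf_neq0 //; split=> //.
    exact: subringM.
  have -> : b * c * (x - y) = c * (b * x) - b * (c * y) by ring.
  by apply: subringB => //; exact: subringM.
- move=> x y [b [Sb b0 Sx]] [c [Sc c0 Sy]]; exists (b * c); rewrite mulf_neq0 //; split=> //.
    exact: subringM.
  have -> : b * c * (x * y) = (b * x) * (c * y) by ring.
  exact: subringM.
Qed.

Lemma fracs_incl S x : is_subring S -> S x -> fracs S x.
Proof. by move=> Sr Sx; exists 1; rewrite mul1r oner_neq0; split=> //; exact: subring1. Qed.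

Lemma fracs_inv S x : fracs S x -> fracs S x^-1.
Proof.
have [->|x0] := eqVneq x 0; first by rewrite invr0.
by move=> [b [Sb b0 Sx]]; exists (b * x); rewrite mulf_neq0 //; split; rewrite ?mulfK.
Qed.

Lemma transcendental_fracs S T : is_subring S -> transcendental S T -> transcendental (fracs S) T.
Proof.
move=> Sr tr p cp pT.
have /fin_all_exists [b hb] := (fun i : 'I_(size p) => cp i).
pose d := \prod_i b i.
have Sprod (P : pred 'I_(size p)) : S (\prod_(i | P i) b i).
  apply: (big_ind S); [exact: subring1|exact: subringM|by move=> i _; case: (hb i)].
have d0 : d != 0 by apply/prodf_neq0 => i _; case: (hb i).
have : d *: p = 0.
  apply: tr => [i|]; last by rewrite hornerZ pT mulr0.
  rewrite coefZ; case: (ltnP i (size p)) => lti; last first.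
    by rewrite nth_default // mulr0; exact: subring0.
  rewrite /d (bigD1 (Ordinal lti)) //= mulrAC; apply: subringM => //.
  by case: (hb (Ordinal lti)).
by move/eqP; rewrite scaler_eq0 (negPf d0) => /eqP.
Qed.

Lemma algind_neq0 (Ys : seq E) : algind Ys -> forall i : 'I_(size Ys), Ys`_i != 0.
Proof.
elim: Ys => [|T Ys IH] /=; first by move=> _ [].
move=> [ai tr]; case=> [[|i] lti] /=; last exact: (IH ai (Ordinal (lti : (i < size Ys)%N))).
apply/eqP => T0; have /eqP : 'X = 0 :> {poly E}; last by rewrite polyX_eq0.
apply: tr; last by rewrite hornerX T0.
move=> i; rewrite coefX; case: eqP => _; [exact: subring1 (Kalg_subring _)|exact: subring0 (Kalg_subring _)].
Qed.

Lemma fracs_exprz S x (n : int) : is_subring S -> fracs S x -> fracs S (x ^ n).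
Proof.
move=> Sr Sx; have Fr := fracs_subring Sr.
case: n => n; first exact: subringX.
by rewrite NegzE -exprz_inv; apply: (@subringX _ _ Fr _ n.+1); exact: fracs_inv.
Qed.

Lemma mon_fracs (Ys : seq E) g : fracs (Kalg Ys) (@mon Ys g).
Proof.
have Fr := fracs_subring (Kalg_subring Ys).
apply: (big_ind (fracs _)); [exact: subring1|exact: subringM|move=> i _].
apply: fracs_exprz; first exact: Kalg_subring.
apply: fracs_incl; first exact: Kalg_subring.
by exists 1%N; apply: Pdeg_var; exact: mem_nth.
Qed.

Lemma mon_cons (T : E) Ys (g : 'I_(size (T :: Ys)) -> int) :
  mon g = T ^ g ord0 * @mon Ys (fun i => g (lift ord0 i)).
Proof. by rewrite /mon big_ord_recl. Qed.

(** Read the relation as a polynomial in the first variable over the fraction field of the others.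
    Its constant coefficient is a relation of the same kind in the remaining variables, for an
    exponent vector that vanishes at the first place stays lexicographically positive when that
    place is dropped. *)
Lemma lexpos_indep (Ys : seq E) : algind Ys -> forall (I : finType) (c : I -> K) (g : I -> 'I_(size Ys) -> int),
  (forall k, c k != 0 -> lexpos (g k)) -> \sum_k c k *: mon (g k) <> 1.
Proof.
elim: Ys => [|T Ys IH] /=.
  move=> _ I c g hc; rewrite big1 => [|k _]; first by apply/eqP; rewrite eq_sym oner_neq0.
  by have [->|/hc [[]]//] := eqVneq (c k) 0; rewrite scale0r.
move=> [ai tr] I c g hc e1.
have Kr := Kalg_subring Ys; have Fr := fracs_subring Kr.
pose m k := @mon Ys (fun i => g k (lift ord0 i)).
have g0 k : c k != 0 -> (0 <= g k ord0)%R.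
  move=> /hc [i [gi gj]]; case: (posnP i) => [i0|i0]; last by rewrite gj.
  have -> : ord0 = i by exact: val_inj.
  exact: Order.POrderTheory.ltW.
pose p : {poly E} := \sum_k (c k *: m k) *: 'X^(absz (g k ord0)).
have Fm k : fracs (Kalg Ys) (c k *: m k).
  have -> : c k *: m k = (c k)%:A * m k by rewrite mulr_algl.
  apply: subringM => //; last exact: mon_fracs.
  by apply: fracs_incl => //; apply: KalgZ; exact: subring1.
have p1 : p - 1 = 0.
  apply: (transcendental_fracs Kr tr).
    move=> i; rewrite coefB coefC; apply: subringB => //; last first.
      by case: eqP => _; [exact: subring1|exact: subring0].
    rewrite coef_sum; apply: subring_sum => // k _; rewrite coefZ coefXn.
    by case: eqP => _; rewrite ?mulr1 ?mulr0 //; exact: subring0.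
  rewrite hornerD hornerN hornerC horner_sum -[X in _ - X]e1; apply/eqP; rewrite subr_eq0; apply/eqP.
  apply: eq_bigr => k _; rewrite hornerZ hornerXn mon_cons.
  have [->|/g0 gk] := eqVneq (c k) 0; first by rewrite !scale0r mul0r.
  have -> : T ^ g k ord0 = T ^+ `|g k ord0|%N by rewrite -{1}(gez0_abs gk).
  by rewrite -scalerAl mulrC.
apply: (IH ai I (fun k => if g k ord0 == 0 then c k else 0) (fun k i => g k (lift ord0 i))).
  move=> k; case: (g k ord0 =P 0) => [gk0 ck|_]; last by rewrite eqxx.
  have [i [gi gj]] := hc k ck.
  case: (unliftP ord0 i) => [j ej|ei]; last by move: gi; rewrite ei gk0 Order.POrderTheory.ltxx.
  by exists j; rewrite -ej; split=> // l lj; apply: gj; rewrite ej.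
have := congr1 (fun q : {poly E} => q`_0) p1.
rewrite coefB coefC coef0 /= => /eqP; rewrite subr_eq0 => /eqP <-.
rewrite coef_sum; apply: eq_bigr => k _; rewrite coefZ coefXn (eq_sym 0%N) absz_eq0.
by case: eqP => _; rewrite ?mulr1 ?mulr0 ?scale0r.
Qed.

Section Monomials.
Variables (Ys : seq E).
Hypothesis ai : algind Ys.

Lemma mon_neq0 g : @mon Ys g != 0.
Proof. by apply/prodf_neq0 => i _; rewrite expfz_neq0 // algind_neq0. Qed.

Lemma monD (g h : 'I_(size Ys) -> int) : mon (fun i => g i + h i) = mon g * mon h.
Proof. by rewrite /mon -big_split; apply: eq_bigr => i _; rewrite expfzDr // algind_neq0. Qed.

Lemma monN (g : 'I_(size Ys) -> int) : mon (fun i => - g i) = (mon g)^-1.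
Proof.
rewrite /mon; apply: (big_ind2 (fun x y => x = y^-1)) => //; first by rewrite invr1.
  by move=> _ x _ y -> ->; rewrite invfM.
by move=> i _; rewrite invr_expz.
Qed.

Lemma eq_mon (g h : 'I_(size Ys) -> int) : g =1 h -> mon g = mon h.
Proof. by move=> gh; apply: eq_bigr => i _; rewrite gh. Qed.

Lemma mon0 (g : 'I_(size Ys) -> int) : (forall i, g i = 0) -> mon g = 1.
Proof. by move=> g0; rewrite /mon big1 // => i _; rewrite g0 expr0z. Qed.

Definition lexring (x : E) : Prop := exists (I : finType) (c : I -> K) (g : I -> 'I_(size Ys) -> int),
  (forall k, lexnn (g k)) /\ x = \sum_k c k *: mon (g k).

Lemma lexring_mon k (g : 'I_(size Ys) -> int) : lexnn g -> lexring (k *: mon g).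
Proof. by move=> gn; exists unit, (fun=> k), (fun=> g); split=> //; rewrite big_const card_unit /= addr0. Qed.

Lemma lexring_subring : is_subring lexring.
Proof.
split.
- have := @lexring_mon 1 (fun=> 0) (or_intror (fun=> erefl)).
  by rewrite scale1r mon0.
- move=> _ _ [I [c [g [gn ->]]]] [J [d [h [hn ->]]]].
  exists (I + J)%type, (fun k => match k with inl i => c i | inr j => - d j end),
    (fun k => match k with inl i => g i | inr j => h j end); split; first by case.
  rewrite big_sumType /=; congr (_ + _); rewrite -sumrN; apply: eq_bigr => j _.
  by rewrite scaleNr.
- move=> _ _ [I [c [g [gn ->]]]] [J [d [h [hn ->]]]].
  exists (I * J)%type, (fun k => c k.1 * d k.2), (fun k i => g k.1 i + h k.2 i); split.
    by move=> [i j]; exact: lexnnD.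
  rewrite mulr_suml -(pair_bigA _ (fun i j => (c i * d j) *: mon (fun l => g i l + h j l))) /=.
  apply: eq_bigr => i _; rewrite mulr_sumr; apply: eq_bigr => j _.
  by rewrite monD -scalerAl -scalerAr scalerA.
Qed.

End Monomials.

(** The exponent [d], the last unit vector, is the smallest lexicographically positive one. Hence it
    is enough to keep the inverse of its monomial out of the ring: if $Y^{-g}$ lay in the ring for
    some $g>0$, so would $Y^{-d}=Y^{g-d}Y^{-g}$. *)
Lemma lex_valring (Ys : seq E) : algind Ys -> exists R : E -> Prop,
  [/\ is_valring R, (forall k : K, R k%:A) &
      forall g : 'I_(size Ys) -> int, lexpos g -> R (mon g) /\ ~ R (mon g)^-1].
Proof.
move=> ai; have [e0|] := posnP (size Ys).
  exists (fun=> True); split=> //; first by split=> //; left.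
  by move=> g [[i lti]]; exfalso; rewrite e0 in lti.
move=> e0; have lt : ((size Ys).-1 < size Ys)%N by rewrite prednK.
pose last := Ordinal lt.
pose d : 'I_(size Ys) -> int := fun i => if i == last then 1 else 0.
have dpos : lexpos d.
  exists last; rewrite /d eqxx; split=> // j; case: eqP => // ->; by rewrite ltnn.
have dmin g : lexpos g -> lexnn (fun i => g i - d i).
  move=> [i [gi gj]]; rewrite /lexnn /d.
  have [ei|ni] := eqVneq i last; last first.
    left; exists i; rewrite (negPf ni) subr0; split=> // j ji; rewrite gj //.
    case: eqP => // ej; exfalso; have := ltn_ord i; move: ji; rewrite ej /=; lia.
  have [g1|g1] := eqVneq (g i) 1.
    right=> j; have [->|nj] := eqVneq j last; first by rewrite -ei g1 subrr.
    have nj' : (j : nat) <> (size Ys).-1 by move=> h; case/eqP: nj; exact: val_inj.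
    by rewrite gj // ei /=; have := ltn_ord j; lia.
  left; exists i; rewrite ei eqxx -ei; split; first by move/eqP: g1 => g1; lia.
  move=> j ji; rewrite gj //; case: eqP => // ej; by rewrite ej ei ltnn in ji.
have Rr := lexring_subring ai.
have Rmon (g : 'I_(size Ys) -> int) : lexnn g -> lexring Ys (mon g).
  by move=> /(lexring_mon 1); rewrite scale1r.
have nV : ~ lexring Ys (mon d)^-1.
  move=> [I [c [g [gn e]]]].
  apply: (lexpos_indep ai (c := c) (g := fun k i => d i + g k i)).
    by move=> k _; exact: lexposD.
  rewrite -(mulfV (mon_neq0 ai d)) e mulr_sumr; apply: eq_bigr => k _.
  by rewrite monD // scalerAr.
have [R [vR RR RV]] := chevalley Rr (Rmon d (or_introl dpos)) (mon_neq0 ai d) nV.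
exists R; split=> //.
  move=> k; apply: RR; rewrite -(@mon0 Ys (fun=> 0)) //.
  by apply: lexring_mon; right.
move=> g gp; split; first by apply: RR; apply: Rmon; left.
move=> RgV; apply: RV.
have -> : (mon d)^-1 = mon (fun i => g i - d i) * (mon g)^-1.
  by rewrite monD // monN // mulrAC mulfV ?mon_neq0 // mul1r.
case: vR => sR _; apply: subringM => //; apply: RR; apply: Rmon; exact: dmin.
Qed.

End LaurentMonomials.

(** * Values *)

Section Values.
Import GRing.Theory.
Import mathcomp.algebra_tactics.ring.
Local Open Scope ring_scope.
Variables (K L : fieldType) (iota : {rmorphism K -> L}).
Notation E := (Kfield iota).
Variable R : E -> Prop.
Hypotheses (vR : is_valring R) (KR : forall k : K, R k%:A).

Let Rr : is_subring R. Proof. by case: vR. Qed.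

Definition nonunit (x : E) : Prop := R x /\ forall y, R y -> x * y <> 1.

Lemma nonunitD x y : nonunit x -> nonunit y -> nonunit (x + y).
Proof.
wlog h : x y / R (x / y) => [hw nx ny|].
  have [_ /(_ (x / y)) [h|h]] := vR; first exact: hw.
  by rewrite addrC; apply: hw => //; rewrite -invf_div.
move=> [Rx nx] [Ry ny]; split; first exact: subringD.
move=> u Ru e1; have [y0|y0] := eqVneq y 0.
  by apply: (nx u) => //; rewrite -e1 y0 addr0.
apply: (ny ((x / y + 1) * u)).
  by apply: subringM => //; apply: subringD => //; exact: subring1.
by rewrite -[RHS]e1 mulrA; congr (_ * _); rewrite mulrDr mulr1 mulrC divfK.
Qed.

Lemma nonunit0 : nonunit 0.
Proof. by split=> [|y _ /eqP]; [exact: subring0|rewrite mul0r eq_sym oner_eq0]. Qed.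

(* [x] and [y] have the same value for the valuation with ring [R]. *)
Definition sim (x y : E) : Prop := [/\ x != 0, y != 0, R (x / y) & R (y / x)].

Lemma sim_refl x : x != 0 -> sim x x.
Proof. by move=> x0; split=> //; rewrite mulfV //; exact: subring1. Qed.

Lemma sim_sym x y : sim x y -> sim y x.
Proof. by case=> *; split. Qed.

Lemma sim_trans y x z : sim x y -> sim y z -> sim x z.
Proof.
move=> [x0 y0 h1 h2] [_ z0 h3 h4]; split=> //.
  have -> : x / z = (x / y) * (y / z) by field; rewrite z0 y0.
  exact: subringM.
have -> : z / x = (z / y) * (y / x) by field; rewrite x0 y0.
exact: subringM.
Qed.

Lemma simM x y x' y' : sim x y -> sim x' y' -> sim (x * x') (y * y').
Proof.
move=> [x0 y0 h1 h2] [x0' y0' h3 h4]; split; rewrite ?mulf_neq0 // -mulf_div; exact: subringM.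
Qed.

Lemma simX x y n : sim x y -> sim (x ^+ n) (y ^+ n).
Proof.
move=> h; elim: n => [|n IH]; first by rewrite !expr0; apply: sim_refl; exact: oner_neq0.
by rewrite !exprS; exact: simM.
Qed.

(** The value group has no torsion: if $u/v\notin R$, then $v/u\in R$ and $u/v=(u/v)^{n+1}(v/u)^n$
    is in $R$ after all. *)
Lemma sim_root x y n : (0 < n)%N -> x != 0 -> y != 0 -> sim (x ^+ n) (y ^+ n) -> sim x y.
Proof.
case: n => // n _.
have half u v : u != 0 -> v != 0 -> R (u ^+ n.+1 / v ^+ n.+1) -> R (u / v).
  move=> u0 v0 h; have [_ /(_ (u / v)) [//|hV]] := vR.
  have -> : u / v = (u ^+ n.+1 / v ^+ n.+1) * ((u / v)^-1) ^+ n.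
    have : u / v != 0 by rewrite mulf_neq0 // invr_eq0.
    rewrite -expr_div_n; move: (u / v) => w w0.
    by rewrite exprS exprVn mulfK // expf_neq0.
  by apply: subringM => //; exact: subringX.
by move=> x0 y0 [_ _ h1 h2]; split=> //; exact: half.
Qed.

Lemma sim_scale (k : K) x : k != 0 -> x != 0 -> sim (k *: x) x.
Proof.
move=> k0 x0; have kx0 : k *: x != 0 by rewrite scaler_eq0 negb_or k0 x0.
split=> //.
  by rewrite -scalerAl mulfV.
suff -> : x / (k *: x) = (k^-1)%:A by exact: KR.
by apply: (mulIf kx0); rewrite divfK // mulr_algl scalerA mulVf // scale1r.
Qed.

Lemma min_value (I : finType) (P : pred I) (s : I -> E) i0 :
  P i0 -> (forall i, P i -> s i != 0) ->
  exists i, P i /\ forall j, P j -> R (s j / s i).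
Proof.
move=> Pi0 s0.
suff [i [Pi hi]] : exists i, P i /\ forall j, j \in enum P -> R (s j / s i).
  by exists i; split=> // j Pj; apply: hi; rewrite mem_enum.
have : {subset enum P <= P} by move=> j; rewrite mem_enum.
elim: (enum P) => [|j r IH] sub; first by exists i0.
have [|i [Pi hi]] := IH; first by move=> l lr; apply: sub; rewrite inE lr orbT.
have Pj : P j by apply: (sub j); exact: mem_head.
have [_ /(_ (s j / s i)) [h|]] := vR.
  by exists i; split=> // l; rewrite inE => /orP[/eqP ->|/hi].
rewrite invf_div => h; exists j; split=> // l; rewrite inE => /orP[/eqP ->|/hi h'].
  by rewrite mulfV ?s0 //; exact: subring1.
have -> : s l / s j = (s l / s i) * (s i / s j) by field; rewrite !s0.
exact: subringM.
Qed.

(** Divide by the term of least value: the other quotients are nonunits, and a sum of nonunits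
    cannot be $-1$. *)
Lemma sum_distinct (I : finType) (P : pred I) (s : I -> E) i0 :
  P i0 -> (forall i, P i -> s i != 0) ->
  (forall i j, P i -> P j -> i != j -> ~ sim (s i) (s j)) ->
  \sum_(i | P i) s i <> 0.
Proof.
move=> Pi0 s0 ds; have [i [Pi hi]] := min_value Pi0 s0.
rewrite (bigD1 i) //= => e0.
have : nonunit (\sum_(j | P j && (j != i)) s j / s i).
  apply: (big_ind nonunit); [exact: nonunit0|exact: nonunitD|].
  move=> j /andP[Pj ji]; split; first exact: hi.
  move=> y Ry e; apply: (ds j i) => //; split; rewrite ?s0 //; first exact: hi.
  suff -> : s i / s j = y by [].
  apply: (@mulfI _ (s j / s i)); first by rewrite mulf_neq0 ?invr_eq0 ?s0.
  by rewrite e; field; rewrite !s0.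
case=> _ /(_ (- 1)) []; first by apply: subringN => //; exact: subring1.
move/eqP: e0; rewrite addrC addr_eq0 => /eqP e0.
by rewrite -mulr_suml e0 mulNr mulfV ?s0 // mulrNN mulr1.
Qed.

Lemma distinct_findep (I : finType) (s : I -> E) :
  (forall i, s i != 0) -> (forall i j, i != j -> ~ sim (s i) (s j)) -> findep s.
Proof.
move=> s0 ds c e0 i0; apply/eqP/negPn/negP => ci0.
have := @sum_distinct I (fun i => c i != 0) (fun i => c i *: s i) i0 ci0.
case.
- by move=> i ci; rewrite scaler_eq0 negb_or ci s0.
- move=> i j ci cj ij h; apply: (ds i j ij).
  apply: (sim_trans _ (sim_scale cj (s0 j))); apply: sim_trans h.
  by apply/sim_sym/sim_scale.
- rewrite -[RHS]e0 [RHS](bigID (fun i => c i != 0)) /= [X in _ + X]big1 ?addr0 //.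
  by move=> i; rewrite negbK => /eqP ->; rewrite scale0r.
Qed.

(** The value of $\sum_jc_jb_j$ is at most that of each $b_i$ with $c_i\ne0$, hence it equals their
    minimum: [b] is orthogonal for the valuation. *)
Definition adapted (I : finType) (b : I -> E) : Prop :=
  forall (c : I -> K) i, c i != 0 -> \sum_j c j *: b j != 0 /\ R (b i / \sum_j c j *: b j).

(* A coset [x + span a] not containing [0] has an element of maximal value, because strictly
   increasing values give independent vectors. *)
Lemma max_value D (a : 'I_D -> E) x : ~ fspan a x ->
  exists w, fspan a w /\ forall w', fspan a w' -> R ((x + w) / (x + w')).
Proof.
move=> nx; apply: NNPP => nmax.
have spa := fspan_subspace a.
have [sp0 [spD spZ]] := spa.
have xw w : fspan a w -> x + w != 0.
  move=> hw; apply/eqP => /eqP; rewrite addr_eq0 => /eqP e; apply: nx.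
  by rewrite e -scaleN1r; exact: spZ.
have step w : exists w', fspan a w -> fspan a w' /\ ~ R ((x + w) / (x + w')).
  have [hw|nw] := classic (fspan a w); last by exists 0.
  apply: NNPP => h; apply: nmax; exists w; split=> // w' hw'; apply: NNPP => h'.
  by apply: h; exists w'.
have [f hf] := boolp.choice step.
pose ws n := iter n f 0.
have spw n : fspan a (ws n) by elim: n => [|n /hf []].
pose s n := x + ws n.
have s0 n : s n != 0 by exact: xw.
have lt1 n : ~ R (s n / s n.+1) by have [] := hf _ (spw n).
have R1 n : R (s n.+1 / s n).
  by have [_ /(_ (s n / s n.+1)) [/lt1 //|]] := vR; rewrite invf_div.
have Rle n m : R (s (n + m)%N / s n).
  elim: m => [|m IH]; first by rewrite addn0 mulfV //; exact: subring1.
  rewrite addnS.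
  have -> : s (n + m).+1 / s n = (s (n + m).+1 / s (n + m)%N) * (s (n + m)%N / s n).
    by field; rewrite !s0.
  exact: subringM.
have nlt n m : (n < m)%N -> ~ R (s n / s m).
  move=> nm h; apply: (lt1 n).
  have -> : s n / s n.+1 = (s n / s m) * (s m / s n.+1) by field; rewrite !s0.
  by apply: subringM => //; rewrite -(subnKC nm).
(* These $D+2$ independent elements lie in the span of [x] and [a], which is generated by $D+1$
   vectors. *)
have fs : findep (fun i : 'I_D.+2 => s i).
  apply: distinct_findep => // i j; rewrite neq_ltn => /orP[] ij [_ _ h1 h2]; exact: (nlt _ _ ij).
pose w i : E := if unlift (ord_max : 'I_D.+1) i is Some j then a j else x.
have wx : w ord_max = x by rewrite /w unlift_none.
have wa j : w (lift ord_max j) = a j by rewrite /w liftK.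
have spW i : fspan w (s i).
  have [_ [wD _]] := fspan_subspace w; apply: wD.
    by have := fspan_mem w ord_max; rewrite wx.
  apply: (fspan_trans _ (spw i)) => j.
  by have := fspan_mem w (lift ord_max j); rewrite wa.
have := steinitz fs (fun i => spW i).
by rewrite !card_ord ltnn.
Qed.

(** The valuative form of orthogonalisation: the last vector is replaced by an element of largest
    value in its coset modulo the span of the preceding ones. *)
Lemma adapted_basis D (b : 'I_D -> E) : findep b ->
  exists a : 'I_D -> E, adapted a /\ forall i, fspan b (a i).
Proof.
elim: D b => [|D IH] b fb; first by exists b; split=> [c []|[]].
pose b' i := b (lift ord_max i).
have [|a [ada spa]] := IH b'.
  exact: (findep_reindex (@lift_inj _ ord_max)).
have spb i : fspan b (b' i) by exact: fspan_mem.
have spab i : fspan b (a i) by exact: fspan_trans (spa i).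
have nx : ~ fspan a (b ord_max).
  move=> h; have [c e] := fspan_trans spa h.
  pose c' i := if unlift (ord_max : 'I_D.+1) i is Some j then c j else - 1.
  have := fb c'; rewrite big_ord_recr /= {2}/c' unlift_none scaleN1r e.
  move/(_ _ ord_max); rewrite /c' unlift_none => h1.
  have /eqP : - 1 = 0 :> K.
    apply: h1; apply/eqP; rewrite subr_eq0; apply/eqP; apply: eq_bigr => i _.
    have -> : widen_ord (leqnSn D) i = lift ord_max i.
      by apply: val_inj; rewrite /= /bump leqNgt ltn_ord.
    by rewrite liftK.
  by rewrite oppr_eq0 oner_eq0.
have [w [spw wmax]] := max_value nx.
set x' := b ord_max + w in wmax.
have [sp0 [spD spZ]] := fspan_subspace a.
have [sb0 [sbD sbZ]] := fspan_subspace b.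
exists (fun i => if unlift ord_max i is Some j then a j else x'); split; last first.
  move=> i; case: (unlift ord_max i) => [j|] /=; first exact: spab.
  by apply: sbD; [exact: fspan_mem|exact: fspan_trans spw].
move=> c i; rewrite big_ord_recr /= unlift_none.
under eq_bigr => j _.
  have -> : widen_ord (leqnSn D) j = lift ord_max j.
    by apply: val_inj; rewrite /= /bump leqNgt ltn_ord.
  rewrite liftK; over.
set v := \sum_(j < D) _; set y := v + _.
have [c0|c0] := eqVneq (c ord_max) 0.
  rewrite /y c0 scale0r addr0; case: (unliftP ord_max i) => [j ->|->]; last by rewrite c0 eqxx.
  exact: ada.
have spv : fspan a v by exists (fun j => c (lift ord_max j)).
have yE : y = c ord_max *: (b ord_max + (w + (c ord_max)^-1 *: v)).
  rewrite /y /x' addrA !scalerDr scalerA mulfV // scale1r addrC; congr (_ + _).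
have spu : fspan a (w + (c ord_max)^-1 *: v) by apply: spD => //; exact: spZ.
have y0 : y != 0.
  rewrite yE scaler_eq0 negb_or c0; apply/eqP => /eqP; rewrite addr_eq0 => /eqP e.
  by apply: nx; rewrite e -scaleN1r; exact: spZ.
have Rx : R (x' / y).
  have h := wmax _ spu.
  have -> : x' / y = ((c ord_max)^-1)%:A * (x' / (b ord_max + (w + (c ord_max)^-1 *: v))).
    rewrite yE; set z := b ord_max + _.
    have z0 : z != 0 by apply: contraNneq y0 => z0; rewrite yE -/z z0 scaler0.
    have cc : ((c ord_max)^-1)%:A * (c ord_max)%:A = 1 :> E.
      by rewrite mulr_algl scalerA mulVf // scale1r.
    apply: (mulIf y0); rewrite yE -/z divfK; last by rewrite -yE.
    rewrite -(mulr_algl _ z); move: cc; set A : E := ((c ord_max)^-1)%:A; set C : E := (c ord_max)%:A => cc.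
    have -> : A * (x' / z) * (C * z) = A * C * x' by field.
    by rewrite cc mul1r.
  exact: subringM.
move=> ci; split=> //; case: (unliftP ord_max i) ci => [j -> cj|-> _ //].
have [v0 Rj] := ada (fun j => c (lift ord_max j)) j cj.
rewrite -/v in v0 Rj.
have -> : a j / y = (a j / v) * (v / y) by field; rewrite y0 v0.
apply: subringM => //.
(* As $v=y-cx'$ and the value of $x'$ is at least that of $y$, so is the value of $v$; the
   inequality known for $v$ passes to $y$. *)
have -> : v / y = 1 - (c ord_max)%:A * (x' / y).
  have -> : v = y - c ord_max *: x' by rewrite /y addrK.
  by rewrite mulrBl mulfV // mulr_algl scalerAl.
by apply: subringB => //; [exact: subring1|exact: subringM].
Qed.

Lemma adapted_sim (I : finType) (b : I -> E) (c : I -> K) i :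
  adapted b -> (forall j, c j != 0 -> sim (b j) (b i)) -> c i != 0 ->
  sim (\sum_j c j *: b j) (b i).
Proof.
move=> ad hs ci; have [s0 Ri] := ad c i ci.
have [b0 _ _ _] := hs i ci; split=> //.
rewrite mulr_suml; apply: subring_sum => // j _.
have [->|/hs [_ _ h _]] := eqVneq (c j) 0; first by rewrite scale0r mul0r; exact: subring0.
by rewrite -scalerAl -mulr_algl; exact: subringM.
Qed.

(** No cancellation occurs inside a group, and the group sums have distinct values, so
    [sum_distinct] applies to them. *)
Lemma grouped_findep (I T : finType) (s : I -> E) (h : I -> T) :
  (forall i j, h i != h j -> ~ sim (s i) (s j)) ->
  (forall (c : I -> K) i, c i != 0 -> sim (\sum_(j | h j == h i) c j *: s j) (s i)) ->
  findep s.
Proof.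
move=> ds gs c e0 i0; apply/eqP/negPn/negP => ci0.
pose S g := \sum_(j | h j == g) c j *: s j.
have ex g : S g != 0 -> exists i, h i = g /\ c i != 0.
  move=> Sg; apply: NNPP => nex; case/eqP: Sg; rewrite /S big1 // => j /eqP hj.
  apply/eqP; rewrite scaler_eq0; apply/orP; left; apply/negPn/negP => cj.
  by apply: nex; exists j.
have Si i : c i != 0 -> sim (S (h i)) (s i) by exact: gs.
apply: (@sum_distinct T (fun g => S g != 0) S (h i0)).
- by have [] := Si _ ci0.
- by [].
- move=> g g' /ex [i [<- ci]] /ex [j [<- cj]] ij hs.
  apply: (ds i j ij); apply: sim_trans (Si j cj); apply: sim_trans hs.
  exact/sim_sym/Si.
- rewrite -[RHS]e0 (partition_big h predT) //= [RHS](bigID (fun g => S g != 0)) /=.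
  rewrite [X in _ = _ + X]big1 ?addr0 //.
  by move=> g; rewrite negbK => /eqP.
Qed.

End Values.

(** * Values as exponent vectors with a common denominator *)

Section Exponents.
Import GRing.Theory.
Import mathcomp.algebra_tactics.ring.
Local Open Scope ring_scope.
Variables (K L : fieldType) (iota : {rmorphism K -> L}).
Notation E := (Kfield iota).
Variables (R : E -> Prop) (Ys ys : seq E).
Hypotheses (vR : is_valring R) (KR : forall k : K, R k%:A) (ai : algind Ys).
Notation e := (size Ys).
Hypothesis monR : forall g : 'I_e -> int, lexpos g -> R (mon g) /\ ~ R (mon g)^-1.
Hypothesis subY : forall n x, Pdeg Ys n x -> Pdeg ys n x.

Lemma sim_mon_inj (g h : 'I_e -> int) : sim R (mon g) (mon h) -> g =1 h.
Proof.
move=> [_ _ h1 h2] i; apply/eqP; rewrite -subr_eq0; apply/eqP.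
have e1 : mon (fun i => g i - h i) = mon g / mon h by rewrite monD // monN.
have [/monR [_]|[/monR []|//]] := lex_total (fun i => g i - h i).
  by rewrite e1 invf_div.
by rewrite monN // e1 invf_div => _; rewrite invf_div.
Qed.

Lemma mon_Pdeg (Zs : seq E) n (g : 'I_(size Zs) -> nat) :
  (forall i, (g i <= n)%N) -> Pdeg Zs n (mon (fun i => (g i)%:Z)).
Proof.
elim: Zs g => [|T Zs IH] g gn; first by exists 1; rewrite /mon big_ord0 scale1r.
rewrite mon_cons; exists ((mon (fun i => (g (lift ord0 i))%:Z)) *: 'X^(g ord0)); split.
- by apply: (leq_trans (size_scale_leq _ _)); rewrite size_polyXn ltnS.
- move=> i; rewrite coefZ coefXn; case: eqP => _; rewrite ?mulr1 ?mulr0; last exact: Pdeg0.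
  by apply: IH => j.
- by rewrite hornerZ hornerXn mulrC.
Qed.

(* [v(x) = g / q] in additive notation. *)
Definition isval (q : nat) (x : E) (g : 'I_e -> int) : Prop := sim R (x ^+ q) (mon g).

Lemma isvalM q x y g h : isval q x g -> isval q y h -> isval q (x * y) (fun i => g i + h i).
Proof. by rewrite /isval exprMn monD //; exact: simM. Qed.

Lemma eq_isval q x g h : g =1 h -> isval q x g -> isval q x h.
Proof. by rewrite /isval => /eq_mon ->. Qed.

Lemma monX (g : 'I_e -> int) n : mon g ^+ n = mon (fun i => g i *+ n).
Proof.
elim: n => [|n IH]; first by rewrite expr0 mon0 // => i; rewrite mulr0n.
by rewrite exprS IH -monD //; apply: eq_mon => i; rewrite mulrS.
Qed.

Lemma isval_mon q (g : 'I_e -> int) : isval q (mon g) (fun i => g i *+ q).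
Proof. by rewrite /isval monX; apply: sim_refl => //; exact: mon_neq0. Qed.

Lemma isvalX q x g n : isval q x g -> isval q (x ^+ n) (fun i => g i *+ n).
Proof. by rewrite /isval -monX exprAC; exact: simX. Qed.

Lemma isval_neq0 q x g : (0 < q)%N -> isval q x g -> x != 0.
Proof. by move=> q0 [h _ _ _]; apply: contraNneq h => ->; rewrite expr0n; case: q q0. Qed.

Lemma isval_sim q x y g h : isval q x g -> isval q y h -> sim R x y -> g =1 h.
Proof.
move=> hx hy hs; apply: sim_mon_inj.
apply: (sim_trans vR (sim_sym hx)); apply: sim_trans hy => //; exact: simX.
Qed.

Lemma sim_isval q x y g : (0 < q)%N -> isval q x g -> isval q y g -> sim R x y.
Proof.
move=> q0 hx hy; apply: (@sim_root _ _ _ _ vR _ _ q) => //.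
- exact: isval_neq0 hx.
- exact: isval_neq0 hy.
- by apply: (sim_trans vR hx); exact: sim_sym.
Qed.

(* Powers of [x] with pairwise incongruent values, times monomials, are independent: by the growth
   bound there are boundedly many of them. *)
Lemma exists_isval : growth ys e ->
  exists q, (0 < q)%N /\ forall x, Kalg ys x -> x != 0 -> exists g, isval q x g.
Proof.
move=> /growth_bound [c hc]; pose N := (c * 2 ^ e)%N.
(* Every $j\le N$ divides $N!$, so one denominator serves all elements. *)
exists N`!; split; first exact: fact_gt0.
move=> x [l px] x0.
have [j [j0 jN [g hg]]] : exists j, [/\ (0 < j)%N, (j <= N)%N & exists g : 'I_e -> int, sim R (x ^+ j) (mon g)].
  (* With exponents up to $n=Nl$ the monomials have the degree bound of $x^N$. The $(N+1)(n+1)^e$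
     products would be independent of degree at most $2n$, while $c(2n+1)^e\le N(n+1)^e$ by the
     choice $N=c2^e$. *)
  apply: NNPP => nex; pose n := (N * l)%N.
  pose s (p : 'I_N.+1 * {ffun 'I_e -> 'I_n.+1}) : E :=
    x ^+ p.1 * mon (fun i => (p.2 i : nat)%:Z).
  have s0 p : s p != 0 by rewrite mulf_neq0 ?expf_neq0 ?mon_neq0.
  have key (p p' : 'I_N.+1 * {ffun 'I_e -> 'I_n.+1}) : (p.1 < p'.1)%N -> ~ sim R (s p) (s p').
    move=> lt hs; apply: nex; exists (p'.1 - p.1)%N; split.
    - by rewrite subn_gt0.
    - by apply: (leq_trans (leq_subr _ _)); rewrite -ltnS.
    exists (fun i => (p.2 i : nat)%:Z - (p'.2 i : nat)%:Z).
    rewrite monD // monN //.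
    move: hs; rewrite /s; have := mon_neq0 ai (fun i => (p.2 i : nat)%:Z).
    have := mon_neq0 ai (fun i => (p'.2 i : nat)%:Z).
    move: (mon _) (mon _) => A A' A'0 A0 hs.
    have xp0 := expf_neq0 p.1 x0.
    have h := simM vR (sim_sym hs) (@sim_refl _ _ _ _ vR ((x ^+ p.1 * A')^-1) _).
    have -> : x ^+ (p'.1 - p.1) = x ^+ p'.1 * A' * (x ^+ p.1 * A')^-1.
      rewrite -{2}(subnK (ltnW lt)) exprD; move: (x ^+ (_ - _)) (x ^+ p.1) xp0 => u v v0.
      by field; rewrite v0 A'0.
    have -> : A * A'^-1 = x ^+ p.1 * A * (x ^+ p.1 * A')^-1.
      by move: (x ^+ p.1) xp0 => v v0; field; rewrite v0 A'0.
    by apply: h; rewrite invr_eq0 mulf_neq0.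
  have fs : findep s.
    apply: (distinct_findep vR KR) => // p p' pp' hs.
    case: (ltngtP p.1 p'.1) => [lt|lt|/val_inj e1].
    - exact: (key p p').
    - by apply: (key p' p) => //; exact: sim_sym.
    case/negP: pp'; case: p p' e1 hs => [i al] [i' be] /= <- hs.
    have hm : sim R (mon (fun i => (al i : nat)%:Z)) (mon (fun i => (be i : nat)%:Z)).
      have := simM vR (@sim_refl _ _ _ _ vR ((x ^+ i)^-1) _) hs.
      rewrite /s /= !mulKf ?expf_neq0 //; apply.
      by rewrite invr_eq0 expf_neq0.
    apply/eqP; congr (_, _); apply/ffunP => k; apply: val_inj.
    by have := sim_mon_inj hm k => -[].
  have ps p : Pdeg ys (N * l + n) (s p).
    apply: PdegM.
      apply: (@Pdeg_mono _ _ _ _ (p.1 * l)); last exact: Pdeg_exp.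
      by rewrite leq_mul2r -ltnS ltn_ord orbT.
    by apply: subY; apply: mon_Pdeg => i; rewrite -ltnS.
  have := hc _ _ _ fs ps; apply/negP; rewrite -ltnNge.
  rewrite card_prod card_ord card_ffun !card_ord.
  apply: (@leq_ltn_trans (N * n.+1 ^ e)); last by rewrite ltn_mul2r ltnSn expn_gt0.
  have -> : (N * n.+1 ^ e = c * (2 * n.+1) ^ e)%N by rewrite expnMn mulnA.
  rewrite leq_mul2l; apply/orP; right; apply: expn_mono.
  by rewrite /n; lia.
exists (fun i => g i *+ (N`! %/ j)).
rewrite /isval -monX -[X in x ^+ X](divnK (_ : (j %| N`!)%N)); last by apply: dvdn_fact; rewrite j0.
by rewrite mulnC exprM; exact: simX.
Qed.

End Exponents.

Lemma decomp_uniq (q M x x' c c' t t' : int) :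
  (0 < q)%R -> (0 < M)%R -> (0 <= c < q)%R -> (0 <= c' < q)%R -> (0 <= t < M)%R -> (0 <= t' < M)%R ->
  (q * M * x + c + q * t = q * M * x' + c' + q * t')%R -> [/\ x = x', c = c' & t = t'].
Proof.
move=> q0 M0 hc hc' ht ht' e1.
have e2 : (q * (M * x + t - M * x' - t') = c' - c)%R by lia.
have u0 : (M * x + t - M * x' - t' = 0)%R by nia.
have ec : c = c' by lia.
have e3 : (M * (x - x') = t' - t)%R by lia.
have ex : (x - x' = 0)%R by nia.
by split; nia.
Qed.

(** * The dilation inequality *)

(* In every fibre of [key], select an element whose [val]-fibre is largest. *)
Lemma popular_representatives (J T3 : finType) (T1 T2 : eqType) (key : J -> T1) (val : J -> T2) (rho : J -> T3) :
  (forall j j', key j = key j' -> rho j = rho j' -> val j = val j') ->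
  (forall j j', val j = val j' -> key j = key j') ->
  exists rep : J -> J, [/\ forall j, key (rep j) = key j,
    forall j j', key j = key j' -> rep j = rep j' &
    #|J| <= #|T3| * #|[set j | val j == val (rep j)]|].
Proof.
move=> kr vk; pose mult j := #|[set j' | val j' == val j]|.
pose best t := [pick j | (key j == t) && [forall j', (key j' == t) ==> (mult j' <= mult j)]].
pose rep j := odflt j (best (key j)).
have repP j : key (rep j) = key j /\ forall j', key j' = key j -> mult j' <= mult (rep j).
  rewrite /rep /best; case: pickP => [r /andP[/eqP kr' /forallP h]|/=].
    by split=> //= j' /eqP kj'; exact: (implyP (h j')).
  have [m /eqP km mmax] := @arg_maxnP _ j (fun j' => key j' == key j) mult (eqxx _).
  by move/(_ m); rewrite km eqxx /= => /forallP []; move=> j'; apply/implyP => /mmax.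
have repE j j' : key j = key j' -> rep j = rep j'.
  move=> e; have [h1 _] := repP j; have [h2 _] := repP j'.
  move: h1 h2; rewrite /rep /best e; case: pickP => //= h.
  have [m /eqP km mmax] := @arg_maxnP _ j (fun i => key i == key j) mult (eqxx _).
  by move: (h m); rewrite km -e eqxx /= => /forallP []; move=> i; apply/implyP => /mmax.
exists rep; split=> //; first by move=> j; case: (repP j).
have repK j : rep (rep j) = rep j by apply: repE; case: (repP j).
pose M r := #|[set j | (rep j == r) && (val j == val r)]|.
have -> : #|J| = \sum_r \sum_(t : T3) #|[set j | (rep j == r) && (rho j == t)]|.
  rewrite -sum1_card (partition_big rep predT) //=; apply: eq_bigr => r _.
  rewrite (partition_big rho predT) //=; apply: eq_bigr => t _.
  by rewrite -sum1_card; apply: eq_bigl => j; rewrite inE.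
(* Within a fibre of [key], the residue [rho] determines the value; so each piece lies in a single
   [val]-fibre, which is no larger than that of the representative [r]. *)
have le r t : #|[set j | (rep j == r) && (rho j == t)]| <= M r.
  have [->|[j0]] := set_0Vmem [set j | (rep j == r) && (rho j == t)]; first by rewrite cards0.
  rewrite inE => /andP[/eqP rj0 /eqP tj0].
  have keyr j : rep j = r -> key j = key r by move=> <-; case: (repP j).
  apply: (@leq_trans (mult j0)).
    apply: subset_leq_card; apply/subsetP => j; rewrite !inE => /andP[/eqP rj /eqP tj].
    by apply/eqP; apply: kr; [rewrite keyr // keyr|rewrite tj].
  have [_ h] := repP j0; apply: leq_trans (h j0 erefl) _; rewrite rj0.
  apply: subset_leq_card; apply/subsetP => j; rewrite !inE => /eqP vj; rewrite vj eqxx andbT.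
  by rewrite (repE j r) -?{1}rj0 ?repK ?rj0 //; exact: vk.
apply: (@leq_trans (\sum_r \sum_(t : T3) M r)).
  by apply: leq_sum => r _ /=; apply: leq_sum => t _; exact: le.
under eq_bigr do rewrite sum_nat_const.
rewrite -big_distrr /= leq_mul2l; apply/orP; right.
rewrite -sum1_card [leqRHS](partition_big rep predT) //=; apply: leq_sum => r _.
rewrite /M -sum1_card; apply: eq_leq; apply: eq_bigl => j; rewrite !inE andbC.
by case: (rep j =P r) => [->|_]; rewrite ?andbF ?andbT.
Qed.

(** * Products realising the points of dilated cells *)

Section Counting.
Import GRing.Theory.
Import mathcomp.algebra_tactics.ring.
Local Open Scope ring_scope.
Variables (K L : fieldType) (iota : {rmorphism K -> L}).
Notation E := (Kfield iota).
Variables (R : E -> Prop) (Ys : seq E).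
Hypotheses (vR : is_valring R) (KR : forall k : K, R k%:A) (ai : algind Ys).
Notation e := (size Ys).
Hypothesis monR : forall g : 'I_e -> int, lexpos g -> R (mon g) /\ ~ R (mon g)^-1.
Variables (q a k' D : nat) (b : 'I_D -> E) (g : 'I_D -> {ffun 'I_e -> int}).
Hypotheses (q0 : (0 < q)%N) (adb : adapted R b) (bg : forall j, isval R q (b j) (g j)).
Notation k := (q * k').+1.
Notation a1 := a.+1.

(* The cells are cubes of side [a1 * q], cut into classes modulo [q]; [k = 1] modulo [q] makes the
   [k]-th multiple of a value stay in its class. *)
Let cell j i : int := (g j i %/ (a1 * q)%N)%Z.
Let rem j i : int := (g j i %% (a1 * q)%N)%Z.
Let cls j i : int := (rem j i %% q)%Z.
Let rho j i : int := (rem j i %/ q)%Z.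

Let gE j i : g j i = cell j i * (a1 * q)%N%:Z + (rho j i * q%:Z + cls j i).
Proof. by rewrite /cls /rho -divz_eq -divz_eq. Qed.

Let clsP j i : (0 <= cls j i < q%:Z)%R.
Proof. by rewrite /cls modz_ge0 ?ltz_pmod //; lia. Qed.

Let rhoP j i : (0 <= rho j i < a1%:Z)%R.
Proof.
have h1 : (0 <= rem j i)%R by apply: modz_ge0; lia.
have h2 : (rem j i < (a1 * q)%N%:Z)%R by apply: ltz_pmod; lia.
have := divz_eq (rem j i) q; rewrite -/(rho j i) -/(cls j i) => h3.
have := clsP j i => h4; nia.
Qed.

Let key j : {ffun 'I_e -> int} * {ffun 'I_e -> int} := ([ffun i => cell j i], [ffun i => cls j i]).
Let rhoO j : {ffun 'I_e -> 'I_a1} := [ffun i => inord `|rho j i|].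

Let key_rho j j' : key j = key j' -> rhoO j = rhoO j' -> g j = g j'.
Proof.
move=> [/ffunP e1 /ffunP e2] /ffunP e3; apply/ffunP => i.
have := e1 i; have := e2 i; have := e3 i; rewrite !ffunE => h3 h2 h1.
have : rho j i = rho j' i.
  have := congr1 val h3; rewrite /= !inordK; have := rhoP j i; have := rhoP j' i; lia.
by rewrite !gE h1 h2 => ->.
Qed.

Let val_key j j' : g j = g j' -> key j = key j'.
Proof. by rewrite /key /cell /cls /rem => ->. Qed.

(** [leD] bounds $D$ by $(a+1)^e|S|$, and each index of [S] comes with $(k(a+1))^e$ monomials. The
    target value determines cell, class and point, so products with different [h] have different
    values; those with the same [h] differ only in the factor [b j], and [adapted_sim] excludes
    their cancellation. *)
Lemma dilated_family : exists (I : finType) (s : I -> E),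
  [/\ (k ^ e * D <= #|I|)%N, findep s & forall i, exists (j j' : 'I_D) (al : 'I_e -> nat),
      (forall l, (al l <= 2 * k * a1)%N) /\ s i = b j ^+ (q * k') * b j' * mon (fun l => (al l)%:Z)].
Proof.
have [rep [keyrep repE leD]] := popular_representatives key_rho val_key.
pose S := [set j | g j == g (rep j)].
pose T := {ffun 'I_e -> 'I_(k * a1)}.
(* Solves $kg_j+q\alpha=\mathrm{tgt}$, which is possible because $k=qk'+1$ leaves the class of $g_j$
   unchanged. The target is shifted by one dilated cell (the $+1$ in [tgt]), which keeps $\alpha$
   nonnegative and costs the factor $2$ in its upper bound. *)
pose al j (t : T) i : int :=
  (t i : nat)%:Z + (k * a1)%N%:Z - k%:Z * rho j i - k'%:Z * cls j i.
have alP j t i : (0 <= al j t i <= (2 * k * a1)%N%:Z)%R.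
  have := rhoP j i; have := clsP j i; have := ltn_ord (t i); rewrite /al.
  move: (cls j i) (rho j i) (nat_of_ord (t i)) => c r u; nia.
pose s (p : {x : 'I_D * T | x.1 \in S}) : E :=
  b (rep (val p).1) ^+ (q * k') * b (val p).1 * mon (al (val p).1 (val p).2).
pose tgt j (t : T) i : int := q%:Z * (k * a1)%N%:Z * (cell j i + 1) + cls j i + q%:Z * (t i : nat)%:Z.
have sval p : isval R q (s p) (tgt (val p).1 (val p).2).
  have gj : g (val p).1 = g (rep (val p).1) by have := valP p; rewrite inE => /eqP.
  rewrite /s; move: gj; case: (val p) => j t /= gj.
  apply: (@eq_isval _ _ _ _ _ _ _ (fun i => g j i *+ (q * k') + g j i + al j t i *+ q)).
    move=> i; rewrite /tgt /al gE -[_ *+ (q * k')]mulr_natr -[_ *+ q]mulr_natr !natz.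
    rewrite !(PoszM, intS); move: (cell j i) (rho j i) (cls j i) => x y z.
    by move: (Posz q) (Posz k') (Posz a) (Posz (t i)) => Q k1 A u; ring.
  apply: isvalM => //; last exact: isval_mon.
  by apply: isvalM => //; apply: isvalX => //; rewrite gj.
have tgt_inj (p p' : {x : 'I_D * T | x.1 \in S}) : tgt (val p).1 (val p).2 =1 tgt (val p').1 (val p').2 ->
    key (val p).1 = key (val p').1 /\ (val p).2 = (val p').2.
  case: (val p) => j t /=; case: (val p') => j' t' /= h.
  have h' i : [/\ cell j i = cell j' i, cls j i = cls j' i & t i = t' i].
    have /(@decomp_uniq q (k * a1)%N) := h i.
    case; try (by lia); try exact: clsP.
      by have := ltn_ord (t i); lia.
      by have := ltn_ord (t' i); lia.
    by move=> h1 h2 [h3]; split=> //; [lia|exact: val_inj].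
  split; last by apply/ffunP => i; case: (h' i).
  by congr (_, _); apply/ffunP => i; rewrite !ffunE; case: (h' i).
exists {x : 'I_D * T | x.1 \in S}, s; split.
- have -> : #|{: {x : 'I_D * T | x.1 \in S}}| = (#|S| * (k * a1) ^ e)%N.
    rewrite card_sig -[X in (_ * X ^ _)%N](card_ord (k * a1)) -[X in (_ * _ ^ X)%N](card_ord e) -card_ffun.
    rewrite -cardsT -cardsX; apply: eq_card => -[j t]; by rewrite !inE andbT.
  rewrite expnMn mulnCA leq_mul2l; apply/orP; right.
  by move: leD; rewrite card_ffun !card_ord mulnC.
- pose h (p : {x : 'I_D * T | x.1 \in S}) := (rep (val p).1, (val p).2).
  apply: (grouped_findep vR (h := h)).
    move=> p p' /eqP hpp' hs; apply: hpp'.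
    have [kk tt] := tgt_inj _ _ (isval_sim vR ai monR (sval p) (sval p') hs).
    by rewrite /h tt (repE _ _ kk).
  move=> c p cp.
  have hsim j j' : g j = g j' -> sim R (b j) (b j').
    by move=> gj; apply: (sim_isval vR q0 (bg j)); rewrite gj.
  pose r := rep (val p).1.
  have gr j : j \in S -> rep j = r -> g j = g (val p).1.
    by move: (valP p); rewrite !inE => /eqP gp /eqP -> rj; rewrite gp /r rj.
  (* The coefficients of the group of [p], transported to the indices of [b] and extended by zero,
     so that the group sum becomes one combination of the [b j] times a common factor. *)
  pose c' (j : 'I_D) : K := if insub (j, (val p).2) is Some p' then (if rep j == r then c p' else 0) else 0.
  have c'p : c' (val p).1 = c p by rewrite /c' -surjective_pairing valK eqxx.
  have c'nz j : c' j != 0 -> j \in S /\ rep j = r.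
    rewrite /c'; case: insubP => [u /= uS _|]; last by rewrite eqxx.
    by case: (rep j =P r) => // _; rewrite eqxx.
  have -> : \sum_(j | h j == h p) c j *: s j =
      b r ^+ (q * k') * (\sum_j c' j *: b j) * mon (al (val p).1 (val p).2).
    rewrite mulr_sumr mulr_suml.
    rewrite (bigID (fun j => (j \in S) && (rep j == r))) /= [X in _ = _ + X]big1 ?addr0; last first.
      move=> j nj; have [->|/c'nz [jS rj]] := eqVneq (c' j) 0; first by rewrite scale0r mulr0 mul0r.
      by rewrite jS rj eqxx in nj.
    rewrite (reindex_omap (fun p' : {x : 'I_D * T | x.1 \in S} => (val p').1)
       (fun j => insub (j, (val p).2))) /=; last first.
      by move=> j /andP[jS _]; rewrite insubT.
    apply: eq_big => [p'|p' /eqP [rp tp]].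
      rewrite (valP p') /= /h xpair_eqE -/r; congr (_ && _).
      case: p' => [[j t] jS] /=; rewrite (insubT (fun x : 'I_D * T => x.1 \in S) (jS : (j, (val p).2).1 \in S)).
      apply/eqP/eqP => [->|]; last by move=> /Some_inj /(congr1 val) [].
      by congr Some; apply: val_inj.
    rewrite /s rp -/r.
    have gp : g (val p').1 = g (val p).1 by exact: gr _ (valP p') rp.
    have -> : c' (val p').1 = c p'.
      by rewrite /c' -tp -surjective_pairing valK rp eqxx.
    have -> : mon (al (val p').1 (val p').2) = mon (al (val p).1 (val p).2).
      by apply: eq_mon => i; rewrite /al /rho /cls /rem gp tp.
    by rewrite -scalerAr -scalerAl.
  rewrite /s -/r; apply: simM => //; last by apply: sim_refl => //; exact: mon_neq0.
  apply: simM => //.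
    by apply: sim_refl => //; apply: expf_neq0; exact: isval_neq0 q0 (bg r).
  apply: adapted_sim => //; last by rewrite c'p.
  by move=> j /c'nz [jS rj]; apply: hsim; exact: gr.
- move=> [[j t] jS]; exists (rep j), j, (fun l => `|al j t l|%N); split.
    by move=> l /=; have := alP j t l; lia.
  by rewrite /s /=; congr (_ * _); apply: eq_mon => l; have := alP j t l; lia.
Qed.

End Counting.

(** * The fraction field of $B$ and dehomogenisation *)

Definition domain_of (K : fieldType) (B : comAlgType K) (h : integral_domain B) : Type := B.

Section DomainStructure.
Import GRing.Theory.
Import mathcomp.algebra_tactics.ring.
Local Open Scope ring_scope.
Variables (K : fieldType) (B : comAlgType K) (h : integral_domain B).
Notation D := (domain_of h).
HB.instance Definition _ := GRing.ComAlgebra.copy D B.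

Definition dom_unit : {pred D} := fun x => boolp.asbool (exists y : D, y * x = 1).
Definition dom_inv (x : D) : D :=
  if excluded_middle_informative (exists y : D, y * x = 1) is left p then proj1_sig (boolp.cid p) else x.

Fact dom_mulVx : {in dom_unit, left_inverse 1 dom_inv *%R}.
Proof.
move=> x; rewrite unfold_in => /boolp.asboolP p; rewrite /dom_inv.
by case: excluded_middle_informative => // p'; case: boolp.cid.
Qed.
Fact dom_unitPl (x y : D) : y * x = 1 -> dom_unit x.
Proof. by move=> e; apply/boolp.asboolP; exists y. Qed.
Fact dom_invr_out : {in [predC dom_unit], dom_inv =1 id}.
Proof.
move=> x; rewrite inE unfold_in => /boolp.asboolP p; rewrite /dom_inv.
by case: excluded_middle_informative.
Qed.
HB.instance Definition _ := GRing.ComNzRing_hasMulInverse.Build D dom_mulVx dom_unitPl dom_invr_out.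

Fact dom_mulf_eq0 (x y : D) : x * y = 0 -> (x == 0) || (y == 0).
Proof. by case: h => _ hd /hd [] ->; rewrite eqxx ?orbT. Qed.
HB.instance Definition _ := GRing.ComUnitRing_isIntegral.Build D dom_mulf_eq0.

Definition scalar_frac : {rmorphism K -> {fraction D}} := @tofrac D \o in_alg D.

Definition embed (x : B) : Kfield scalar_frac := tofrac (x : D).

End DomainStructure.

Section Embedding.
Import GRing.Theory.
Import mathcomp.algebra_tactics.ring.
Local Open Scope ring_scope.
Variables (K : fieldType) (B : comAlgType K) (h : integral_domain B).
Notation E := (Kfield (scalar_frac h)).
Let em : B -> E := embed h.

Lemma embedM x y : em (x * y) = em x * em y.
Proof. exact: (rmorphM (@tofrac (domain_of h))). Qed.
Lemma embed1 : em 1 = 1.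
Proof. exact: (rmorph1 (@tofrac (domain_of h))). Qed.
Lemma embedD x y : em (x + y) = em x + em y.
Proof. exact: (rmorphD (@tofrac (domain_of h))). Qed.
Lemma embedX x n : em (x ^+ n) = em x ^+ n.
Proof. exact: (rmorphXn (@tofrac (domain_of h))). Qed.
Lemma embedZ (k : K) x : em (k *: x) = k *: em x.
Proof. by rewrite kscaleE -[k *: x]mulr_algl embedM. Qed.
Lemma embed_eq0 x : (em x == 0) = (x == 0).
Proof. exact: (tofrac_eq0 (x : domain_of h)). Qed.
Lemma embed0 : em 0 = 0.
Proof. by apply/eqP; rewrite embed_eq0. Qed.

Lemma embed_sum (I : finType) (c : I -> K) (b : I -> B) :
  em (\sum_i c i *: b i) = \sum_i c i *: em (b i).
Proof.
apply: (big_ind2 (fun x y => em x = y)) => [|x _ y _ <- <-|i _]; first exact: embed0.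
  exact: embedD.
exact: embedZ.
Qed.

Variables (Bn : nat -> B -> Prop) (z0 : B).
Hypotheses (grB : graded Bn) (Bz0 : Bn 1%N z0) (z00 : z0 != 0).

Let ez0 : em z0 != 0. Proof. by rewrite embed_eq0. Qed.

Definition dehom n (x : B) : E := em x / em z0 ^+ n.

Lemma dehom_sum n (I : finType) (c : I -> K) (b : I -> B) :
  dehom n (\sum_i c i *: b i) = \sum_i c i *: dehom n (b i).
Proof. by rewrite /dehom embed_sum mulr_suml; apply: eq_bigr => i _; rewrite scalerAl. Qed.

Lemma dehom_eq0 n x : (dehom n x == 0) = (x == 0).
Proof. by rewrite mulf_eq0 invr_eq0 expf_eq0 (negPf ez0) andbF orbF embed_eq0. Qed.

Lemma dehomM m n x y : dehom (m + n) (x * y) = dehom m x * dehom n y.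
Proof. by rewrite /dehom embedM exprD mulf_div. Qed.

Lemma dehomX n x k : dehom (k * n) (x ^+ k) = dehom n x ^+ k.
Proof. by rewrite /dehom embedX expr_div_n -exprM mulnC. Qed.

Lemma dehom_findep n (I : finType) (b : I -> B) : findep b <-> findep (fun i => dehom n (b i)).
Proof.
split=> fb c; first by rewrite -dehom_sum => /eqP; rewrite dehom_eq0 => /eqP /fb.
move=> e0; apply: fb; apply/eqP; by rewrite -dehom_sum dehom_eq0 e0.
Qed.

Lemma dehom_fspan n (I : finType) (b : I -> B) y :
  fspan (fun i => dehom n (b i)) y -> exists2 x, fspan b x & y = dehom n x.
Proof. by move=> [c ->]; exists (\sum_i c i *: b i); [exists c|rewrite dehom_sum]. Qed.

Definition dehomog n (y : E) : Prop := exists2 x, Bn n x & y = dehom n x.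

Lemma dehomogM m n y y' : dehomog m y -> dehomog n y' -> dehomog (m + n) (y * y').
Proof.
by move=> [x Bx ->] [x' Bx' ->]; exists (x * x'); [exact: graded_mul|rewrite dehomM].
Qed.

(** Since $1=z_0^n/z_0^n$, the images of the $B_n$ in $E$ increase with $n$; monomials can therefore
    be padded to any larger degree. *)
Lemma dehomog1 n : dehomog n 1.
Proof.
exists (z0 ^+ n); first by rewrite -[X in Bn X]muln1; exact: graded_exp.
by rewrite /dehom embedX mulfV // expf_neq0.
Qed.

Lemma dehomogX n y k : dehomog n y -> dehomog (k * n) (y ^+ k).
Proof.
by move=> [x Bx ->]; exists (x ^+ k); [exact: graded_exp|rewrite dehomX].
Qed.

Lemma dehomog_mon (Ys : seq E) (al : 'I_(size Ys) -> nat) M g :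
  (forall y, y \in Ys -> dehomog 1 y) -> (forall i, (al i <= M)%N) -> (size Ys * M <= g)%N ->
  dehomog g (mon (fun i => (al i)%:Z)).
Proof.
move=> hY hal le.
have h' : dehomog (size Ys * M) (mon (fun i => (al i)%:Z)).
  rewrite /mon -[X in dehomog (X * _) _]card_ord -sum1_card.
  rewrite big_distrl /=.
  apply: (big_ind2 dehomog) => [|m y n y'|i _]; [exact: dehomog1|exact: dehomogM|].
  rewrite mul1n -(subnK (hal i)) -[_ ^ _]mul1r; apply: dehomogM; first exact: dehomog1.
  rewrite -[X in dehomog X]muln1; apply: dehomogX; apply: hY; exact: mem_nth.
by rewrite -(subnK le) -[mon _]mul1r; apply: dehomogM => //; exact: dehomog1.
Qed.

End Embedding.

(** * The dilation inequality in the graded algebra *)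

Section Dilation.
Import GRing.Theory.
Import mathcomp.algebra_tactics.ring.
Local Open Scope ring_scope.
Variables (K : fieldType) (B : comAlgType K) (Bn : nat -> B -> Prop).
Hypotheses (domB : integral_domain B) (grB : graded Bn) (ftB : finite_type B).
Hypotheses (genB : generated_by (Bn 1%N)) (dimB : krull_dim_pos B).

(** If $B_1=0$, then $B=K$ is a field and has no strict inclusion of prime ideals. *)
Lemma degree1_nonzero : exists2 z0, Bn 1%N z0 & z0 != 0.
Proof.
apply: NNPP => nz.
have z1 x : Bn 1%N x -> x = 0.
  by move=> Bx; apply: NNPP => /eqP x0; apply: nz; exists x.
have sc (x : B) : exists k : K, x = k%:A.
  move: x (genB x); apply: in_subalg_ind_ring.
  - by move=> x /z1 ->; exists 0; rewrite scale0r.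
  - by exists 1; rewrite scale1r.
  - by move=> _ _ [k ->] [l ->]; exists (k + l); rewrite scalerDl.
  - by move=> _ _ [k ->] [l ->]; exists (k * l); rewrite -scalerAl mul1r scalerA.
  - by move=> c _ [k ->]; exists (c * k); rewrite scalerA.
have [p [q [[[p0 [_ pM]] _] [[[q0 [_ qM]] [q1 _]] [_ [x [qx npx]]]]]]] := dimB.
have [k e] := sc x.
have [k0|k0] := eqVneq k 0; first by apply: npx; rewrite e k0 scale0r.
apply: q1; have -> : 1 = (k^-1)%:A * x :> B; last exact: qM.
by rewrite e mulr_algl scalerA mulVf // scale1r.
Qed.

Lemma power_pos_nonzero n : exists2 x, Bn n x & x != 0.
Proof.
have [z0 Bz0 z00] := degree1_nonzero; exists (z0 ^+ n).
  by rewrite -[X in Bn X]muln1; exact: graded_exp.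
elim: n => [|n IH]; first by rewrite expr0 oner_neq0.
rewrite exprS; apply/eqP => /(proj2 domB) []; apply/eqP => //.
Qed.

(** The bound on [g] is the degree of a monomial in [e] variables with exponents at most $2k(a+1)$.
    The factors [x] and [x'] stay in the span of [b], hence in any filtration step that contains
    [b]. *)
Theorem dilation : exists e q c : nat, [/\ (0 < q)%N,
  (forall n (I : finType) (b : I -> B), findep b -> (forall i, Bn n (b i)) -> (#|I| <= c * n.+1 ^ e)%N) &
  forall m D (b : 'I_D -> B), findep b -> (forall i, Bn m (b i)) ->
  forall a k' g, (e * (2 * (q * k').+1 * a.+1) <= g)%N ->
  exists (I : finType) (s : I -> B), [/\ ((q * k').+1 ^ e * D <= #|I|)%N, findep s &
    forall i, exists x x' w, [/\ fspan b x, fspan b x', Bn g w & s i = x ^+ (q * k') * x' * w]]].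
Proof.
have [z0 Bz0 z00] := degree1_nonzero.
have [p [z [Bz spz]]] := degree1_finite grB genB ftB.
pose psi n : B -> Kfield (scalar_frac domB) := dehom domB z0 n.
pose ys : seq (Kfield (scalar_frac domB)) := [seq psi 1%N (z i) | i : 'I_p].
have ysP y : y \in ys -> @dehomog K B domB Bn z0 1 y.
  by move=> /imageP [i _ ->]; exists (z i).
have [Ys [subYs subY ai gr]] := @transcendence_basis _ _ (scalar_frac domB) ys.
have [R [vR KR monR]] := lex_valring ai.
have [q [q0 hval]] := exists_isval vR KR ai monR subY gr.
have [c hc] := growth_bound gr.
have psiP n x : Bn n x -> Pdeg ys n (psi n x).
  move=> /(homogeneous_monom grB genB Bz spz) [d ->].
  rewrite /psi dehom_sum; apply: subspace_sum; first exact: Pdeg_subspace.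
  move=> t; rewrite /monom; case: t => t /= /eqP <-.
  elim: t => [|j t IH].
    by rewrite big_nil /dehom embed1 expr0 invr1 mulr1; exact: Pdeg1.
  rewrite big_cons /= -add1n dehomM; apply: PdegM => //; apply: Pdeg_var.
  by apply/imageP; exists j.
exists (size Ys), q, c; split=> //.
  move=> n I b fb Bb; apply: hc (n) _ (fun i => psi n (b i)) _ _.
    exact/(dehom_findep domB z00).
  by move=> i; exact: psiP.
move=> m D b fb Bb a k' g leg.
have [a' [ada spa]] := adapted_basis vR KR (proj1 (dehom_findep domB z00 m b) fb).
have /fin_all_exists2 [x spx ex] := (fun i => dehom_fspan (spa i)).
have Bx i : Bn m (x i).
  by have [d ->] := spx i; apply: subspace_sum => //; case: grB.
have a0 i : a' i != 0.
  have := ada (fun j => (j == i)%:R) i; rewrite eqxx oner_neq0 => /(_ isT) [].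
  rewrite (bigD1 i) //= eqxx scale1r big1 ?addr0 // => j /negPf ->.
  by rewrite scale0r.
have /fin_all_exists [gg hgg] : forall i, exists g : {ffun 'I_(size Ys) -> int}, isval R q (a' i) g.
  move=> i; have [|gi hgi] := hval (a' i) _ (a0 i).
    by exists m; rewrite ex; exact: psiP.
  exists [ffun l => gi l]; apply: eq_isval hgi => l; by rewrite ffunE.
have [I [s [leI fs hs]]] := dilated_family vR KR ai monR a k' q0 ada hgg.
have hs' i : exists y, (exists j j' w, [/\ Bn g w & y = x j ^+ (q * k') * x j' * w]) /\
    s i = psi (q * k' * m + m + g)%N y.
  have [j [j' [al [hal ->]]]] := hs i.
  have [w Bw ew] := dehomog_mon grB Bz0 z00 (fun y yY => ysP y (subYs y yY)) hal leg.
  exists (x j ^+ (q * k') * x j' * w); split; first by exists j, j', w.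
  by rewrite ew !ex /psi !dehomM dehomX.
have /fin_all_exists [t ht] := hs'.
exists I, t; split=> //.
  apply/(dehom_findep domB z00 (q * k' * m + m + g)) => d e0; apply: fs.
  by rewrite -[RHS]e0; apply: eq_bigr => i _; have [_ ->] := ht i.
move=> i; have [[j [j' [w [Bw ->]]]] _] := ht i.
by exists (x j), (x j'), w; split.
Qed.

End Dilation.

(** * Filtrations and dimensions *)

Lemma finite_minimum d (l : 'I_d.+1 -> R) : exists i, forall j, Rle (l i) (l j).
Proof.
elim: d l => [|d IH] l; first by exists ord0 => j; rewrite (ord1 j); exact: Rle_refl.
have [i hi] := IH (fun j => l (lift ord0 j)).
have [h|h] := Rle_dec (l ord0) (l (lift ord0 i)).
  by exists ord0 => j; case: (unliftP ord0 j) => [j' ->|->]; [have := hi j'|]; lra.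
by exists (lift ord0 i) => j; case: (unliftP ord0 j) => [j' ->|->]; [have := hi j'|]; lra.
Qed.

Section FilteredAlgebra.
Local Open Scope R_scope.
Variables (K : fieldType) (B : comAlgType K) (f : nat -> R).
Variables (Bn : nat -> B -> Prop) (F : nat -> R -> B -> Prop).
Hypotheses (domB : integral_domain B) (grB : graded Bn) (ftB : finite_type B).
Hypotheses (genB : generated_by (Bn 1%N)) (dimB : krull_dim_pos B).
Hypothesis filtF : forall n, (1 <= n)%N -> filtration_on (Bn n) (F n).

(** Separatedness makes the supremum finite, exhaustiveness makes its set nonempty, and left
    continuity makes it attained. *)
Lemma filtration_lambda n a : (1 <= n)%N -> Bn n a -> a <> GRing.zero ->
  exists l, lambda_is (F n) a l /\ F n l a.
Proof.
move=> n1 Ba a0; have [_ [dec [sep [exh lc]]]] := filtF n1.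
have [r0 nr0] : exists r, ~ F n r a.
  by apply: not_all_ex_not => h; apply: a0; exact: sep.
have [l hl] : {l | is_lub (fun r => F n r a) l}.
  apply: completeness; last exact: exh.
  exists r0 => r Fr; apply: Rnot_lt_le => lt; apply: nr0.
  by apply: (dec _ r) Fr; lra.
exists l; split=> //; apply/lc => s sl; apply: NNPP => ns.
have : Rle l s; last by lra.
apply: (proj2 hl) => r Fr; apply: Rnot_lt_le => lt; apply: ns.
by apply: (dec _ r) Fr; lra.
Qed.

(** The minimum is attained on a basis: the filtration step at the least index among basis vectors
    contains the basis, hence all of $B_n$. *)
Lemma min_lambda n : (1 <= n)%N ->
  exists m, is_min_lambda Bn F n m /\ forall x, Bn n x -> F n m x.
Proof.
move=> n1; have [d /has_dimE [sB [b [fb Bb spb]]]] := homogeneous_dim grB genB ftB n.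
have [x0 Bx0 x00] := power_pos_nonzero domB grB genB dimB n.
case: d b fb Bb spb => [|d] b fb Bb spb.
  have [c e] := spb _ Bx0; by rewrite e big_ord0 eqxx in x00.
have b0 i : b i <> GRing.zero by exact: findep_neq0.
have /fin_all_exists [l hl] := (fun i => filtration_lambda n1 (Bb i) (b0 i)).
have [i hi] := finite_minimum l.
have [subF [dec _]] := filtF n1.
have Fall x : Bn n x -> F n (l i) x.
  move=> /spb [c ->]; apply: subspace_sum; first by have [] := subF (l i).
  by move=> j; apply: (dec _ (l j)) => //; have [] := hl j.
exists (l i); split=> //; split; first by exists (b i); have [] := hl i.
by move=> a la Ba a0 [ub _]; apply: ub; exact: Fall.
Qed.

Hypothesis qfF : quasi_filtered f F.

Lemma prod_set_nseq k m s l x w :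
  F m s x -> prod_set F l w -> prod_set F (nseq k (m, s) ++ l) (GRing.mul (GRing.exp x k) w).
Proof.
move=> Fx hw; elim: k => [|k IH]; first by rewrite GRing.expr0 GRing.mul1r.
by rewrite GRing.exprS -GRing.mulrA /=; exact: prod_set_cons.
Qed.

(** The only instance of the quasi-filtration used below: [k] factors at one level in degree [m] and
    one more factor in degree [g]. *)
Lemma quasi_filtered_span : exists n1, (1 <= n1)%N /\ forall k m g s t,
  (n1 <= m)%N -> (n1 <= g)%N -> forall y,
  in_span (prod_set F (nseq k (m, s) ++ [:: (g, t)])) y ->
  F (k * m + g)%N (INR k * (s - f m) + (t - f g)) y.
Proof.
have [n0 hn0] := qfF; exists n0.+1; split=> // k m g s t n1m n1g y hy.
have := hn0 (nseq k (m, s) ++ [:: (g, t)]).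
have -> : sumn (map fst (nseq k (m, s) ++ [:: (g, t)])) = (k * m + g)%N.
  by elim: k {hy} => [|k IH] /=; rewrite ?addn0 // IH mulSn addnA.
have -> : foldr (fun p acc => Rplus (Rminus p.2 (f p.1)) acc) R0 (nseq k (m, s) ++ [:: (g, t)])
    = (INR k * (s - f m) + (t - f g)).
  elim: k {hy} => [|k IH]; first by rewrite /=; lra.
  by rewrite S_INR /= IH; lra.
apply=> //; first by rewrite size_cat addn1.
move=> i; rewrite size_cat size_nseq /= addn1 ltnS nth_cat size_nseq => ik.
case: ltnP => lt; first by rewrite nth_nseq lt /= ltnW.
have -> : (i - k = 0)%N by lia.
by rewrite /= ltnW.
Qed.

Variable u : nat -> R.
Hypothesis hu : forall n, (1 <= n)%N -> is_min_lambda Bn F n (u n) /\ forall x, Bn n x -> F n (u n) x.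

Lemma min_lambda_superadditive : exists n1, (1 <= n1)%N /\ forall k m g,
  (n1 <= m)%N -> (n1 <= g)%N ->
  (INR k * (u m - f m) + (u g - f g) <= u (k * m + g)%N).
Proof.
have [n1 [n10 hn1]] := quasi_filtered_span; exists n1; split=> // k m g n1m n1g.
have N1 : (1 <= k * m + g)%N by lia.
have [[[a [Ba [a0 [ub _]]]] _] _] := hu N1; apply: ub.
apply: hn1 => //; apply: (homogeneous_prod_span grB genB ftB).
  move=> i; rewrite size_cat size_nseq /= addn1 ltnS nth_cat size_nseq => ik x.
  case: ltnP => lt; first by rewrite nth_nseq lt /=; apply: (proj2 (hu _)); lia.
  have -> : (i - k = 0)%N by lia.
  by rewrite /=; apply: (proj2 (hu _)); lia.
have -> // : sumn (map fst (nseq k (m, u m) ++ [:: (g, u g)])) = (k * m + g)%N.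
by elim: (k) => [|k' IH] /=; rewrite ?addn0 // IH mulSn addnA.
Qed.

Lemma filtration_dim n r : (1 <= n)%N -> exists d, has_dim (F n r) d.
Proof.
move=> n1; have [subF _] := filtF n1; have [sF FB] := subF r.
have [d /has_dimE [sB [b [fb Bb spb]]]] := homogeneous_dim grB genB ftB n.
by apply: (has_dim_exists sF (w := b)) => x /FB /spb.
Qed.

Variables (D : nat -> R -> nat) (W : nat -> nat).
Hypothesis hD : forall n r, (1 <= n)%N -> has_dim (F n r) (D n r).
Hypothesis hW : forall n, has_dim (Bn n) (W n).

Lemma dim_mono n r s : (1 <= n)%N -> (r <= s) -> (D n s <= D n r)%N.
Proof.
move=> n1 rs; have [_ [dec _]] := filtF n1.
have /has_dimE [_ [b [fb Fb _]]] := hD s n1.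
rewrite -[D n s]card_ord; apply: (has_dim_ge (hD r n1) fb) => i.
exact: (dec _ s).
Qed.

Lemma dim_leW n r : (1 <= n)%N -> (D n r <= W n)%N.
Proof.
move=> n1; have [subF _] := filtF n1.
have /has_dimE [_ [b [fb Fb _]]] := hD r n1.
rewrite -[D n r]card_ord; apply: (has_dim_ge (hW n) fb) => i.
by have [_ h] := subF r; exact: h.
Qed.

Lemma dim_low n r : (1 <= n)%N -> (r <= u n) -> D n r = W n.
Proof.
move=> n1 ru; apply/eqP; rewrite eqn_leq dim_leW //=.
apply: (@leq_trans (D n (u n))); last exact: dim_mono.
have /has_dimE [_ [b [fb Bb _]]] := hW n.
rewrite -[W n]card_ord; apply: (has_dim_ge (hD (u n) n1) fb) => i.
exact: (proj2 (hu n1)).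
Qed.

Lemma dim_pos n : (0 < W n)%N.
Proof.
have [x0 Bx0 x00] := power_pos_nonzero domB grB genB dimB n.
have /has_dimE [_ [b [fb Bb spb]]] := hW n.
case: (W n) b fb Bb spb => // b _ _ /(_ _ Bx0) [c e].
by rewrite e big_ord0 eqxx in x00.
Qed.

Lemma dim_zero n r : (1 <= n)%N -> (forall a l, Bn n a -> a <> GRing.zero ->
  lambda_is (F n) a l -> l < r) -> D n r = 0%N.
Proof.
move=> n1 hr; have [subF _] := filtF n1.
have /has_dimE [_ [b [fb Fb spb]]] := hD r n1.
case: (D n r) b fb Fb spb => // d b fb Fb _; exfalso.
have b0 : b ord0 <> GRing.zero by exact: findep_neq0.
have Bb : Bn n (b ord0) by have [_ h] := subF r; exact: h.
have [l [hl _]] := filtration_lambda n1 Bb b0.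
have := hr _ _ Bb b0 hl; have := proj1 hl r (Fb ord0); lra.
Qed.

(** A decreasing family of finite-dimensional subspaces becomes constant, and separatedness makes
    the constant zero. This covers the finitely many degrees about which the limsup hypothesis says
    nothing. *)
Lemma dim_zero_exists n : (1 <= n)%N -> exists r, D n r = 0%N.
Proof.
move=> n1; have [subF [dec [sep _]]] := filtF n1.
have [r0 hmin] : exists r0, forall r, (D n r0 <= D n r)%N.
  apply: NNPP => h.
  have step k : forall r, (D n r <= k)%N -> False.
    elim: k => [|k IH] r le.
      by apply: h; exists r => r'; move: le; rewrite leqn0 => /eqP ->.
    have [r' lt] : exists r', ~ (D n r <= D n r')%N.
      by apply: not_all_ex_not => h'; apply: h; exists r.
    by apply: (IH r'); move/negP: lt; rewrite -ltnNge => lt; rewrite -ltnS; exact: leq_trans le.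
  exact: (step _ 0 (leqnn _)).
exists r0; apply/eqP; rewrite -leqn0 leqNgt; apply/negP => pos.
have /has_dimE [_ [b [fb Fb spb]]] := hD r0 n1.
have all r x : F n r0 x -> F n r x.
  move=> Fx; have [rr0|r0r] := Rle_dec r r0; first exact: (dec _ r0).
  have {}r0r : (r0 <= r) by lra.
  apply: NNPP => nFx.
  have /has_dimE [sF [c [fc Fc spc]]] := hD r n1.
  have nx : ~ fspan c x by move=> [k e]; apply: nFx; rewrite e; exact: subspace_sum.
  have := has_dim_ge (hD r0 n1) (findep_extend fc nx).
  rewrite card_ord ltnNge hmin /= => h; suff: false by []; apply: h => i.
  by case: (unlift ord_max i) => [j|] //=; apply: (dec _ r) => //; exact: Fc.
by apply: (@findep_neq0 _ _ _ _ (Ordinal pos) fb); apply: sep => r; exact: all.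
Qed.

(** The products of [dilation] have $k$ factors in $\mathcal F_sB_m$ and one in $B_g=\mathcal
    F_{u(g)}B_g$; quasi-filtration gives their level. *)
Lemma dim_dilation : exists n1 e q c : nat, [/\ (1 <= n1)%N, (0 < q)%N,
  (forall n, (W n <= c * n.+1 ^ e)%N) &
  forall a k' m g s, (n1 <= m)%N -> (n1 <= g)%N -> (e * (2 * (q * k').+1 * a.+1) <= g)%N ->
   ((q * k').+1 ^ e * D m s <= D ((q * k').+1 * m + g)
      (INR (q * k').+1 * (s - f m) + (u g - f g)) )%N].
Proof.
have [e [q [c [q0 hc hdil]]]] := dilation domB grB ftB genB dimB.
have [n1 [n10 hn1]] := quasi_filtered_span.
exists n1, e, q, c; split=> //.
  move=> n; have /has_dimE [_ [b [fb Bb _]]] := hW n.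
  by rewrite -[W n]card_ord; exact: hc fb Bb.
move=> a k' m g s n1m n1g leg.
have m1 : (1 <= m)%N by lia.
have [subF _] := filtF m1; have [sF FB] := subF s.
have /has_dimE [_ [b [fb Fb _]]] := hD s m1.
have [I [t [leI ft ht]]] := hdil m _ b fb (fun i => FB _ (Fb i)) a k' g leg.
apply: (leq_trans leI); apply: (has_dim_ge (hD _ _) ft); first by lia.
move=> i; apply: hn1 => //; apply: in_span_mem.
have [x [x' [w [[cx ->] [cx' ->] Bw ->]]]] := ht i.
rewrite -GRing.mulrA (_ : nseq _ _ ++ _ = nseq (q * k') (m, s) ++ (m, s) :: [:: (g, u g)]); last first.
  by elim: (q * k')%N => //= n ->.
apply: prod_set_nseq; first exact: subspace_sum.
apply: prod_set_cons; first exact: subspace_sum.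
rewrite -[w]GRing.mulr1; apply: prod_set_cons; first exact: (proj2 (hu (leq_trans n10 n1g))).
by exists [::]; split=> //; split=> //; rewrite big_ord0.
Qed.

End FilteredAlgebra.

(** * Real sequences *)

Section RealSequences.
Local Open Scope R_scope.

Lemma INR_addn m n : INR (m + n)%N = INR m + INR n. Proof. exact: plus_INR. Qed.
Lemma INR_muln m n : INR (m * n)%N = INR m * INR n. Proof. exact: mult_INR. Qed.
Lemma INR_expn m n : INR (m ^ n)%N = INR m ^ n.
Proof. by elim: n => [|n IH] //; rewrite expnS INR_muln IH. Qed.
Lemma INR_leq m n : (m <= n)%N -> INR m <= INR n.
Proof. by move=> /leP; exact: le_INR. Qed.
Lemma INR_gt0 n : (0 < n)%N -> 0 < INR n.
Proof. by move=> /ltP; exact: lt_0_INR. Qed.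

Lemma exists_INR_gt (x : R) : exists N, forall n, (N <= n)%N -> x < INR n.
Proof.
have [N hN] := INR_unbounded x; exists N => n /INR_leq; lra.
Qed.

Lemma Un_cv_bounded (v : nat -> R) l : Un_cv v l -> exists C, 0 < C /\ forall n, Rabs (v n) <= C.
Proof. by move=> h; have [C [C0 hC]] := maj_by_pos v (exist _ l h); exists C. Qed.

Lemma finite_bound (v : nat -> R) N : exists C, 0 <= C /\ forall n, (n < N)%N -> Rabs (v n) <= C.
Proof.
elim: N => [|N [C [C0 hC]]]; first by exists 0; split=> //; lra.
exists (C + Rabs (v N)); have := Rabs_pos (v N) => h; split; first by lra.
move=> n; rewrite ltnS leq_eqVlt => /orP[/eqP ->|/hC]; lra.
Qed.

(** * Fekete's lemma with error terms *)

Section Fekete.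
Variables (u f : nat -> R) (n1 N0 : nat) (C : R).
Hypotheses (f0 : forall n, 0 <= f n) (fcv : Un_cv (fun n => f n / INR n) 0).
Hypothesis n10 : (1 <= n1)%N.
Hypothesis super : forall k m g, (n1 <= m)%N -> (n1 <= g)%N ->
  INR k * (u m - f m) + (u g - f g) <= u (k * m + g)%N.
Hypothesis bounded : forall n, (N0 <= n)%N -> (1 <= n)%N -> u n / INR n <= C.

(** The limit is the supremum of $(u(m)-f(m))/m$ over $m\ge n_1$; the error $f(n)/n$ disappears in
    the upper estimate. *)
Lemma almost_superadditive_cv : exists L, Un_cv (fun n => u n / INR n) L.
Proof.
pose S x := exists m, (n1 <= m)%N /\ x = (u m - f m) / INR m.
have [C1 [C10 hC1]] := finite_bound (fun m => u m / INR m) N0.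
have [L [ubL lubL]] : {L | is_lub S L}.
  apply: completeness; last by exists ((u n1 - f n1) / INR n1), n1.
  exists (Rmax C C1) => _ [m [n1m ->]].
  have m0 : 0 < INR m by apply: INR_gt0; lia.
  apply: (@Rle_trans _ (u m / INR m)).
    by apply: Rmult_le_compat_r; [left; exact: Rinv_0_lt_compat|have := f0 m; lra].
  have [lt|ge] := ltnP m N0.
    by apply: (Rle_trans _ _ _ _ (Rmax_r _ _)); have := hC1 m lt; have := Rle_abs (u m / INR m); lra.
  by apply: (Rle_trans _ _ _ _ (Rmax_l _ _)); apply: bounded => //; lia.
exists L => eps eps0.
have [Nf hNf] := fcv eps0.
have upper n : (Nf <= n)%N -> (n1 <= n)%N -> u n / INR n < L + eps.
  move=> Nn n1n; have := hNf n (elimT leP Nn); rewrite /R_dist Rminus_0_r => /Rabs_def2 [h _].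
  have := ubL _ (ex_intro _ n (conj n1n erefl)); rewrite /Rdiv Rmult_minus_distr_r; rewrite /Rdiv in h; lra.
have [m [n1m hm]] : exists m, (n1 <= m)%N /\ L - eps / 2 < (u m - f m) / INR m.
  apply: NNPP => h; have : L <= L - eps / 2; last by lra.
  apply: lubL => _ [m [n1m ->]]; apply: Rnot_lt_le => lt; apply: h; by exists m.
have m0 : 0 < INR m by apply: INR_gt0; lia.
have [C2 [C20 hC2]] := finite_bound (fun g => u g - f g) (n1 + m).
set y := (u m - f m) / INR m in hm.
have ey : u m - f m = INR m * y by rewrite /y; field; lra.
have [N1 hN1] := exists_INR_gt ((C2 + INR (n1 + m)%N * Rabs y) * 2 / eps).
exists (N1 + Nf + n1).+1 => n /leP hn.
have n0 : 0 < INR n by apply: INR_gt0; lia.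
apply: Rabs_def1; first by have := upper n ltac:(lia) ltac:(lia); lra.
(* Dividing $n-n_1$ rather than $n$ by $m$ keeps the last block $g$ at least $n_1$, where [super]
   applies, and below $n_1+m$. *)
pose k := ((n - n1) %/ m)%N; pose g := (n1 + (n - n1) %% m)%N.
have en : n = (k * m + g)%N by rewrite /k /g addnCA -divn_eq; lia.
have lg : (g < n1 + m)%N by rewrite ltn_add2l ltn_pmod //; lia.
have ng : (n1 <= g)%N by exact: leq_addr.
have hs := super k n1m ng; rewrite -en ey in hs.
have hg := hC2 g lg.
have hg' : - C2 <= u g - f g by have := Rle_abs (- (u g - f g)); rewrite Rabs_Ropp; lra.
have ekm : INR k * INR m = INR n - INR g by rewrite [in RHS]en INR_addn INR_muln; lra.
have hn1 : (C2 + INR (n1 + m)%N * Rabs y) * 2 / eps < INR n by apply: hN1; lia.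
have hn1' : (C2 + INR (n1 + m)%N * Rabs y) < INR n * (eps / 2).
  have -> : C2 + INR (n1 + m)%N * Rabs y = (C2 + INR (n1 + m)%N * Rabs y) * 2 / eps * (eps / 2) by field; lra.
  by apply: Rmult_lt_compat_r; lra.
have gy : INR g * y <= INR (n1 + m)%N * Rabs y.
  apply: (@Rle_trans _ (INR g * Rabs y)).
    by apply: Rmult_le_compat_l; [exact: pos_INR|exact: Rle_abs].
  by apply: Rmult_le_compat_r; [exact: Rabs_pos|exact: INR_leq (ltnW lg)].
have hu : INR n * (L - eps) < u n.
  have : INR k * (INR m * y) = INR n * y - INR g * y by rewrite -Rmult_assoc ekm; ring.
  have : INR n * (L - eps / 2) < INR n * y by apply: Rmult_lt_compat_l.
  lra.
have : L - eps < u n / INR n; last by lra.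
by apply: (Rmult_lt_reg_l (INR n)) => //; have -> : INR n * (u n / INR n) = u n by field; lra.
Qed.

End Fekete.

(** Up to [eta], each late term is a lower bound of all much later ones, so the upper limit does not
    exceed the lower limit. *)
Lemma cv_of_late_lower_bound (w : nat -> R) (C : R) :
  (forall n, (1 <= n)%N -> 0 <= w n <= C) ->
  (forall eta, 0 < eta -> exists M, forall m, (M <= m)%N -> exists N, forall n, (N <= n)%N -> w m - eta <= w n) ->
  exists l, Un_cv w l /\ forall x, (exists N, forall n, (N <= n)%N -> x <= w n) -> x <= l.
Proof.
move=> wb wl; pose A x := exists N, forall n, (N <= n)%N -> x <= w n.
have [l [ub lub]] : {l | is_lub A l}.
  apply: completeness; last by exists 0, 1%N => n /wb; lra.
  exists C => x [N hN]; have := hN N.+1 (leqnSn _); have := wb N.+1 isT; lra.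
exists l; split=> // eps eps0.
have [M hM] := wl (eps / 2) ltac:(lra).
have [x [[N hN] hx]] : exists x, A x /\ l - eps < x.
  apply: NNPP => h; have : l <= l - eps; last by lra.
  by apply: lub => x Ax; apply: Rnot_lt_le => lt; apply: h; exists x.
exists (M + N)%N => n /leP hn; apply: Rabs_def1.
  have : w n - eps / 2 <= l; last by lra.
  by apply: ub; apply: hM; lia.
have := hN n; have h : (N <= n)%N by lia.
move=> /(_ h); lra.
Qed.

Lemma bernoulli x e : 0 <= x <= 1 -> 1 - INR e * x <= (1 - x) ^ e.
Proof.
move=> hx; elim: e => [|e IH]; first by rewrite /=; lra.
rewrite S_INR /=; have h : 0 <= INR e by exact: pos_INR.
have h2 : (1 - x) * (1 - INR e * x) <= (1 - x) * (1 - x) ^ e by apply: Rmult_le_compat_l; lra.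
nra.
Qed.

(** * Asymptotic form of the dilation inequality *)

Section Asymptotics.
Variables (D : nat -> R -> nat) (W : nat -> nat) (u f : nat -> R) (n1 e q c : nat) (C : R).
Hypothesis (fcv : Un_cv (fun n => f n / INR n) 0).
Hypotheses (n10 : (1 <= n1)%N) (q0 : (0 < q)%N) (C0 : 0 <= C).
Hypothesis Dmono : forall n r s, (1 <= n)%N -> r <= s -> (D n s <= D n r)%N.
Hypothesis DW : forall n r, (1 <= n)%N -> (D n r <= W n)%N.
Hypothesis W0 : forall n, (0 < W n)%N.
Hypothesis Wc : forall n, (W n <= c * n.+1 ^ e)%N.
Hypothesis dil : forall a k' m g s, (n1 <= m)%N -> (n1 <= g)%N ->
  (e * (2 * (q * k').+1 * a.+1) <= g)%N ->
  ((q * k').+1 ^ e * D m s <= D ((q * k').+1 * m + g)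
     (INR (q * k').+1 * (s - f m) + (u g - f g)))%N.
Hypothesis ulow : forall g, (1 <= g)%N -> - C * INR g <= u g - f g.

Lemma dilation_asymptotic t eps xi : 0 < eps -> 0 < xi < 1 ->
  exists M, forall m, (M <= m)%N -> exists N, forall n, (N <= n)%N ->
  (1 - xi) ^ e * (INR (D m (INR m * t)) / INR m ^ e) <= INR (D n (INR n * (t - eps))) / INR n ^ e.
Proof.
move=> eps0 [xi0 xi1].
pose A := Rabs t + C.
have A0 : 0 <= A by rewrite /A; have := Rabs_pos t; lra.
(* [x] will bound the share $g/n$: $x\le\xi$ controls the loss of dimension, and
   $x(|t|+C)\le\varepsilon/2$ the loss of level caused by $B_g$. The other half of $\varepsilon$
   pays for $kf(m)$. *)
have [x [x0 [xxi xA]]] : exists x, 0 < x /\ x <= xi /\ x * A <= eps / 2.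
  exists (Rmin xi (eps / (2 * (A + 1)))).
  have h : 0 < eps / (2 * (A + 1)) by apply: Rdiv_lt_0_compat; lra.
  split; first exact: Rmin_pos.
  split; first exact: Rmin_l.
  apply: (@Rle_trans _ (eps / (2 * (A + 1)) * (A + 1))); last by right; field; lra.
  apply: Rmult_le_compat; [by left; exact: Rmin_pos|exact: A0|exact: Rmin_r|lra].
have [p hp] := exists_INR_gt (4 * INR e / x).
have [Nf hNf] := fcv (ltac:(lra) : eps / 2 > 0).
exists (n1 + p.+1 + Nf)%N => m hm.
have m0 : 0 < INR m by apply: INR_gt0; lia.
have pp : 0 < INR p.+1 by exact: INR_gt0.
have hep : 2 * INR e / INR p.+1 <= x / 2.
  have := hp p.+1 (leqnSn p) => h.
  apply: (Rmult_le_reg_r (INR p.+1)) => //.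
  have -> : 2 * INR e / INR p.+1 * INR p.+1 = 2 * INR e by field; lra.
  have : 4 * INR e / x * x <= INR p.+1 * x by apply: Rmult_le_compat_r; lra.
  have -> : 4 * INR e / x * x = 4 * INR e by field; lra.
  lra.
(* Since $a+1=\lfloor m/(p+1)\rfloor$ and $2e/(p+1)\le x/2$, the monomials need at most $xm/2$
   degrees per unit of $k$. *)
pose a := (m %/ p.+1).-1.
have a1 : a.+1 = (m %/ p.+1)%N by rewrite /a prednK // divn_gt0; lia.
have ha : INR a.+1 * INR p.+1 <= INR m by rewrite a1 -INR_muln; apply: INR_leq; exact: leq_trunc_div.
have fm : f m <= eps / 2 * INR m.
  have := hNf m ltac:(lia); rewrite /R_dist Rminus_0_r => /Rabs_def2 [h _].
  have -> : f m = f m / INR m * INR m by field; lra.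
  by apply: Rmult_le_compat_r; lra.
(* Each unit of $k$ consumes $m$ degrees for the power and $2e(a+1)$ for the monomials. *)
pose h := (m + 2 * e * a.+1)%N.
have h0 : (0 < h)%N by rewrite /h; lia.
have [N hN] := exists_INR_gt (INR (n1 + q * h)%N * 2 / x).
exists (N + n1 + h).+1 => n hn.
have n0 : 0 < INR n by apply: INR_gt0; lia.
(* The largest $k\equiv1$ modulo $q$ with $kh\le n-n_1$; at least $n_1$ degrees are left for $g$,
   and fewer than $qh+n_1$ remain beyond $kh$. *)
pose k' := (((n - n1) %/ h).-1 %/ q)%N.
pose k := (q * k').+1.
have d1 : (0 < (n - n1) %/ h)%N by rewrite divn_gt0 //; lia.
have kle : (k <= (n - n1) %/ h)%N.
  by rewrite /k -[X in (_ <= X)%N](prednK d1) ltnS mulnC; exact: leq_trunc_div.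
have kh : (k * h + n1 <= n)%N.
  have := leq_trunc_div (n - n1) h; have : (k * h <= (n - n1) %/ h * h)%N by rewrite leq_mul2r kle orbT.
  by move: (k * h)%N ((n - n1) %/ h * h)%N => x1 x2; lia.
have kgt : (n < (k + q) * h + n1)%N.
  have h1 : ((n - n1) %/ h < k + q)%N.
    have := ltn_ceil ((n - n1) %/ h).-1 q0; rewrite -/k' mulSn mulnC /k.
    by move: (q * k')%N ((n - n1) %/ h)%N d1 => x1 x2; lia.
  have h2 : (n - n1 < ((n - n1) %/ h).+1 * h)%N by exact: ltn_ceil.
  have h3 : (((n - n1) %/ h).+1 * h <= (k + q) * h)%N by rewrite leq_mul2r h1 orbT.
  by move: ((k + q) * h)%N (((n - n1) %/ h).+1 * h)%N h2 h3 => x1 x2; lia.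
have km_n : (k * m + 2 * e * a.+1 * k + n1 <= n)%N.
  by move: kh; rewrite /h mulnDr [(k * (2 * e * a.+1))%N]mulnC.
pose g := (n - k * m)%N.
have en : (k * m + g)%N = n.
  by rewrite /g subnKC //; move: (k * m)%N (2 * e * a.+1 * k)%N km_n => x1 x2; lia.
have hg1 : (n1 <= g)%N by move: (k * m)%N (2 * e * a.+1 * k)%N km_n en => x1 x2; lia.
have hg2 : (e * (2 * k * a.+1) <= g)%N.
  have -> : (e * (2 * k * a.+1) = 2 * e * a.+1 * k)%N by lia.
  by move: (k * m)%N (2 * e * a.+1 * k)%N km_n en => x1 x2; lia.
have hd := dil (INR m * t) (ltac:(lia) : (n1 <= m)%N) hg1 hg2; rewrite -/k en in hd.
have eg : INR g = INR n - INR k * INR m by rewrite -en INR_addn INR_muln; lra.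
have gx : INR g <= x * INR n.
  have i1 : INR n <= INR k * INR m + INR k * (2 * INR e * INR a.+1) + INR (n1 + q * h)%N.
    have := INR_leq (ltnW kgt); rewrite !(INR_addn, INR_muln).
    have -> : INR 2 = 2 by [].
    lra.
  have i2 : INR (n1 + q * h)%N <= x / 2 * INR n.
    have h1 : INR (n1 + q * h)%N * 2 / x <= INR n by left; apply: hN; lia.
    have -> : INR (n1 + q * h)%N = x / 2 * (INR (n1 + q * h)%N * 2 / x) by field; lra.
    by apply: Rmult_le_compat_l; lra.
  have i3 : INR k * (2 * INR e * INR a.+1) <= x / 2 * INR n.
    have kmn : INR k * INR m <= INR n by have := pos_INR g; lra.
    have i4 : 2 * INR e * INR a.+1 <= x / 2 * INR m.
      apply: (@Rle_trans _ (2 * INR e / INR p.+1 * INR m)); last by apply: Rmult_le_compat_r; lra.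
      have -> : 2 * INR e * INR a.+1 = 2 * INR e / INR p.+1 * (INR a.+1 * INR p.+1) by field; lra.
      apply: Rmult_le_compat_l ha; apply: Rmult_le_pos; first by have := pos_INR e; lra.
      by left; exact: Rinv_0_lt_compat.
    apply: (@Rle_trans _ (INR k * (x / 2 * INR m))).
      by apply: Rmult_le_compat_l i4; exact: pos_INR.
    have -> : INR k * (x / 2 * INR m) = x / 2 * (INR k * INR m) by ring.
    by apply: Rmult_le_compat_l; lra.
  lra.
have lev : INR n * (t - eps) <= INR k * (INR m * t - f m) + (u g - f g).
  have ug := ulow (ltac:(lia) : (1 <= g)%N).
  have kf : INR k * f m <= eps / 2 * INR n.
    apply: (@Rle_trans _ (INR k * (eps / 2 * INR m))).
      by apply: Rmult_le_compat_l fm; exact: pos_INR.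
    have -> : INR k * (eps / 2 * INR m) = eps / 2 * (INR k * INR m) by ring.
    by apply: Rmult_le_compat_l; [lra|have := pos_INR g; lra].
  have gA : INR g * A <= eps / 2 * INR n.
    apply: (@Rle_trans _ (x * INR n * A)); first by apply: Rmult_le_compat_r.
    have -> : x * INR n * A = x * A * INR n by ring.
    by apply: Rmult_le_compat_r; lra.
  have gt : INR g * t <= INR g * Rabs t by apply: Rmult_le_compat_l; [exact: pos_INR|exact: Rle_abs].
  have -> : INR n * (t - eps) = INR k * INR m * t + INR g * t - eps * INR n by rewrite eg; ring.
  rewrite /A in gA; lra.
have nn : (1 <= n)%N by lia.
have hd2 := leq_trans hd (Dmono nn lev).
have hd3 : INR k ^ e * INR (D m (INR m * t)) <= INR (D n (INR n * (t - eps))).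
  by rewrite -INR_expn -INR_muln; exact: INR_leq.
have ne : 0 < INR n ^ e by exact: pow_lt.
have me : 0 < INR m ^ e by exact: pow_lt.
apply: (@Rle_trans _ (INR k ^ e * INR (D m (INR m * t)) / INR n ^ e)); last first.
  by apply: Rmult_le_compat_r hd3; left; exact: Rinv_0_lt_compat.
have -> : INR k ^ e * INR (D m (INR m * t)) / INR n ^ e
    = (INR k * INR m / INR n) ^ e * (INR (D m (INR m * t)) / INR m ^ e).
  by rewrite /Rdiv !Rpow_mult_distr pow_inv; field; split; apply: Rgt_not_eq.
apply: Rmult_le_compat_r.
  by apply: Rmult_le_pos; [exact: pos_INR|left; exact: Rinv_0_lt_compat].
apply: pow_incr; split; first by lra.
have : INR k * INR m / INR n = 1 - INR g / INR n by rewrite eg; field; lra.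
move=> ->; have : INR g / INR n <= x; last by lra.
by apply: (Rmult_le_reg_r (INR n)) => //; have -> : INR g / INR n * INR n = INR g by field; lra.
Qed.

Variable tlow : R.
Hypothesis low : forall n t, (1 <= n)%N -> t <= tlow -> D n (INR n * t) = W n.

Let w n := INR (W n) / INR n ^ e.

Lemma w_bound n : (1 <= n)%N -> 0 < w n <= INR c * 2 ^ e.
Proof.
move=> n1'; have n0 : 0 < INR n by exact: INR_gt0.
have ne : 0 < INR n ^ e by exact: pow_lt.
split; first by apply: Rdiv_lt_0_compat => //; exact: INR_gt0.
apply: (Rmult_le_reg_r (INR n ^ e)) => //.
have -> : w n * INR n ^ e = INR (W n) by rewrite /w; field; lra.
have := INR_leq (Wc n); rewrite INR_muln INR_expn => h; apply: (Rle_trans _ _ _ h).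
rewrite Rmult_assoc -Rpow_mult_distr; apply: Rmult_le_compat_l; first exact: pos_INR.
apply: pow_incr; split; first exact: pos_INR.
by have := INR_leq n1'; rewrite (S_INR n) /=; lra.
Qed.

(** At a level below all minima the filtration step is the whole of $B_n$, so the inequality for
    tails becomes one for $\dim B_n$ itself. *)
Lemma w_late xi : 0 < xi < 1 -> exists M, forall m, (M <= m)%N -> exists N, forall n, (N <= n)%N ->
  (1 - xi) ^ e * w m <= w n.
Proof.
move=> hxi; have [M hM] := @dilation_asymptotic tlow 1 xi ltac:(lra) hxi.
exists M.+1 => m Mm; have [N hN] := hM m (ltnW Mm); exists N.+1 => n Nn.
have := hN n (ltnW Nn).
rewrite (low (leq_ltn_trans (leq0n M) Mm) (Rle_refl tlow)).
by rewrite (low (t := tlow - 1) (leq_ltn_trans (leq0n N) Nn)) //; lra.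
Qed.

(** Gives $\dim B_n\sim ln^e$ with $l>0$. By Bernoulli's inequality [w_late] takes the additive form
    of [cv_of_late_lower_bound]; positivity comes from [w_late] with $\xi=1/2$. *)
Lemma w_cv : exists l, 0 < l /\ Un_cv w l.
Proof.
have Cw0 : 0 <= INR c * 2 ^ e by have := w_bound (leqnn 1); lra.
have [l [cv lb]] : exists l, Un_cv w l /\ forall x, (exists N, forall n, (N <= n)%N -> x <= w n) -> x <= l.
  apply: (@cv_of_late_lower_bound w (INR c * 2 ^ e)); first by move=> n /w_bound; lra.
  move=> eta eta0; pose xi := Rmin (1 / 2) (eta / (INR e * (INR c * 2 ^ e) + 1)).
  have den : 0 < INR e * (INR c * 2 ^ e) + 1.
    have : 0 <= INR e * (INR c * 2 ^ e) by apply: Rmult_le_pos => //; exact: pos_INR.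
    lra.
  have xi0 : 0 < xi by apply: Rmin_pos; [lra|exact: Rdiv_lt_0_compat].
  have xi1 : xi <= 1 / 2 by exact: Rmin_l.
  have [M hM] := @w_late xi ltac:(lra); exists M.+1 => m Mm.
  have [N hN] := hM m (ltnW Mm); exists N => n /hN h.
  have [wm0 wmC] := w_bound (leq_ltn_trans (leq0n M) Mm).
  have := @bernoulli xi e ltac:(lra) => hb.
  have h2 : (1 - INR e * xi) * w m <= (1 - xi) ^ e * w m by apply: Rmult_le_compat_r; lra.
  have h3 : INR e * xi * w m <= eta.
    apply: (@Rle_trans _ (INR e * (eta / (INR e * (INR c * 2 ^ e) + 1)) * (INR c * 2 ^ e))).
      apply: Rmult_le_compat; [|lra| |exact: wmC].
        by apply: Rmult_le_pos; [exact: pos_INR|lra].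
      by apply: Rmult_le_compat_l; [exact: pos_INR|exact: Rmin_r].
    have -> : INR e * (eta / (INR e * (INR c * 2 ^ e) + 1)) * (INR c * 2 ^ e)
        = eta * ((INR e * (INR c * 2 ^ e)) / (INR e * (INR c * 2 ^ e) + 1)) by field; lra.
    rewrite -{2}[eta]Rmult_1_r; apply: Rmult_le_compat_l; first by lra.
    apply: (Rmult_le_reg_r (INR e * (INR c * 2 ^ e) + 1)) => //.
    rewrite /Rdiv Rmult_assoc Rinv_l; lra.
  lra.
exists l; split=> //.
have [M hM] := @w_late (1 / 2) ltac:(lra); have [N hN] := hM M.+1 (leqnSn M).
apply: (@Rlt_le_trans _ ((1 - 1 / 2) ^ e * w M.+1)).
  by apply: Rmult_lt_0_compat; [apply: pow_lt; lra|have := @w_bound M.+1 isT; lra].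
by apply: lb; exists N.
Qed.

Theorem normalized_late t eps eta : 0 < eps -> 0 < eta ->
  exists M, forall m, (M <= m)%N -> exists N, forall n, (N <= n)%N ->
  INR (D m (INR m * t)) / INR (W m) - eta <= INR (D n (INR n * (t - eps))) / INR (W n).
Proof.
move=> eps0 eta0; have [l [l0 cv]] := w_cv.
pose xi := Rmin (1 / 2) (eta / (2 * (INR e + 1))).
have e0 : 0 <= INR e by exact: pos_INR.
have xi0 : 0 < xi by apply: Rmin_pos; [lra|apply: Rdiv_lt_0_compat; lra].
have xi1 : xi <= 1 / 2 by exact: Rmin_l.
have exi : INR e * xi <= eta / 2.
  apply: (@Rle_trans _ ((INR e + 1) * (eta / (2 * (INR e + 1))))); last by right; field; lra.
  by apply: Rmult_le_compat; [lra|lra|lra|exact: Rmin_r].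
(* With [w m] and [w n] within $d$ of $l$, the losses $2d+\frac{\eta}{2}(l+d)$ remain below
   $\eta(l-d)$. *)
pose d := Rmin (l / 12) (eta * l / 8).
have d0 : 0 < d by apply: Rmin_pos; [lra|apply: Rdiv_lt_0_compat; [exact: Rmult_lt_0_compat|lra]].
have [Nw hNw] := cv d d0.
have hw n : (Nw <= n)%N -> l - d < w n < l + d.
  by move=> /leP Nn; have := hNw n Nn; rewrite /R_dist => /Rabs_def2; lra.
have d1 : d <= l / 12 by exact: Rmin_l.
have d2 : d <= eta * l / 8 by exact: Rmin_r.
have [M hM] := @dilation_asymptotic t eps xi eps0 ltac:(lra).
exists (M + Nw).+1 => m hm; have [N hN] := hM m ltac:(lia); exists (N + Nw).+1 => n hn.
have h := hN n ltac:(lia).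
have := hw m ltac:(lia) => wm; have := hw n ltac:(lia) => wn.
have m1 : (1 <= m)%N by lia.
have n1' : (1 <= n)%N by lia.
have ne : 0 < INR n ^ e by apply: pow_lt; exact: INR_gt0.
have me : 0 < INR m ^ e by apply: pow_lt; exact: INR_gt0.
have Wm : 0 < INR (W m) by exact: INR_gt0.
have Wn : 0 < INR (W n) by exact: INR_gt0.
set X := INR (D m _) in h *; set Y := INR (D n _) in h *.
pose G := X / INR (W m).
have G01 : 0 <= G <= 1.
  split; first by apply: Rmult_le_pos; [exact: pos_INR|left; exact: Rinv_0_lt_compat].
  apply: (Rmult_le_reg_r (INR (W m))) => //.
  have -> : G * INR (W m) = X by rewrite /G; field; lra.
  by rewrite Rmult_1_l; apply: INR_leq; exact: DW.
have eX : X / INR m ^ e = G * w m by rewrite /G /w; field; lra.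
have eY : Y / INR (W n) = (Y / INR n ^ e) / w n by rewrite /w; field; lra.
rewrite eX in h; rewrite eY -/G.
have wn0 : 0 < w n by lra.
apply: (Rmult_le_reg_r (w n)) => //.
have -> : Y / INR n ^ e / w n * w n = Y / INR n ^ e by field; lra.
apply: Rle_trans h.
have := @bernoulli xi e ltac:(lra) => hb.
have h2 : (1 - INR e * xi) * (G * w m) <= (1 - xi) ^ e * (G * w m).
  by apply: Rmult_le_compat_r => //; apply: Rmult_le_pos; lra.
apply: Rle_trans h2.
have h3 : (1 - eta / 2) * (G * w m) <= (1 - INR e * xi) * (G * w m).
  by apply: Rmult_le_compat_r; [apply: Rmult_le_pos; lra|lra].
apply: Rle_trans h3.
have h4 : G * (w n - w m) <= 2 * d.
  have := Rle_dec (w n) (w m); case=> cmp.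
    by have : G * (w n - w m) <= 0; [nra|lra].
  have : G * (w n - w m) <= 1 * (w n - w m) by apply: Rmult_le_compat_r; lra.
  lra.
have h5 : eta / 2 * (G * w m) <= eta / 2 * w m.
  apply: Rmult_le_compat_l; first by lra.
  have : G * w m <= 1 * w m by apply: Rmult_le_compat_r; lra.
  lra.
nra.
Qed.

End Asymptotics.

End RealSequences.

(** * The limit measure *)

Section QuantileMeasure.
Import all_classical all_reals all_analysis Rstruct Rstruct_topology.
Import Order.TTheory GRing.Theory Num.Theory numFieldTopology.Exports numFieldNormedType.Exports.
Local Open Scope classical_set_scope.
Local Open Scope ring_scope.
Variable Q : R -> R.
Hypothesis Qmono : forall u v : R, 0 < u -> u <= v -> v < 1 -> Q v <= Q u.

Let pre (A : R -> Prop) : set (measurableTypeR R) := [set u | 0 < u < 1 /\ A (Q u)].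

Let pre_measurable (A : R -> Prop) : borel A -> measurable (pre A).
Proof.
elim=> {A} [a b|A _ IH|A _ IH|A A' e _ IH].
- apply: measurable_realfun.is_interval_measurable => x y [/andP[x0 x1] [ax xb]] [/andP[y0 y1] [ay yb]] z /andP[xz zy].
  have z0 : 0 < z by exact: lt_le_trans x0 xz.
  have z1 : z < 1 by exact: le_lt_trans zy y1.
  split; first by rewrite z0 z1.
  split.
    by apply: (Rlt_le_trans _ (Q y)) => //; apply/RleP; exact: Qmono.
  by apply: (Rle_lt_trans _ (Q x)) => //; apply/RleP; exact: Qmono.
- have -> : pre (fun x => ~ A x) = `]0, 1[%classic `\` pre A.
    apply/seteqP; split=> u /=; rewrite in_itv /=.
      by move=> [u01 nA]; split=> // -[].
    by move=> [u01 nA]; split=> // hA; apply: nA.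
  by apply: measurableD.
- have -> : pre (fun x => exists k, A k x) = \bigcup_k pre (A k).
    apply/seteqP; split=> u /=; first by move=> [u01 [k Ak]]; exists k.
    by move=> [k _ [u01 Ak]]; split=> //; exists k.
  by apply: bigcup_measurable.
- have -> // : pre A' = pre A.
  by apply/seteqP; split=> u [u01 h]; split=> //; apply/e.
Qed.

Let pre01 (A : R -> Prop) : pre A `<=` `]0%R, 1%R[%classic.
Proof. by move=> u [u01 _] /=; rewrite in_itv. Qed.

Let leb01 : @lebesgue_measure R `]0%R, 1%R[%classic = 1%E.
Proof. by rewrite lebesgue_measure_itv /= lte_fin ltr01 oppr0 adde0. Qed.

Let pre_fin (A : R -> Prop) : borel A -> lebesgue_measure (pre A) \is a fin_num.
Proof.
move=> bA; rewrite ge0_fin_numE //; apply: (@le_lt_trans _ _ 1%E); last exact: ltry.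
rewrite -leb01; apply: le_measure; rewrite ?inE //; first [exact: pre_measurable|exact: pre01].
Qed.

(** [mu A] is the Lebesgue measure of the $u\in{]0,1[}$ with $Q(u)\in A$. The bounds hold because
    the preimage of $[t,+\infty[$ contains $]0,p[$, respectively lies in $]0,p]$. *)
Lemma quantile_measure : exists mu : (R -> Prop) -> R, prob_measure mu /\
  forall t p : R, borel (fun x => Rle t x) ->
    (0 <= p <= 1 -> (forall u, 0 < u -> u < p -> Rle t (Q u)) -> Rle p (mu (fun x => Rle t x))) /\
    (0 <= p -> (forall u, 0 < u -> u < 1 -> Rle t (Q u) -> u <= p) -> Rle (mu (fun x => Rle t x)) p).
Proof.
pose mu A : R := fine (lebesgue_measure (pre A)).
have muE A : borel A -> (mu A)%:E = lebesgue_measure (pre A).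
  by move=> bA; rewrite fineK // pre_fin.
have mono (A : R -> Prop) (p : R) : borel A -> `]0%R, p[%classic `<=` pre A -> (0 <= p)%R -> p <= mu A.
  move=> bA sub p0; rewrite -lee_fin muE //.
  have -> : p%:E = @lebesgue_measure R `]0%R, p[%classic.
    rewrite lebesgue_measure_itv /= lte_fin oppr0 adde0.
    by case: ltP => // p0'; congr EFin; apply/eqP; rewrite eq_le p0 p0'.
  by apply: le_measure; rewrite ?inE //; exact: pre_measurable.
exists mu; split.
  split; [|split].
  - by move=> A bA; apply/RleP; rewrite fine_ge0.
  - have -> : (1 : R) = fine (1%E : \bar R) by [].
    congr fine; rewrite -leb01; congr lebesgue_measure; apply/seteqP; split=> u /=; rewrite in_itv //=.
    by case.
  - move=> A bA dA.
    have bU : borel (fun x => exists k, A k x) by exact: borel_cunion.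
    have tr : trivIset setT (fun k => pre (A k)).
      apply/trivIsetP => i j _ _ ij; apply/eqP/negPn/negP => /set0P [u [[_ hi] [_ hj]]].
      by apply: (dA i j (Q u)) => //; exact/eqP.
    have eU : \bigcup_k pre (A k) = pre (fun x => exists k, A k x).
      apply/seteqP; split=> u /=; last by move=> [u01 [k Ak]]; exists k.
      by move=> [k _ [u01 Ak]]; split=> //; exists k.
    have : (fun n => (\sum_(0 <= i < n) lebesgue_measure (pre (A i)))%E) @ \oo --> (mu (fun x => exists k, A k x))%:E.
      rewrite muE // -eU; apply: measure_semi_sigma_additive => //.
        by move=> k; exact: pre_measurable.
      by rewrite eU; exact: pre_measurable.
    move=> /fine_cvg.
    move=> /cvgrPdist_lt cv eps eps0.
    have [N _ hN] := cv eps (introT RltP eps0).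
    exists N => n /ssrnat.leP Nn; apply/RltP; rewrite RdistE distrC sum_f_R0E.
    have := hN n.+1 (leq_trans Nn (leqnSn n)) => /=.
    rewrite -sum_fine // => i _; exact: pre_fin.
move=> t p bt; split.
  move=> /andP[p0 p1] h; apply/RleP; apply: mono => // u /=; rewrite in_itv /= => /andP[u0 up].
  by split; [rewrite u0 (lt_le_trans up p1)|exact: h].
move=> p0 h; apply/RleP; rewrite -lee_fin muE //.
apply: (@le_trans _ _ (@lebesgue_measure R `]0%R, p]%classic)).
  apply: le_measure; rewrite ?inE //; first exact: pre_measurable.
  by move=> u [/andP[u0 u1] hu] /=; rewrite in_itv /= u0 /=; exact: h.
rewrite lebesgue_measure_itv /= lte_fin oppr0 adde0.
by case: ltP.
Qed.

End QuantileMeasure.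

Section PushforwardQuantile.
Import Rstruct.

(** The same statement in terms of the order [Rle], [Rlt] used in the rest of the proof. *)
Lemma pushforward_quantile (Q : R -> R) :
  (forall u v, Rlt 0 u -> Rle u v -> Rlt v 1 -> Rle (Q v) (Q u)) ->
  exists mu, prob_measure mu /\ forall t p, borel (fun x => Rle t x) ->
    (Rle 0 p -> Rle p 1 -> (forall u, Rlt 0 u -> Rlt u p -> Rle t (Q u)) -> Rle p (mu (fun x => Rle t x))) /\
    (Rle 0 p -> (forall u, Rlt 0 u -> Rlt u 1 -> Rle t (Q u) -> Rle u p) -> Rle (mu (fun x => Rle t x)) p).
Proof.
move=> Qm; have [|mu [pm h]] := @quantile_measure Q.
  by move=> u v /RltP u0 /RleP uv /RltP v1; apply/RleP; exact: Qm.
exists mu; split=> // t p bt; have [h1 h2] := h t p bt; split.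
  move=> /RleP p0 /RleP p1 hu; apply: h1; first by apply/andP.
  by move=> u /RltP u0 /RltP up; exact: hu.
move=> /RleP p0 hu; apply: h2 => //.
by move=> u /RltP u0 /RltP u1 tu; apply/RleP; exact: hu.
Qed.

End PushforwardQuantile.

(** * Integrals and vague convergence *)

Section VagueConvergence.
Local Open Scope R_scope.

Lemma Rabs_le_inv x y : Rabs x <= y -> - y <= x <= y.
Proof. by rewrite /Rabs; case: Rcase_abs; lra. Qed.

Lemma pred_ext (T : Type) (mu : (R -> Prop) -> T) (A A' : R -> Prop) :
  (forall x, A x <-> A' x) -> mu A = mu A'.
Proof. by move=> h; congr mu; apply: boolp.funext => x; apply: boolp.propext. Qed.

Lemma borel_union A A' : borel A -> borel A' -> borel (fun x => A x \/ A' x).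
Proof.
move=> bA bA'; apply: (@borel_ext (fun x => exists k, (if k is 0%N then A else A') x)).
  move=> x; split=> [[[|k]]|[h|h]]; [by left|by right|by exists 0%N|by exists 1%N].
by apply: borel_cunion => -[|k].
Qed.

Lemma borel_inter A A' : borel A -> borel A' -> borel (fun x => A x /\ A' x).
Proof.
move=> bA bA'; apply: (@borel_ext (fun x => ~ (~ A x \/ ~ A' x))); first by move=> x; tauto.
by apply: borel_compl; apply: borel_union; exact: borel_compl.
Qed.

Lemma borel_true : borel (fun _ => True).
Proof.
apply: (@borel_ext (fun x => 0 < x < 1 \/ ~ (0 < x < 1))); first by move=> x; tauto.
by apply: borel_union; [|apply: borel_compl]; exact: borel_open.
Qed.

Lemma borel_false : borel (fun _ => False).
Proof. by apply: (borel_ext _ (borel_compl borel_true)); tauto. Qed.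

Lemma borel_lt a : borel (fun x => x < a).
Proof.
apply: (@borel_ext (fun x => exists k, a - INR k < x < a)); last first.
  by apply: borel_cunion => k; exact: borel_open.
move=> x; split=> [[k]|xa]; first by lra.
by have [k hk] := INR_unbounded (a - x); exists k; lra.
Qed.

Lemma borel_ge a : borel (fun x => a <= x).
Proof. by apply: (borel_ext _ (borel_compl (borel_lt a))) => x; lra. Qed.

Lemma borel_co a b : borel (fun x => a <= x < b).
Proof. by apply: borel_inter; [exact: borel_ge|exact: borel_lt]. Qed.

Fixpoint rsum (G : nat -> R) N : R := if N is n.+1 then rsum G n + G n else 0.

Lemma rsum_le G H N : (forall i, (i < N)%N -> G i <= H i) -> rsum G N <= rsum H N.
Proof.
elim: N => [|N IH] h /=; first by lra.
have := h N (ltnSn N); have := IH (fun i lt => h i (ltnW lt)); lra.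
Qed.

Lemma rsum_lin G H c N : rsum (fun i => G i + c * H i) N = rsum G N + c * rsum H N.
Proof. by elim: N => [|N IH] /=; rewrite ?IH; ring. Qed.

Lemma rsum_const c N : rsum (fun=> c) N = INR N * c.
Proof. by elim: N => [|N IH]; rewrite ?S_INR /= ?IH; ring. Qed.

Section Measure.
Variable mu : (R -> Prop) -> R.
Hypothesis pm : prob_measure mu.

Lemma mu_ge0 A : borel A -> 0 <= mu A. Proof. by case: pm => h _; exact: h. Qed.
Lemma mu_true : mu (fun=> True) = 1. Proof. by case: pm => _ []. Qed.

(** Additivity over a sequence of empty sets gives a convergent series with constant terms. *)
Lemma mu_false : mu (fun=> False) = 0.
Proof.
case: pm => _ [_ /(_ (fun _ _ => False) (fun=> borel_false))] h.
have {}h := h (fun _ _ _ _ F _ => F).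
rewrite (pred_ext mu (A := fun x => exists _ : nat, False) (A' := fun=> False)) in h; last by move=> x; split=> [[]|].
have nn := mu_ge0 borel_false.
case: (Rle_lt_or_eq_dec _ _ nn) => // pos.
have [N hN] := h _ pos; have := hN N.+1 (le_S _ _ (le_n N)).
have -> : sum_f_R0 (fun=> mu (fun=> False)) N.+1 = mu (fun=> False) * INR N.+2 by exact: sum_cte.
rewrite /R_dist Rabs_right !S_INR; have := pos_INR N; nra.
Qed.

Lemma mu_union A A' : borel A -> borel A' -> (forall x, A x -> A' x -> False) ->
  mu (fun x => A x \/ A' x) = mu A + mu A'.
Proof.
move=> bA bA' dis.
pose S k : R -> Prop := match k with 0%N => A | 1%N => A' | _ => fun=> False end.
have bS k : borel (S k) by case: k => [|[|k]] //=; exact: borel_false.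
have dS i j x : i <> j -> S i x -> S j x -> False.
  by case: i j => [|[|i]] [|[|j]] //= _ h1 h2; [exact: (dis x)|exact: (dis x)].
case: pm => _ [_ /(_ S bS dS)] h.
apply: (uniqueness_sum (fun k => mu (S k))).
  rewrite (pred_ext mu (A' := fun x => exists k, S k x)) // => x.
  split=> [[hA|hA]|[[|[|k]]]] //=; [by exists 0%N|by exists 1%N|by left|by right].
move=> eps eps0; exists 1%N => n /leP n1.
have -> : sum_f_R0 (fun k => mu (S k)) n = mu A + mu A'.
  elim: n n1 => // -[|n] IH _ //; rewrite tech5 IH //= mu_false; ring.
by rewrite /R_dist Rminus_diag Rabs_R0.
Qed.

Lemma mu_split A X : borel A -> borel X ->
  mu A = mu (fun x => A x /\ X x) + mu (fun x => A x /\ ~ X x).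
Proof.
move=> bA bX; rewrite -mu_union.
- by apply: pred_ext => x; tauto.
- exact: borel_inter.
- by apply: borel_inter => //; exact: borel_compl.
- by move=> x; tauto.
Qed.

Lemma mu_mono A A' : borel A -> borel A' -> (forall x, A x -> A' x) -> mu A <= mu A'.
Proof.
move=> bA bA' sub; rewrite (mu_split bA' bA).
have -> : mu (fun x => A' x /\ A x) = mu A by apply: pred_ext => x; split=> [[]//|h]; split=> //; exact: sub.
have : 0 <= mu (fun x => A' x /\ ~ A x); last by lra.
by apply: mu_ge0; apply: borel_inter => //; exact: borel_compl.
Qed.

Lemma mu_le1 A : borel A -> mu A <= 1.
Proof. by move=> bA; rewrite -mu_true; apply: mu_mono => //; exact: borel_true. Qed.

Lemma mu_co a b : a <= b -> mu (fun x => a <= x < b) = mu (fun x => a <= x) - mu (fun x => b <= x).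
Proof.
move=> ab; rewrite (mu_split (borel_ge a) (borel_ge b)).
have -> : mu (fun x => a <= x /\ b <= x) = mu (fun x => b <= x) by apply: pred_ext => x; lra.
have -> : mu (fun x => a <= x /\ ~ b <= x) = mu (fun x => a <= x < b) by apply: pred_ext => x; lra.
ring.
Qed.

(** [sv l] is the simple function given by the list, and [vv l X] its integral over [X]. *)
Let sv (l : seq (R * (R -> Prop))) x := foldr (fun p acc => p.1 * indic p.2 x + acc) 0 l.
Let vv (l : seq (R * (R -> Prop))) X := foldr (fun p acc => p.1 * mu (fun x => p.2 x /\ X x) + acc) 0 l.
Notation nthl l i := (nth (0, fun _ => False) l i).

Definition simple_good (l : seq (R * (R -> Prop))) : Prop :=
  (forall i, (i < size l)%N -> 0 <= (nthl l i).1 /\ borel (nthl l i).2) /\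
  (forall i j x, (i < j)%N -> (j < size l)%N -> (nthl l i).2 x -> (nthl l j).2 x -> False).

Lemma simple_good_tail p l : simple_good (p :: l) -> simple_good l.
Proof. by move=> [h1 h2]; split=> [i|i j x]; [exact: (h1 i.+1)|exact: (h2 i.+1 j.+1)]. Qed.

Lemma indicE (A : R -> Prop) x : indic A x = 1 /\ A x \/ indic A x = 0 /\ ~ A x.
Proof. by rewrite /indic; case: excluded_middle_informative => h; [left|right]. Qed.

Lemma sv_ge0 l x : simple_good l -> 0 <= sv l x.
Proof.
elim: l => [|p l IH] gl /=; first by lra.
have := IH (simple_good_tail gl); have [/(_ 0%N isT) /= [h _] _] := gl.
by case: (indicE p.2 x) => [[-> _]|[-> _]]; lra.
Qed.

Lemma vv_split l X Y : simple_good l -> borel X -> borel Y -> (forall x, X x -> Y x -> False) ->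
  vv l (fun x => X x \/ Y x) = vv l X + vv l Y.
Proof.
move=> gl bX bY dis; elim: l gl => [|p l IH] gl /=; first by ring.
rewrite (IH (simple_good_tail gl)); have [/(_ 0%N isT) /= [_ bp] _] := gl.
have -> : mu (fun x => p.2 x /\ (X x \/ Y x)) = mu (fun x => p.2 x /\ X x) + mu (fun x => p.2 x /\ Y x).
  rewrite -mu_union; try exact: borel_inter.
    by apply: pred_ext => x; tauto.
  by move=> x [_ Xx] [_ Yx]; exact: (dis x).
ring.
Qed.

(** Induction on the list, cutting [X] along the first set: by disjointness only the first term
    contributes on that set, and only the others off it. *)
Lemma vv_bound l X M : simple_good l -> borel X -> 0 <= M -> (forall x, X x -> sv l x <= M) ->
  vv l X <= M * mu X.
Proof.
move=> gl bX M0; elim: l X gl bX => [|p l IH] X gl bX hM /=.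
  by have := mu_ge0 bX; nra.
have gl' := simple_good_tail gl; have [/(_ 0%N isT) /= [p0 bp] dis] := gl.
have bXA : borel (fun x => X x /\ p.2 x) by exact: borel_inter.
have bXN : borel (fun x => X x /\ ~ p.2 x) by apply: borel_inter => //; exact: borel_compl.
have e1 : vv l X = vv l (fun x => X x /\ ~ p.2 x).
  have h : forall i x, (i < size l)%N -> (nthl l i).2 x -> ~ p.2 x.
    by move=> i x lti hi hp; exact: (dis 0%N i.+1 x).
  elim: (l) h => [|p' l' IH'] h //=; rewrite IH'; last by move=> i x; exact: (h i.+1).
  congr (_ * _ + _); apply: pred_ext => x; split=> [[h1 h2]|[h1 [h2 _]]] //.
  by split=> //; split=> //; exact: (h 0%N).
have i1 : vv l (fun x => X x /\ ~ p.2 x) <= M * mu (fun x => X x /\ ~ p.2 x).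
  apply: IH => // x [Xx npx]; have := hM x Xx; rewrite /=.
  by case: (indicE p.2 x) => [[_ h]|[-> _]] //; lra.
have i2 : p.1 * mu (fun x => p.2 x /\ X x) <= M * mu (fun x => X x /\ p.2 x).
  have -> : mu (fun x => p.2 x /\ X x) = mu (fun x => X x /\ p.2 x) by apply: pred_ext => x; tauto.
  have [[x [Xx px]]|nx] := classic (exists x, X x /\ p.2 x).
    apply: Rmult_le_compat_r; first exact: mu_ge0.
    have := hM x Xx; rewrite /=; have := sv_ge0 x gl'.
    by case: (indicE p.2 x) => [[-> _]|[_ h]] //; lra.
  rewrite (pred_ext mu (A' := fun=> False)); first by rewrite mu_false; lra.
  by move=> x; split=> // h; apply: nx; exists x.
rewrite (mu_split bX bp) e1; lra.
Qed.

Lemma vv_true l : vv l (fun=> True) = foldr (fun p acc => p.1 * mu p.2 + acc) 0 l.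
Proof.
elim: l => [|p l IH] //=; rewrite IH; congr (_ * _ + _); apply: pred_ext => x; tauto.
Qed.

(** * Integrals compared with Riemann sums *)

Section Step.
Variables (t : nat -> R) (N : nat) (h : R -> R) (d : R).
Hypotheses (tmono : forall i, t i <= t i.+1) (h0 : forall x, 0 <= h x) (d0 : 0 <= d).
Hypothesis hout : forall x, x < t 0%N \/ t N <= x -> h x = 0.
Hypothesis hosc : forall i x, (i < N)%N -> t i <= x < t i.+1 -> Rabs (h x - h (t i)) <= d.

Let J i x := t i <= x < t i.+1.
Let tle i j : (i <= j)%N -> t i <= t j.
Proof.
move=> ij; rewrite -(subnK ij); elim: (j - i)%N => [|n IH]; first by rewrite add0n; lra.
by rewrite addSn; have := tmono (n + i); lra.
Qed.
Let stepsum := rsum (fun i => h (t i) * mu (J i)) N.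

Let rsumJ n : rsum (fun i => mu (J i)) n = mu (fun x => t 0%N <= x < t n).
Proof.
elim: n => [|n IH] /=.
  rewrite (pred_ext mu (A' := fun=> False)) ?mu_false // => x; split=> //; lra.
rewrite IH -mu_union; try exact: borel_co; last by rewrite /J => x; lra.
by apply: pred_ext => x; rewrite /J; have := tle (leq0n n); have := tmono n; lra.
Qed.

(** A simple function below [h] is at most [h (t i) + d] on the cell [J i] and at most $0$ outside;
    as the total mass is at most $1$, the excess is at most [d]. *)
Lemma step_upper v : simple_below mu h v -> v <= stepsum + d.
Proof.
move=> [l [l1 [l2 [l3 ->]]]]; have gl : simple_good l by split.
rewrite -vv_true.
have -> : vv l (fun=> True) = vv l (fun x => t 0%N <= x < t N) + vv l (fun x => ~ (t 0%N <= x < t N)).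
  rewrite -vv_split //; try exact: borel_co; try (by apply: borel_compl; exact: borel_co).
  by apply: (pred_ext (vv l)) => x; tauto.
have i1 : vv l (fun x => ~ (t 0%N <= x < t N)) <= 0 * mu (fun x => ~ (t 0%N <= x < t N)).
  apply: vv_bound => //; [by apply: borel_compl; exact: borel_co|lra|].
  by move=> x hx; apply: (Rle_trans _ _ _ (l3 x)); rewrite hout; lra.
have i2 n : (n <= N)%N ->
    vv l (fun x => t 0%N <= x < t n) <= rsum (fun i => h (t i) * mu (J i) + d * mu (J i)) n.
  elim: n => [|n IH] nN /=.
    rewrite (pred_ext (vv l) (A' := fun=> False)); last by move=> x; lra.
    by have := @vv_bound l (fun=> False) 0 gl borel_false (Rle_refl 0) (fun x F => False_ind _ F); lra.
  have -> : vv l (fun x => t 0%N <= x < t n.+1) = vv l (fun x => t 0%N <= x < t n) + vv l (J n).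
    rewrite -vv_split //; try exact: borel_co; last by rewrite /J => x; lra.
    apply: (pred_ext (vv l)) => x; rewrite /J.
    by have := tle (leq0n n); have := tmono n; lra.
  have i3 : vv l (J n) <= (h (t n) + d) * mu (J n).
    apply: vv_bound => //; [exact: borel_co|by have := h0 (t n); lra|].
    move=> x hx; apply: (Rle_trans _ _ _ (l3 x)).
    by have := hosc nN hx => /Rabs_le_inv; lra.
  by have := IH (ltnW nN); lra.
have := i2 N (leqnn N); rewrite rsum_lin rsumJ -/stepsum => i3.
have i4 : d * mu (fun x => t 0%N <= x < t N) <= d * 1.
  by apply: Rmult_le_compat_l => //; apply: mu_le1; exact: borel_co.
lra.
Qed.

Let L := fix L n : seq (R * (R -> Prop)) :=
  if n is m.+1 then (Rmax (h (t m) - d) 0, J m) :: L m else [::].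

Let L_lt n i x : (i < size (L n))%N -> (nthl (L n) i).2 x -> x < t n.
Proof.
elim: n i => [|n IH] [|i] //=; first by rewrite /J; lra.
by move=> lti hx; have := IH i lti hx; have := tmono n; lra.
Qed.

(** The simple function equal to $\max(h(t_i)-d,0)$ on each cell lies below [h], and its integral
    reaches the Riemann sum up to [d]. *)
Lemma step_lower : exists v, simple_below mu h v /\ stepsum - d <= v.
Proof.
exists (foldr (fun p acc => p.1 * mu p.2 + acc) 0 (L N)); split.
  exists (L N); split; [|split; [|split=> //]].
  - elim: (N) => [|n IH] [|i] //= lt; last exact: IH.
    by split; [exact: Rmax_r|exact: borel_co].
  - elim: (N) => [|n IH] i j x //=; case: i j => [|i] [|j] //= ij lt.
      by move=> [h1 _] /(L_lt lt); lra.
    exact: IH.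
  - move=> x.
    have svE n : foldr (fun p acc => p.1 * indic p.2 x + acc) 0 (L n)
        = rsum (fun i => Rmax (h (t i) - d) 0 * indic (J i) x) n.
      by elim: n => [|n IH] //=; rewrite IH; ring.
    rewrite svE.
    have P n : (n <= N)%N -> (x < t n -> rsum (fun i => Rmax (h (t i) - d) 0 * indic (J i) x) n <= h x) /\
        (t n <= x -> rsum (fun i => Rmax (h (t i) - d) 0 * indic (J i) x) n = 0).
      elim: n => [|n IH] nN /=; first by split=> // _; exact: h0.
      have [IH1 IH2] := IH (ltnW nN); have tn := tmono n; split=> hx.
        case: (indicE (J n) x) => [[-> Jx]|[-> nJ]].
          rewrite IH2; last by case: Jx.
          have := hosc nN Jx => /Rabs_le_inv ho.
          have := h0 x => hx0; rewrite Rplus_0_l Rmult_1_r; apply: Rmax_lub; lra.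
        have : x < t n by apply: Rnot_le_lt => h1; apply: nJ; split.
        by move=> /IH1; lra.
      case: (indicE (J n) x) => [[_ [_ Jx]]|[-> nJ]]; first by lra.
      by rewrite IH2; [ring|lra].
    have [P1 P2] := P N (leqnn N).
    by case: (Rlt_le_dec x (t N)) => [/P1 //|/P2 ->]; exact: h0.
have -> : foldr (fun p acc => p.1 * mu p.2 + acc) 0 (L N) = rsum (fun i => Rmax (h (t i) - d) 0 * mu (J i)) N.
  by elim: (N) => [|n IH] //=; rewrite IH; ring.
have i1 : d * rsum (fun i => mu (J i)) N <= d * 1.
  by rewrite rsumJ; apply: Rmult_le_compat_l => //; apply: mu_le1; exact: borel_co.
have i2 : rsum (fun i => h (t i) * mu (J i) + (- d) * mu (J i)) N
   <= rsum (fun i => Rmax (h (t i) - d) 0 * mu (J i)) N.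
  apply: rsum_le => i _; have := mu_ge0 (borel_co (t i) (t i.+1)) => m0.
  have -> : h (t i) * mu (J i) + (- d) * mu (J i) = (h (t i) - d) * mu (J i) by ring.
  by apply: Rmult_le_compat_r; [exact: m0|exact: Rmax_l].
rewrite rsum_lin in i2; rewrite /stepsum; lra.
Qed.

Lemma step_approx I : integral_nonneg mu h I -> Rabs (I - stepsum) <= d.
Proof.
move=> [ub lub]; apply: Rabs_le; split.
  by have [v [hv le]] := step_lower; have := ub v hv; lra.
by have := lub _ step_upper; lra.
Qed.

End Step.

Lemma integral_nonneg_exists h M : (forall x, 0 <= h x <= M) -> exists I, integral_nonneg mu h I.
Proof.
move=> hM; have [I hI] : {I | is_lub (simple_below mu h) I}; last by exists I.
have M0 : 0 <= M by have := hM 0; lra.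
apply: completeness.
  exists (M * 1) => v [l [l1 [l2 [l3 ->]]]]; rewrite -vv_true -mu_true.
  apply: vv_bound => //; [exact: borel_true|].
  by move=> x _; apply: (Rle_trans _ _ _ (l3 x)); have := hM x; lra.
by exists 0, [::]; split=> //; split=> //; split=> //= x; have := hM x; lra.
Qed.

End Measure.

(** * Convergence of tails and of integrals *)

Section VagueLimit.
Variables (nu : nat -> (R -> Prop) -> R) (G : nat -> R -> R) (ta tb : R).
Hypothesis pn : forall n, (1 <= n)%N -> prob_measure (nu n).
Hypothesis nuG : forall n t, (1 <= n)%N -> nu n (fun x => t <= x) = G n t.
Hypothesis Glow : forall n t, (1 <= n)%N -> t <= ta -> G n t = 1.
Hypothesis Ghigh : forall n t, (1 <= n)%N -> tb < t -> G n t = 0.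
Hypothesis late : forall t eps eta, 0 < eps -> 0 < eta ->
  exists M, forall m, (M <= m)%N -> exists N, forall n, (N <= n)%N -> G m t - eta <= G n (t - eps).

Let G01 n t : (1 <= n)%N -> 0 <= G n t <= 1.
Proof.
move=> n1; rewrite -nuG //; split; [apply: mu_ge0|apply: mu_le1]; try exact: pn; exact: borel_ge.
Qed.

Let Gmono n s t : (1 <= n)%N -> s <= t -> G n t <= G n s.
Proof.
move=> n1 st; rewrite -!nuG //; apply: mu_mono; [exact: pn|exact: borel_ge|exact: borel_ge|].
by move=> x; lra.
Qed.

(** [Gi] is the pointwise lower limit of the tails. By [late], the upper limit at $t$ is at most the
    lower limit at every $s<t$. *)
Lemma liminf_tail : exists Gi : R -> R,
  [/\ forall t, 0 <= Gi t <= 1, forall s t, s <= t -> Gi t <= Gi s,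
      (forall t, t <= ta -> Gi t = 1) /\ (forall t, tb < t -> Gi t = 0),
      forall t eta, 0 < eta -> exists N, forall n, (N <= n)%N -> Gi t - eta <= G n t &
      forall s t eta, s < t -> 0 < eta -> exists N, forall n, (N <= n)%N -> G n t <= Gi s + eta].
Proof.
pose A t x := exists N, forall n, (N <= n)%N -> x <= G n t.
have A0 t : A t 0 by exists 1%N => n n1; have := G01 t n1; lra.
have A1 t x : A t x -> x <= 1.
  by move=> [N hN]; have := hN N.+1 (leqnSn N); have := @G01 N.+1 t isT; lra.
have ex t : exists l, is_lub (A t) l.
  by have [l hl] := completeness (A t) (ex_intro _ 1 (A1 t)) (ex_intro _ 0 (A0 t)); exists l.
have [Gi hGi] := boolp.choice ex.
have G1 t : 0 <= Gi t <= 1.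
  by have [ub lub] := hGi t; split; [exact/ub/A0|apply: lub; exact: A1].
exists Gi; split=> //.
- move=> s t st; have [_ lub] := hGi t; have [ub _] := hGi s; apply: lub => x [N hN]; apply: ub.
  by exists N.+1 => n Nn; have := hN n (ltnW Nn); have := @Gmono n s t (leq_ltn_trans (leq0n _) Nn) st; lra.
- split=> t ht; have [ub lub] := hGi t.
    apply: Rle_antisym; first by have := G1 t; lra.
    by apply: ub; exists 1%N => n n1; rewrite Glow //; lra.
  apply: Rle_antisym; last by have := G1 t; lra.
  by apply: lub => x [N hN]; have := hN N.+1 (leqnSn N); rewrite Ghigh //; lra.
- move=> t eta eta0; have [_ lub] := hGi t.
  have [x [[N hN] hx]] : exists x, A t x /\ Gi t - eta < x.
    apply: NNPP => h; have : Gi t <= Gi t - eta; last by lra.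
    by apply: lub => x Ax; apply: Rnot_lt_le => lt; apply: h; exists x.
  by exists N => n /hN; lra.
- move=> s t eta st eta0; have [M hM] := @late t (t - s) eta ltac:(lra) eta0.
  exists M => m /hM [N hN]; have [ub _] := hGi s.
  have : G m t - eta <= Gi s; last by lra.
  apply: ub; exists N => n /hN; by have -> : t - (t - s) = s by ring.
Qed.

Variable Gi : R -> R.
Hypothesis G1 : forall t, 0 <= Gi t <= 1.
Hypothesis Gim : forall s t, s <= t -> Gi t <= Gi s.
Hypothesis Gilow : forall t, t <= ta -> Gi t = 1.
Hypothesis Gihigh : forall t, tb < t -> Gi t = 0.
Hypothesis Gige : forall t eta, 0 < eta -> exists N, forall n, (N <= n)%N -> Gi t - eta <= G n t.
Hypothesis Gile : forall s t eta, s < t -> 0 < eta -> exists N, forall n, (N <= n)%N -> G n t <= Gi s + eta.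

(** [Q u] is the supremum of the levels at which [Gi] is at least [u], so the tail of [mu] at $t$
    lies between $\mathrm{Gi}(t)$ and $\mathrm{Gi}(s)$ for every $s<t$. *)
Lemma limit_measure : exists mu, prob_measure mu /\
  forall t, Gi t <= mu (fun x => t <= x) /\ forall s, s < t -> mu (fun x => t <= x) <= Gi s.
Proof.
have exQ u : exists y, 0 < u < 1 -> is_lub (fun t => u <= Gi t) y.
  have [u01|n] := classic (0 < u < 1); last by exists 0.
  have [y hy] : {y | is_lub (fun t => u <= Gi t) y}.
    apply: completeness; last by exists ta; rewrite Gilow; lra.
    exists tb => t hu; apply: Rnot_lt_le => lt; rewrite Gihigh in hu; lra.
  by exists y.
have [Q hQ] := boolp.choice exQ.
have [|mu [pm hmu]] := @pushforward_quantile Q.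
  move=> u v u0 uv v1; have [ubu _] := hQ u ltac:(lra); have [_ lubv] := hQ v ltac:(lra).
  by apply: lubv => t ht; apply: ubu; lra.
exists mu; split=> // t; split.
  have [h _] := hmu t (Gi t) (borel_ge t); apply: h; try by have := G1 t; lra.
  move=> u u0 ut; have [ub _] := hQ u ltac:(have := G1 t; lra); apply: ub; lra.
move=> s st; have [_ h] := hmu t (Gi s) (borel_ge t); apply: h; first by have := G1 s; lra.
move=> u u0 u1 tQ; have [_ lub] := hQ u ltac:(lra).
apply: Rnot_lt_le => lt; have : Q u <= s; last by lra.
apply: lub => y hy; apply: Rnot_lt_le => sy; have := @Gim s y ltac:(lra); lra.
Qed.

(** A monotone function with values in $[0,1]$ cannot drop by more than [eta] on each of $K>1/\eta$
    consecutive intervals. *)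
Lemma small_variation a b eta : a < b -> 0 < eta -> exists s t, a < s /\ s < t /\ t < b /\ Gi s - Gi t <= eta.
Proof.
move=> ab eta0; apply: NNPP => h.
have [K hK] := INR_unbounded (1 / eta).
(* Dividing by $K+2$ leaves a margin [r] at both ends, so all points [p j] are strictly inside. *)
pose r := (b - a) / (INR K + 2); have K0 := pos_INR K.
have r0 : 0 < r by apply: Rdiv_lt_0_compat; lra.
have er : r * (INR K + 2) = b - a by rewrite /r; field; lra.
pose p j := a + r * (INR j + 1).
have step j : (j <= K)%N -> INR j * eta <= Gi (p 0%N) - Gi (p j).
  elim: j => [|j IH] jK; first by rewrite /=; lra.
  have := IH (ltnW jK).
  have jK' : INR j + 1 <= INR K by rewrite -S_INR; exact: INR_leq.
  have : eta < Gi (p j) - Gi (p j.+1).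
    apply: Rnot_le_lt => le; apply: h; exists (p j), (p j.+1); rewrite /p S_INR.
    have j0 := pos_INR j; split; [nra|split; [nra|split; [nra|]]].
    by move: le; rewrite /p S_INR.
  by rewrite S_INR; lra.
have := step K (leqnn K); have := G1 (p 0%N); have := G1 (p K).
have : 1 < INR K * eta.
  have -> : 1 = 1 / eta * eta by field; lra.
  by apply: Rmult_lt_compat_r.
lra.
Qed.

Variable mu : (R -> Prop) -> R.
Hypothesis pmu : prob_measure mu.
Hypothesis hmu : forall t, Gi t <= mu (fun x => t <= x) /\ forall s, s < t -> mu (fun x => t <= x) <= Gi s.

(** A substitute, at tolerance [eta], for a continuity point of the limit: where [Gi] varies little
    just before $t$, the tails and that of [mu] are caught in the same narrow range. *)
Lemma good_point a b eta : a < b -> 0 < eta -> exists t, a < t < b /\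
  exists N, forall n, (N <= n)%N -> Rabs (G n t - mu (fun x => t <= x)) <= eta.
Proof.
move=> ab eta0; have [s [t [as' [st [tb' hs]]]]] := @small_variation a b (eta / 2) ab ltac:(lra).
exists t; split; first by lra.
have [N1 h1] := @Gige t (eta / 2) ltac:(lra); have [N2 h2] := @Gile s t (eta / 2) st ltac:(lra).
exists (N1 + N2)%N => n hn; have := h1 n ltac:(lia); have := h2 n ltac:(lia).
have [m1 /(_ s st) m2] := hmu t; move=> *; apply: Rabs_le; lra.
Qed.

Lemma eventually_all (P : nat -> nat -> Prop) K :
  (forall i, exists N, forall n, (N <= n)%N -> P i n) ->
  exists N, forall n, (N <= n)%N -> forall i, (i <= K)%N -> P i n.
Proof.
move=> h; elim: K => [|K [N hN]].
  by have [N hN] := h 0%N; exists N => n /hN p [].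
have [N' hN'] := h K.+1; exists (N + N')%N => n hn i; rewrite leq_eqVlt => /orP[/eqP ->|].
  by apply: hN'; lia.
by rewrite ltnS => iK; apply: hN => //; lia.
Qed.

Lemma integral_cv h M Hm : (forall x, 0 <= h x <= Hm) -> (forall x, M < Rabs x -> h x = 0) ->
  (forall eps, 0 < eps -> exists d, 0 < d /\ forall x y, Rabs (x - y) < d -> Rabs (h x - h y) < eps) ->
  exists (In : nat -> R) (I : R), (forall n, (1 <= n)%N -> integral_nonneg (nu n) h (In n)) /\
    integral_nonneg mu h I /\ Un_cv In I.
Proof.
move=> hb hout huc.
have exI n : exists I, (1 <= n)%N -> integral_nonneg (nu n) h I.
  case: (leqP 1 n) => n1; last by exists 0.
  by have [I hI] := integral_nonneg_exists (pn n1) hb; exists I.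
have [In hIn] := boolp.choice exI.
have [I hI] := integral_nonneg_exists pmu hb.
exists In, I; split=> //; split=> // eps eps0.
have [d [d0 hd]] := huc (eps / 4) ltac:(lra).
have Hm0 : 0 <= Hm by have := hb 0; lra.
pose M' := Rmax M 0.
have M'0 : 0 <= M' by exact: Rmax_r.
have hM' x : M' < Rabs x -> h x = 0.
  by move=> hx; apply: hout; have := Rmax_l M 0; rewrite -/M'; lra.
pose r := d / 2; have r0 : 0 < r by rewrite /r; lra.
pose a0 := - M' - r - 1.
have [K hK] := INR_unbounded ((2 * M' + r + 2) / r).
have hK' : 2 * M' + r + 2 < INR K * r.
  have -> : 2 * M' + r + 2 = (2 * M' + r + 2) / r * r by field; lra.
  exact: Rmult_lt_compat_r.
(* Each of the $K$ cells contributes an error of at most $2\eta H_m$; this choice keeps their sum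
   below $\varepsilon/4$. *)
pose eta := eps / (8 * (INR K + 1) * (Hm + 1)).
have K0 := pos_INR K.
have den : 0 < 8 * (INR K + 1) * (Hm + 1) by apply: Rmult_lt_0_compat; lra.
have eta0 : 0 < eta by exact: Rdiv_lt_0_compat.
have ext k : exists t, a0 + INR k * r < t < a0 + (INR k + 1) * r /\
    exists N, forall n, (N <= n)%N -> Rabs (G n t - mu (fun x => t <= x)) <= eta.
  by apply: good_point => //; nra.
have [t ht] := boolp.choice ext.
have ti k : a0 + INR k * r < t k < a0 + (INR k + 1) * r by have [] := ht k.
have tS k : t k <= t k.+1 by have := ti k; have := ti k.+1; rewrite S_INR; lra.
have tgap k : t k.+1 - t k < d by have := ti k; have := ti k.+1; rewrite S_INR /r; lra.
have tout x : x < t 0%N \/ t K <= x -> h x = 0.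
  move=> hx; apply: hM'; have h1 := ti 0%N; have h2 := ti K; rewrite /= /a0 in h1 h2.
  case: hx => hx; first by rewrite Rabs_left; lra.
  by rewrite Rabs_right; lra.
have tosc i x : (i < K)%N -> t i <= x < t i.+1 -> Rabs (h x - h (t i)) <= eps / 4.
  by move=> _ hx; left; apply: hd; rewrite Rabs_right; have := tgap i; lra.
have [N hN] := @eventually_all (fun i n => Rabs (G n (t i) - mu (fun x => t i <= x)) <= eta) K.+1
  (fun i => proj2 (ht i)).
exists N.+1 => n /leP Nn; have n1 : (1 <= n)%N by lia.
have hpos x : 0 <= h x by have := hb x; lra.
have a1 := step_approx (pn n1) tS hpos (ltac:(lra) : 0 <= eps / 4) tout tosc (hIn n n1).
have a2 := step_approx pmu tS hpos (ltac:(lra) : 0 <= eps / 4) tout tosc hI.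
set S1 := rsum _ _ in a1; set S2 := rsum _ _ in a2.
have a3 : Rabs (S1 - S2) <= INR K * (Hm * (2 * eta)).
  rewrite -(rsum_const (Hm * (2 * eta)) K) /S1 /S2.
  have aux : forall k, (k <= K)%N -> Rabs (rsum (fun i => h (t i) * nu n (fun x => t i <= x < t i.+1)) k
      - rsum (fun i => h (t i) * mu (fun x => t i <= x < t i.+1)) k) <= rsum (fun=> Hm * (2 * eta)) k.
    elim=> [|k IH] kK /=; first by rewrite Rminus_diag Rabs_R0; lra.
    have := IH (ltnW kK); set X := rsum _ _; set Y := rsum _ _ => hXY.
    rewrite !mu_co //; try exact: pn.
    rewrite !nuG //.
    have b1 := hN n ltac:(lia) k ltac:(lia); have b2 := hN n ltac:(lia) k.+1 ltac:(lia).
    set g1 := G n (t k) in b1 *; set g2 := G n (t k.+1) in b2 *.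
    set m1 := mu (fun x => t k <= x) in b1 *; set m2 := mu (fun x => t k.+1 <= x) in b2 *.
    have -> : X + h (t k) * (g1 - g2) - (Y + h (t k) * (m1 - m2))
        = (X - Y) + h (t k) * ((g1 - m1) - (g2 - m2)) by ring.
    apply: (Rle_trans _ _ _ (Rabs_triang _ _)); apply: Rplus_le_compat => //.
    rewrite Rabs_mult; have := hb (t k) => hbk; rewrite (Rabs_right (h (t k))); last by lra.
    apply: Rmult_le_compat; [lra|exact: Rabs_pos|lra|].
    apply: (Rle_trans _ _ _ (Rabs_triang _ _)); rewrite Rabs_Ropp; lra.
  exact: aux.
have a4 : INR K * (Hm * (2 * eta)) <= eps / 4.
  have -> : eps / 4 = (INR K + 1) * ((Hm + 1) * (2 * eta)) by rewrite /eta; field; split; lra.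
  apply: Rmult_le_compat; [lra| |lra|]; first by apply: Rmult_le_pos; lra.
  by apply: Rmult_le_compat_r; lra.
rewrite /R_dist.
have -> : In n - I = (In n - S1) + (S1 - S2) - (I - S2) by ring.
apply: (@Rle_lt_trans _ (eps / 4 + eps / 4 + eps / 4)); last by lra.
apply: (Rle_trans _ _ _ (Rabs_triang _ _)); rewrite Rabs_Ropp; apply: Rplus_le_compat => //.
by apply: (Rle_trans _ _ _ (Rabs_triang _ _)); apply: Rplus_le_compat => //; lra.
Qed.

Lemma compact_support_uniform g M : continuity g -> (forall x, M < Rabs x -> g x = 0) ->
  (exists Hm, forall x, Rabs (g x) <= Hm) /\
  forall eps, 0 < eps -> exists d, 0 < d /\ forall x y, Rabs (x - y) < d -> Rabs (g x - g y) < eps.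
Proof.
(* With the margin $2$ and a modulus at most $1$, two close points of which one lies outside
   $[-a,a]$ are both in the region where [g] vanishes. *)
move=> gc gM; pose a := Rmax M 0 + 2.
have a2 : 2 <= a by have := Rmax_r M 0; rewrite /a; lra.
have gout x : a - 2 < Rabs x -> g x = 0.
  by move=> hx; apply: gM; have := Rmax_l M 0; rewrite /a in hx; lra.
split.
  have gc' x : - a <= x <= a -> continuity_pt g x by move=> _; exact: gc.
  have [x1 [h1 _]] := continuity_ab_maj g (- a) a ltac:(lra) gc'.
  have [x2 [h2 _]] := continuity_ab_min g (- a) a ltac:(lra) gc'.
  exists (Rabs (g x1) + Rabs (g x2)) => x.
  have p1 := Rabs_pos (g x1); have p2 := Rabs_pos (g x2).
  case: (Rle_lt_dec (Rabs x) a) => hx.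
    have hx' : - a <= x <= a by move: hx => /Rabs_le_inv.
    have q1 := h1 x hx'; have q2 := h2 x hx'.
    have r1 := Rle_abs (g x1); have r2 := Rle_abs (- g x2); rewrite Rabs_Ropp in r2.
    by apply: Rabs_le; lra.
  by rewrite gout ?Rabs_R0; lra.
move=> eps eps0.
have gc' x : - a <= x <= a -> continuity_pt g x by move=> _; exact: gc.
have [d hd] := Heine_cor2 gc' (mkposreal eps eps0).
exists (Rmin d 1); have d0 := cond_pos d; split; first by apply: Rmin_pos; lra.
move=> x y xy; have l1 := Rmin_l d 1; have l2 := Rmin_r d 1.
have close u v : Rabs (u - v) < Rmin d 1 -> - a <= u <= a -> ~ (- a <= v <= a) -> Rabs (g u - g v) < eps.
  move=> uv hu hv.
  have hv' : a - 2 < Rabs v.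
    apply: Rnot_le_lt => /Rabs_le_inv h; apply: hv; lra.
  have hu' : a - 2 < Rabs u.
    apply: Rnot_le_lt => /Rabs_le_inv h; apply: hv.
    by move: uv => /Rabs_def2; lra.
  by rewrite !gout // Rminus_diag Rabs_R0.
have [hx|hx] := classic (- a <= x <= a); have [hy|hy] := classic (- a <= y <= a).
- by apply: hd => //; lra.
- exact: close.
- by rewrite Rabs_minus_sym; apply: close => //; rewrite Rabs_minus_sym.
- have o v : ~ (- a <= v <= a) -> g v = 0.
    by move=> hv; apply: gout; apply: Rnot_le_lt => /Rabs_le_inv h; apply: hv; lra.
  by rewrite !o // Rminus_diag Rabs_R0.
Qed.

Lemma vague_limit : vague_cv nu mu.
Proof.
move=> g gc [M gM].
have [[Hm hHm] guc] := compact_support_uniform gc gM.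
(* The sign [s] treats the positive and the negative part of [g] together. *)
have part (s : R) : (s = 1 \/ s = -1) ->
    exists (In : nat -> R) (I : R), (forall n, (1 <= n)%N -> integral_nonneg (nu n) (fun x => Rmax (s * g x) 0) (In n)) /\
    integral_nonneg mu (fun x => Rmax (s * g x) 0) I /\ Un_cv In I.
  move=> hs; apply: (@integral_cv _ M Hm).
  - move=> x; split; first exact: Rmax_r.
    apply: Rmax_lub; last by have := hHm x; have := Rabs_pos (g x); lra.
    by have := hHm x => /Rabs_le_inv; case: hs => ->; lra.
  - by move=> x /gM ->; rewrite Rmult_0_r Rmax_left; lra.
  - move=> eps /guc [d [d0 hd]]; exists d; split=> // x y /hd /Rabs_def2 h.
    apply: Rabs_def1; rewrite /Rmax; case: Rle_dec => h1; case: Rle_dec => h2; case: hs => hs; rewrite hs in h1 h2 *; lra.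
have [In1 [I1 [h1 [h2 h3]]]] := part 1 (or_introl erefl).
have [In2 [I2 [k1 [k2 k3]]]] := part (-1) (or_intror erefl).
have e1 : (fun x => Rmax (1 * g x) 0) = (fun x => Rmax (g x) 0).
  by apply: boolp.funext => x; rewrite Rmult_1_l.
have e2 : (fun x => Rmax (-1 * g x) 0) = (fun x => Rmax (- g x) 0).
  by apply: boolp.funext => x; congr Rmax; ring.
rewrite e1 in h1 h2; rewrite e2 in k1 k2.
exists (fun n => In1 n - In2 n), (I1 - I2); split; last split.
- move=> n n1; exists (In1 n), (In2 n); split; [|split] => //; [exact: h1|exact: k1].
- by exists I1, I2.
- exact: CV_minus.
Qed.

End VagueLimit.

Theorem tail_vague_cv (nu : nat -> (R -> Prop) -> R) (G : nat -> R -> R) (ta tb : R) :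
  (forall n, (1 <= n)%N -> prob_measure (nu n)) ->
  (forall n t, (1 <= n)%N -> nu n (fun x => t <= x) = G n t) ->
  (forall n t, (1 <= n)%N -> t <= ta -> G n t = 1) ->
  (forall n t, (1 <= n)%N -> tb < t -> G n t = 0) ->
  (forall t eps eta, 0 < eps -> 0 < eta ->
     exists M, forall m, (M <= m)%N -> exists N, forall n, (N <= n)%N -> G m t - eta <= G n (t - eps)) ->
  exists mu, prob_measure mu /\ vague_cv nu mu.
Proof.
move=> pn nuG Glow Ghigh late.
have [Gi [G1 Gim [Gl Gh] Gige Gile]] := liminf_tail pn nuG Glow Ghigh late.
have [mu [pmu hmu]] := limit_measure G1 Gim Gl Gh.
exists mu; split=> //; exact: (vague_limit pn nuG G1 Gige Gile pmu hmu).
Qed.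

End VagueConvergence.

(** * Conclusion *)

Local Open Scope R_scope.

Lemma borel_scale c A : 0 < c -> borel A -> borel (fun y => A (c * y)).
Proof.
move=> c0; elim=> {A} [a b|A _ IH|A _ IH|A A' e _ IH].
- apply: (@borel_ext (fun y => a / c < y < b / c)); last exact: borel_open.
  move=> y; split=> -[h1 h2]; split.
  + by have := Rmult_lt_compat_l c _ _ c0 h1; have -> : c * (a / c) = a by field; lra.
  + by have := Rmult_lt_compat_l c _ _ c0 h2; have -> : c * (b / c) = b by field; lra.
  + by apply: (Rmult_lt_reg_l c) => //; have -> : c * (a / c) = a by field; lra.
  + by apply: (Rmult_lt_reg_l c) => //; have -> : c * (b / c) = b by field; lra.
- exact: borel_compl.
- exact: borel_cunion.
- by apply: borel_ext IH => y; exact: e.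
Qed.

Lemma pushT_prob c nu : 0 < c -> prob_measure nu -> prob_measure (pushT c nu).
Proof.
move=> c0 [nn [tot add]]; split; [|split].
- by move=> A bA; apply: nn; exact: borel_scale.
- exact: tot.
- move=> A bA dA; apply: (add (fun k y => A k (c * y))).
    by move=> k; exact: borel_scale.
  by move=> i j y; exact: dA.
Qed.

Lemma support_bounds nu (a b : R) : prob_measure nu ->
  nu (fun x => a <= x) = 1 -> (forall t, b < t -> nu (fun x => t <= x) = 0) ->
  forall x, in_support nu x -> a <= x /\ x <= b.
Proof.
move=> pm na nb x sx; split; apply: Rnot_lt_le => lt.
  have := sx ((a - x) / 2) ltac:(lra).
  set I := nu _; have : I <= nu (fun y => ~ (a <= y)).
    apply: mu_mono => //; [exact: borel_open|by apply: borel_compl; exact: borel_ge|].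
    by move=> y; lra.
  have := mu_split pm borel_true (borel_ge a); rewrite mu_true //.
  have -> : nu (fun x => True /\ a <= x) = 1 by rewrite -na; apply: pred_ext => y; tauto.
  have -> : nu (fun x => True /\ ~ a <= x) = nu (fun y => ~ (a <= y)) by apply: pred_ext => y; tauto.
  lra.
have := sx ((x - b) / 2) ltac:(lra); set I := nu _.
have : I <= nu (fun y => x - (x - b) / 2 <= y).
  by apply: mu_mono => //; [exact: borel_open|exact: borel_ge|move=> y; lra].
by rewrite nb; lra.
Qed.

Theorem mainTheorem8 (K : fieldType) (B : comAlgType K) (f : nat -> R)
  (Bn : nat -> B -> Prop) (F : nat -> R -> B -> Prop)
  (nuB : nat -> (R -> Prop) -> R) :
  (forall n, Rle 0 (f n)) ->
  Un_cv (fun n => Rdiv (f n) (INR n)) 0 ->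
  integral_domain B -> graded Bn -> finite_type B -> generated_by (Bn 1%N) ->
  krull_dim_pos B ->
  (forall n, (1 <= n)%N -> filtration_on (Bn n) (F n)) ->
  quasi_filtered f F ->
  limsup_lambda_finite Bn F ->
  (forall n, (1 <= n)%N -> is_nu_W (Bn n) (F n) (nuB n)) ->
  let nu := fun n => pushT (Rinv (INR n)) (nuB n) in
  (exists u : nat -> R, (forall n, (1 <= n)%N -> is_min_lambda Bn F n (u n)) /\
     exists L : R, Un_cv (fun n => Rdiv (u n) (INR n)) L) /\
  (exists a b : R, forall n, (1 <= n)%N -> forall x, in_support (nu n) x ->
     Rle a x /\ Rle x b) /\
  (exists mu, prob_measure mu /\ vague_cv nu mu).
Proof.
move=> f0 fcv domB grB ftB genB dimB filtF qfF [C [N0 hC]] hnu nu.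
have exu n : exists m, (1 <= n)%N -> is_min_lambda Bn F n m /\ forall x, Bn n x -> F n m x.
  (* Degree $0$ carries no filtration; the value there is a mere default. *)
  case: (leqP 1 n) => n1; last by exists 0.
  by have [m hm] := min_lambda domB grB ftB genB dimB filtF n1; exists m.
have [u hu] := boolp.choice exu.
have [n1 [n10 super]] := min_lambda_superadditive grB ftB genB qfF hu.
have ubd n : (N0 <= n)%N -> (1 <= n)%N -> u n / INR n <= C.
  by move=> Nn n1'; have [[[a [Ba [a0 la]]] _] _] := hu n n1'; exact: hC la.
have [l ucv] := almost_superadditive_cv f0 fcv n10 super ubd.
split; first by exists u; split; [by move=> n /hu []|exists l].
have exD n : exists Dn : R -> nat, (1 <= n)%N -> forall r, has_dim (F n r) (Dn r).
  case: (leqP 1 n) => n1'; last by exists (fun=> 0%N).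
  have [Dn hDn] := boolp.choice (fun r => filtration_dim grB ftB genB filtF r n1').
  by exists Dn.
have [D hD'] := boolp.choice exD.
have hD n r : (1 <= n)%N -> has_dim (F n r) (D n r) by move=> n1'; exact: hD'.
have [W hW] := boolp.choice (homogeneous_dim grB genB ftB).
(* Since $u(n)\ge-C_1n$ for all $n\ge1$, every normalised tail equals $1$ up to the level $-C_1$. *)
have [C1 [C10 hC1]] := Un_cv_bounded ucv.
have [C2 [C20 hC2]] := Un_cv_bounded fcv.
have ulow1 n : (1 <= n)%N -> - C1 * INR n <= u n.
  move=> n1'; have np := INR_gt0 n1'.
  have -> : u n = u n / INR n * INR n by field; lra.
  by apply: Rmult_le_compat_r; [lra|have := Rabs_le_inv (hC1 n); lra].
have ulow n : (1 <= n)%N -> - (C1 + C2) * INR n <= u n - f n.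
  move=> n1'; have np := INR_gt0 n1'; have := ulow1 n n1'.
  have : f n / INR n * INR n <= C2 * INR n.
    by apply: Rmult_le_compat_r; [lra|have := Rabs_le_inv (hC2 n); lra].
  have -> : f n / INR n * INR n = f n by field; lra.
  lra.
have Dmono n r s : (1 <= n)%N -> r <= s -> (D n s <= D n r)%N by exact: (dim_mono filtF hD).
have low n t : (1 <= n)%N -> t <= - C1 -> D n (INR n * t) = W n.
  move=> n1' tC; apply: (dim_low filtF hu hD hW n1').
  apply: Rle_trans (ulow1 n n1').
  by have := INR_gt0 n1'; nra.
(* For $n\ge N_0$ the limsup hypothesis gives the common bound [C]; in the finitely many smaller
   degrees [Cf] bounds levels at which the filtration already vanishes. *)
have [tb high] : exists tb, forall n t, (1 <= n)%N -> tb < t -> D n (INR n * t) = 0%N.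
  have exr n : exists r, (1 <= n)%N -> D n r = 0%N.
    case: (leqP 1 n) => n1'; last by exists 0.
    by have [r hr] := dim_zero_exists filtF hD n1'; exists r.
  have [r hr] := boolp.choice exr.
  have [Cf [Cf0 hCf]] := finite_bound (fun n => r n / INR n) N0.
  exists (Rmax C Cf) => n t n1' ht; have np := INR_gt0 n1'.
  have [lt|ge] := ltnP n N0; last first.
    apply: (dim_zero filtF hD n1') => a la Ba a0 hla.
    have -> : la = INR n * (la / INR n) by field; lra.
    apply: Rmult_lt_compat_l => //; apply: (Rle_lt_trans _ C); first exact: hC hla.
    by have := Rmax_l C Cf; lra.
  apply/eqP; rewrite -leqn0 -(hr n n1'); apply: Dmono => //.
  have -> : r n = INR n * (r n / INR n) by field; lra.
  apply: Rmult_le_compat_l; first by lra.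
  by have := Rabs_le_inv (hCf n lt); have := Rmax_r C Cf; lra.
have W0 n := dim_pos domB grB genB dimB hW n.
pose G n t := INR (D n (INR n * t)) / INR (W n).
have pn n : (1 <= n)%N -> prob_measure (nu n).
  move=> n1'; apply: pushT_prob; last by have [] := hnu n n1'.
  exact/Rinv_0_lt_compat/INR_gt0.
have nuG n t : (1 <= n)%N -> nu n (fun x => t <= x) = G n t.
  move=> n1'; have np := INR_gt0 n1'; have [_ h] := hnu n n1'.
  rewrite /nu /pushT /G -(h _ _ _ (hD n (INR n * t) n1') (hW n)).
  apply: pred_ext => y; split=> hy.
    have := Rmult_le_compat_l (INR n) _ _ ltac:(lra) hy.
    by have -> : INR n * (/ INR n * y) = y by field; lra.
  apply: (Rmult_le_reg_l (INR n)) => //.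
  by have -> : INR n * (/ INR n * y) = y by field; lra.
have Glow n t : (1 <= n)%N -> t <= - C1 -> G n t = 1.
  move=> n1' tC; rewrite /G low //; have := INR_gt0 (W0 n) => Wp; by field; lra.
have Ghigh n t : (1 <= n)%N -> tb < t -> G n t = 0.
  by move=> n1' tt; rewrite /G high // /Rdiv Rmult_0_l.
split.
  exists (- C1), tb => n n1' x; apply: support_bounds; first exact: pn.
    by rewrite nuG // Glow //; lra.
  by move=> t tt; rewrite nuG // Ghigh.
have [n2 [e [q [c [n20 q0 Wc dil]]]]] := dim_dilation domB grB ftB genB dimB filtF qfF hu hD hW.
apply: (tail_vague_cv pn nuG Glow Ghigh).
have CC : 0 <= C1 + C2 by lra.
have DW n r : (1 <= n)%N -> (D n r <= W n)%N by exact: (dim_leW filtF hD hW).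
by move=> t eps eta; apply: (normalized_late fcv n20 q0 CC Dmono DW W0 Wc dil ulow low).
Qed.
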